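(* Let $(\Omega,\mathfrak S,\mathbb P,\Theta)$ be a measure-preserving $\mathbb Z^2$-dynamical system and let $Y=(Y_x)_{x\in\mathbb Z^2}$ be i.i.d. rate-1 exponential random variables on $\Omega$ that satisfy $Y_x(\omega)=Y_0(\theta_x\omega)$ $\mathbb P$-almost surely for each $x\in\mathbb Z^2$. Then the following statements hold (simultaneously) with $\mathbb P$-probability one. (i) Each semi-infinite geodesic is $\mathbf u$-directed for some $\mathbf u\in\mathcal U$. (ii) For $r\in\{1,2\}$ and each $x\in\mathbb Z^2$, $\{x_k=x+k\mathbf e_r\}_{k\in\mathbb Z_{\ge0}}$ is the only semi-infinite geodesic that satisfies $x_0=x$ and $\liminf_{k\to\infty}k^{-1}\,x_k\cdot\mathbf e_{3-r}=0$. (iii) For each $\mathbf u\in\mathcal U$ and each $x\in\mathbb Z^2$ there exists a $\mathbf u$-directed semi-infinite geodesic that starts at $x$.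
   Context: Measure-preserving $\mathbb Z^2$-dynamical system: $(\Omega,\mathfrak S,\mathbb P)$ is a probability space and $\Theta=(\theta_x)_{x\in\mathbb Z^2}$ is a group of measurable bijections of $\Omega$ (an action of $\mathbb Z^2$) that preserves $\mathbb P$. Notation: $\mathbf e_1=(1,0)$, $\mathbf e_2=(0,1)$; $|x|_1=|x_1|+|x_2|$; $x\le y$ means coordinatewise order; $\mathcal U=\{(t,1-t):0\le t\le1\}$. An up-right path is a sequence of points of $\mathbb Z^2$ with increments $x_{k+1}-x_k\in\{\mathbf e_1,\mathbf e_2\}$; $\Pi_{x,y}$ is the set of up-right paths $(x_k)_{k=0}^n$ with $x_0=x$, $x_n=y$, $n=|y-x|_1$. The last-passage percolation process is, for $x\le y$ in $\mathbb Z^2$, $G_{x,y}=\max_{x_\bullet\in\Pi_{x,y}}\sum_{k=0}^{|y-x|_1}Y_{x_k}$. An up-right path $(x_i)_{i\in I}$ indexed by a finite or infinite subinterval $I\subset\mathbb Z$ is a geodesic if $G_{x_k,x_\ell}=\sum_{i=k}^{\ell}Y_{x_i}$ for all $k<\ell$ in $I$. A semi-infinite geodesic is a geodesic indexed by $I=\mathbb Z_{\ge0}$; it starts at $x_0$. A semi-infinite geodesic $x_\bullet$ is $\mathbf u$-directed if $x_n/n\to\mathbf u$ as $n\to\infty$. *)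

(* Defs.v *)
From HB Require Import structures.
From mathcomp Require Import all_boot all_order all_algebra finmap.
From mathcomp Require Import all_classical all_reals all_analysis.

Set Implicit Arguments.
Unset Strict Implicit.
Unset Printing Implicit Defensive.

Import Order.TTheory GRing.Theory Num.Theory numFieldNormedType.Exports.

Local Open Scope classical_set_scope.
Local Open Scope ring_scope.

Notation Z2 := (int * int)%type.

(* [unit_vec 1] is (1,0) and [unit_vec 2] is (0,1); only r = 1, 2 are used. *)
Definition unit_vec (r : nat) : Z2 := if r == 1%N then (1, 0) else (0, 1).

Definition dot (x y : Z2) : int := x.1 * y.1 + x.2 * y.2.

Definition l1norm (x : Z2) : nat := (`|x.1| + `|x.2|)%N.

Definition up_right_step (u v : Z2) : bool :=
  (v - u == unit_vec 1) || (v - u == unit_vec 2).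

(* A path (x_k)_{0 <= k <= n} is the sequence of its n + 1 points. *)
Definition up_right_paths (x y : Z2) : set (seq Z2) :=
  [set p | [/\ size p = (l1norm (y - x)).+1,
               sorted up_right_step p,
               p`_0 = x
             & p`_(l1norm (y - x)) = y]].

(* For x <= y coordinatewise there are finitely many, and at least one, up-right
   paths from x to y, so this supremum is a maximum. For other x and y it is a
   supremum over the empty set, which is 0 by convention and is never used. *)
Definition last_passage (R : realType) (Y : Z2 -> R) (x y : Z2) : R :=
  sup [set \sum_(0 <= k < (l1norm (y - x)).+1) Y p`_k
      | p in up_right_paths x y].

Definition semi_infinite_geodesic (R : realType) (Y : Z2 -> R)
    (x : nat -> Z2) : Prop :=
  (forall k, up_right_step (x k) (x k.+1)) /\
  (forall k l, (k < l)%N ->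
     last_passage Y (x k) (x l) = \sum_(k <= i < l.+1) Y (x i)).

Definition directions (R : realType) : set (R * R) :=
  [set (t, 1 - t) | t in `[0, 1]].

Definition directed (R : realType) (u : R * R) (x : nat -> Z2) : Prop :=
  (fun n => ((x n).1%:~R / n%:R, (x n).2%:~R / n%:R) : R * R) @ \oo --> u.

(* Bijectivity of each theta x, and measurability of its inverse theta (- x),
   follow from the action axioms. *)
Definition measure_preserving_action d (T : measurableType d) (R : realType)
    (P : probability T R) (theta : Z2 -> T -> T) : Prop :=
  [/\ (forall w, theta 0 w = w),
      (forall x y w, theta (x + y) w = theta x (theta y w)),
      (forall x, measurable_fun [set: T] (theta x))
    & (forall x (A : set T), measurable A -> P (theta x @^-1` A) = P A)].

Definition mutually_independent d (T : measurableType d) (R : realType)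
    (P : probability T R) (Y : Z2 -> {RV P >-> R}) : Prop :=
  forall (J : {fset Z2}) (A : Z2 -> set R), (forall x, measurable (A x)) ->
    P (\bigcap_(x in [set` J]) (Y x @^-1` A x)) =
    (\prod_(x <- J) P (Y x @^-1` A x))%E.

Definition exponentially_distributed d (T : measurableType d) (R : realType)
    (P : probability T R) (rate : R) (X : {RV P >-> R}) : Prop :=
  forall A : set R, measurable A ->
    distribution P X A = exponential_prob rate A.

(* Main.v *)
Require Import Defs.
From HB Require Import structures.
From mathcomp Require Import all_boot all_order all_algebra finmap.
From mathcomp Require Import ring lra zify.
From mathcomp Require Import all_classical all_reals all_analysis.
From mathcomp Require Import measurable_realfun.
Import Order.TTheory GRing.Theory Num.Theory numFieldNormedType.Exports.
Local Open Scope classical_set_scope.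
Local Open Scope ring_scope.

(* Fix [0 < rho < 1] and put the corner of a quadrant at [x + (N, N)], with
   boundary weights [Y / (1 - rho)] and [Y / rho] on its two axes.  By Burke's
   property the last-passage times H_rho to this corner have, along every row
   (column), i.i.d. exponential increments of rate [1 - rho] ([rho]).  The path
   from x that follows the larger of the two values of H_rho is a geodesic until
   it reaches the boundary.  If it passes through x + z, then
     H_rho(x) - H_rho(x + z) = (weight of the path)
                            <= H_sigma(x) - H_sigma(x + z) for every sigma;
   Chernoff bounds turn this into [f_rho z <= f_sigma z + del * |z|], where
   [f_rho z = z.1 / (1 - rho) + z.2 / rho], and this fails for a suitable sigma
   when z is outside a cone around the characteristic direction of rho.  The
   bounds are uniform in N, so a limit along good values of N gives, almost
   surely, a geodesic from x that stays in a prescribed cone.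

   Finite geodesics are almost surely unique, so geodesics with a common starting
   point never cross.  Geodesics confined to arbitrarily thin cones then force
   every geodesic to have a direction, and their limits have any given direction.
   As rho tends to 0 the vertical increment of H_rho exceeds the weight of x with
   probability tending to 1; so there is a geodesic from x with a horizontal first
   step and a direction other than (1, 0).  It blocks any (1, 0)-directed geodesic
   from x whose first step is vertical. *)

Set Implicit Arguments.
Unset Strict Implicit.
Unset Printing Implicit Defensive.

(** Off the boundary the weights are the same for all parameters, so a path that is optimal for rho
    is a competitor for every sigma; this is the source of the inequality between increments. The
    gap between f_rho and f_sigma exists because, for fixed z, f_rho z is minimal in rho where z
    points in the characteristic direction of rho; away from it, a shift of the parameter gains an
    amount linear in |z|. The obstacle is the limit in N. The corner moves with N, and the bounds on
    the bad events do not decay in N, so they cannot be summed. But each bad event has probability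
    at most e, uniformly in N, hence so does the event that all large N are bad. Off that event
    infinitely many N are good, compactness of the space of paths gives a limit, and e is arbitrary.
    Almost sure statements can be combined only countably often. The deterministic part therefore
    starts from cones with rational ends and reaches all real directions through the left-right
    order of geodesics. *)

Section MeasureUniqueness.
Context {R : realType}.

(** Rectangles are stable under intersection and generate the product sigma-algebra, so finite
    measures that agree on them are equal. General [m] and [m'] admit restrictions and multiples of
    a probability. *)
Lemma eq_joint_law d (T : measurableType d) d1 (T1 : measurableType d1)
    d2 (T2 : measurableType d2) (m m' : {measure set T -> \bar R})
    (X X' : T -> T1) (Y Y' : T -> T2) :
  (m setT < +oo)%E ->
  measurable_fun setT X -> measurable_fun setT X' ->
  measurable_fun setT Y -> measurable_fun setT Y' ->
  (forall A B, measurable A -> measurable B ->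
     m [set w | A (X w) /\ B (Y w)] = m' [set w | A (X' w) /\ B (Y' w)]) ->
  forall S : set (T1 * T2), measurable S ->
    m [set w | S (X w, Y w)] = m' [set w | S (X' w, Y' w)].
Proof.
move=> moo mX mX' mY mY' mm' S mS.
have mXY : measurable_fun setT (fun w => (X w, Y w)) by exact/measurable_fun_pair.
have mXY' : measurable_fun setT (fun w => (X' w, Y' w)) by exact/measurable_fun_pair.
pose p : {measure set (T1 * T2) -> \bar R} :=
  [the measure _ _ of pushforward m (fun w => (X w, Y w))].
pose p' : {measure set (T1 * T2) -> \bar R} :=
  [the measure _ _ of pushforward m' (fun w => (X' w, Y' w))].
have -> : m [set w | S (X w, Y w)] = p mXY S by [].
have -> : m' [set w | S (X' w, Y' w)] = p' mXY' S by [].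
apply: (@measure_unique _ R _
  [set A `*` B | A in measurable & B in measurable] (fun=> setT) _ _ _ _ (p mXY) (p' mXY')) => //.
- by rewrite measurable_prod_measurableType.
- move=> _ _ [A mA [B mB <-]] [A' mA' [B' mB' <-]]; rewrite -setXI.
  by exists (A `&` A'); [exact: measurableI|exists (B `&` B') => //; exact: measurableI].
- by move=> _; exists setT => //; exists setT => //; rewrite setXTT.
- by rewrite bigcup_const.
- by move=> _ [A mA [B mB <-]]; rewrite /p /p' /= /pushforward; exact: mm'.
Qed.

Lemma eq_law_rays d (T : measurableType d) d' (T' : measurableType d')
    (m : {measure set T -> \bar R}) (m' : {measure set T' -> \bar R})
    (X : T -> R) (X' : T' -> R) :
  (m setT < +oo)%E -> measurable_fun setT X -> measurable_fun setT X' ->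
  (forall r, m [set w | r < X w] = m' [set w | r < X' w]) ->
  forall A : set R, measurable A ->
    m [set w | A (X w)] = m' [set w | A (X' w)].
Proof.
move=> moo mX mX' mm' A mA.
pose p : {measure set R -> \bar R} := [the measure _ _ of pushforward m X].
pose p' : {measure set R -> \bar R} := [the measure _ _ of pushforward m' X'].
have -> : m [set w | A (X w)] = p mX A by [].
have -> : m' [set w | A (X' w)] = p' mX' A by [].
apply: (@measure_unique _ R _ (@RGenOInfty.G R) (fun n => `]-n%:R, +oo[%classic)
  _ _ _ _ (p mX) (p' mX')) => //.
- exact: RGenOInfty.measurableE.
- move=> _ _ [x ->] [y ->]; exists (Num.max x y).
  by apply/seteqP; split => z /=; rewrite !in_itv/= !andbT gt_max;
    [case=> -> ->|move/andP].
- by move=> i; exists (- i%:R).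
- apply/seteqP; split => // x _; exists (Num.trunc `|x|).+1 => //=.
  rewrite in_itv/= andbT ltrNl.
  by rewrite (le_lt_trans (ler_norm _))// normrN truncnS_gt.
- move=> _ [x ->]; rewrite /p /p' /= /pushforward.
  have E (U : Type) (Z : U -> R) : Z @^-1` `]x, +oo[ = [set w | x < Z w].
    by apply/seteqP; split => w /=; rewrite in_itv/= andbT.
  by rewrite !E.
- move=> k; apply: le_lt_trans moo; rewrite /p /= /pushforward.
  apply: le_measure => //; rewrite inE// -[X in measurable X]setTI.
  exact: mX.
Qed.

End MeasureUniqueness.

(** * Independent families *)

Section Independence.
Context d {T : measurableType d} {R : realType} (P : probability T R).
Context {I : eqType}.
Implicit Types (K : set I) (X : I -> T -> R).

(** Independence of the subfamily indexed by [K], tested on duplicate-free lists. The index type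
    stays fixed while [K] shrinks, because the transformations below overwrite some variables and
    give up others. *)
Definition indep K X :=
  (forall k, K k -> measurable_fun setT (X k)) /\
  (forall s : seq I, uniq s -> (forall k, k \in s -> K k) ->
   forall A : I -> set R, (forall k, measurable (A k)) ->
     P [set w | forall k, k \in s -> A k (X k w)] =
     (\prod_(k <- s) P [set w | A k (X k w)])%E).

Lemma indep_sub K K' X : K' `<=` K -> indep K X -> indep K' X.
Proof.
move=> KK' [mX iX]; split=> [k /KK'/mX//|s us sK]; apply: iX => // k /sK.
exact: KK'.
Qed.

Lemma eq_indep K X X' : (forall k, K k -> X k = X' k) -> indep K X -> indep K X'.
Proof.
move=> XX' [mX iX]; split=> [k Kk|s us sK A mA]; first by rewrite -XX'//; exact: mX.
rewrite (_ : [set w | _] = [set w | forall k, k \in s -> A k (X k w)]); last first.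
  by apply/seteqP; split => w /= h k ks; have := h _ ks; rewrite (XX' k)//; exact: sK.
rewrite iX//; apply: eq_big_seq => k ks; rewrite (XX' k)//; exact: sK.
Qed.

Lemma measurable_box (s : seq I) X (A : I -> set R) :
  (forall k, k \in s -> measurable_fun setT (X k)) ->
  (forall k, measurable (A k)) ->
  measurable [set w | forall k, k \in s -> A k (X k w)].
Proof.
elim: s => [|a s IH] mX mA.
  by rewrite (_ : mkset _ = setT)//; apply/seteqP; split.
rewrite (_ : mkset _ = (X a @^-1` A a) `&` [set w | forall k, k \in s -> A k (X k w)]).
  apply: measurableI; last by apply: IH => // k ks; apply: mX; rewrite inE ks orbT.
  by rewrite -[X in measurable X]setTI; apply: mX => //; rewrite mem_head.
apply/seteqP; split => w /=.
  move=> h; split; first by apply: h; rewrite mem_head.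
  by move=> k ks; apply: h; rewrite inE ks orbT.
by move=> [ha h] k; rewrite inE => /predU1P[->|/h].
Qed.

(** For rectangles [S] this is the definition. Both sides are finite measures in [S], namely [P]
    restricted to the event on [t] and [P] scaled by the probability of that event, so the identity
    extends to all measurable [S]. *)
Lemma indep_pair K X (a b : I) (t : seq I) (A : I -> set R) (S : set (R * R)) :
  indep K X -> uniq [:: a, b & t] -> (forall k, k \in [:: a, b & t] -> K k) ->
  (forall k, measurable (A k)) -> measurable S ->
  P [set w | S (X a w, X b w) /\ forall k, k \in t -> A k (X k w)] =
  (P [set w | S (X a w, X b w)] * P [set w | forall k, k \in t -> A k (X k w)])%E.
Proof.
move=> [mX iX] us sK mA mS.
have mXa : measurable_fun setT (X a) by apply/mX/sK; rewrite mem_head.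
have mXb : measurable_fun setT (X b) by apply/mX/sK; rewrite !inE eqxx orbT.
pose D := [set w | forall k, k \in t -> A k (X k w)].
have mD : measurable D.
  by apply: measurable_box => // k kt; apply/mX/sK; rewrite !inE kt !orbT.
have PD : (P D)%E = (fine (P D))%:E by rewrite fineK ?fin_num_measure.
have D0 : 0 <= fine (P D) by rewrite fine_ge0.
pose m : {measure set T -> \bar R} := mrestr P mD.
pose m' : {measure set T -> \bar R} := mscale (NngNum D0) P.
have m'E B : m' B = (P D * P B)%E.
  by rewrite /m' /= /mscale; congr (_ * _)%E; exact/esym.
suff : m [set w | S (X a w, X b w)] = m' [set w | S (X a w, X b w)].
  by rewrite m'E muleC.
apply: eq_joint_law => //.
  rewrite /m /= /mrestr setTI; apply: le_lt_trans (ltry 1).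
  exact: probability_le1.
move=> B C mB mC; rewrite m'E /m /= /mrestr.
pose A' k := if k == a then B else if k == b then C else A k.
have mA' k : measurable (A' k) by rewrite /A'; case: eqP => // _; case: eqP.
move: us; rewrite /= inE negb_or => /and3P[/andP[ab aNt] bNt ut].
have A't k : k \in t -> A' k = A k.
  rewrite /A' => kt; case: eqP kt => [->|_ kt]; first by rewrite (negPf aNt).
  by case: eqP kt => [->|//]; rewrite (negPf bNt).
have A'a : A' a = B by rewrite /A' eqxx.
have A'b : A' b = C by rewrite /A' eq_sym (negPf ab) eqxx.
have uab : uniq [:: a, b & t] by rewrite /= inE negb_or ab aNt bNt.
have := iX [:: a, b & t] uab sK A' mA'.
have ua : uniq [:: a; b] by rewrite /= inE ab.
have sKa k : k \in [:: a; b] -> K k.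
  by rewrite !inE => /orP[]/eqP->; apply: sK; rewrite !inE eqxx ?orbT.
have := iX [:: a; b] ua sKa A' mA'.
have sKt k : k \in t -> K k by move=> kt; apply: sK; rewrite !inE kt !orbT.
have := iX t ut sKt A' mA'.
rewrite !big_cons big_nil mule1 A'a A'b.
rewrite (_ : [set w | forall k, k \in t -> A' k (X k w)] = D); last first.
  by apply/seteqP; split => w /= h k kt; have := h _ kt; rewrite A't.
move=> <-.
rewrite (_ : [set w | forall k, k \in [:: a; b] -> A' k (X k w)] =
             [set w | B (X a w) /\ C (X b w)]); last first.
  apply/seteqP; split => w /= h.
    split; first by rewrite -A'a; apply: h; rewrite mem_head.
    by rewrite -A'b; apply: h; rewrite !inE eqxx orbT.
  by move=> k; rewrite !inE => /orP[]/eqP->; rewrite ?A'a ?A'b; case: h.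
move=> ->; rewrite muleA [in RHS]muleC => <-; congr (P _).
apply/seteqP; split => w /=.
  move=> [[hB hC] hD] k; rewrite !inE => /or3P[/eqP->|/eqP->|kt];
    rewrite ?A'a ?A'b//.
  by rewrite A't//; exact: hD.
move=> h; split; last by move=> k kt; rewrite -A't//; apply: h; rewrite !inE kt !orbT.
split; first by rewrite -A'a; apply: h; rewrite mem_head.
by rewrite -A'b; apply: h; rewrite !inE eqxx orbT.
Qed.

End Independence.

Section IndependenceTransforms.
Context d {T : measurableType d} {R : realType} (P : probability T R).
Context {I : eqType}.
Implicit Types (K : set I) (X : I -> T -> R).

Definition replace2 X (a b : I) (f g : R * R -> R) (k : I) (w : T) : R :=
  if k == a then f (X a w, X b w) else if k == b then g (X a w, X b w) else X k w.

(** By [indep_pair] the pair is independent of the remaining variables, so it is enough that the two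
    new variables are independent of each other. *)
Lemma indep_replace2 K X (a b : I) (f g : R * R -> R) :
  indep P K X -> a != b -> K a -> K b ->
  measurable_fun setT f -> measurable_fun setT g ->
  (forall A B, measurable A -> measurable B ->
    P [set w | A (f (X a w, X b w)) /\ B (g (X a w, X b w))] =
    (P [set w | A (f (X a w, X b w))] * P [set w | B (g (X a w, X b w))])%E) ->
  indep P K (replace2 X a b f g).
Proof.
move=> indX ab Ka Kb mf mg fg; have [mX iX] := indX.
have mXab : measurable_fun setT (fun w => (X a w, X b w)).
  by apply/measurable_fun_pair; exact: mX.
set X' := replace2 _ _ _ _ _.
have X'a : X' a = fun w => f (X a w, X b w).
  by apply/funext => w; rewrite /X' /replace2 eqxx.
have X'b : X' b = fun w => g (X a w, X b w).
  by apply/funext => w; rewrite /X' /replace2 eq_sym (negPf ab) eqxx.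
have X'k k : k != a -> k != b -> X' k = X k.
  by move=> ka kb; apply/funext => w; rewrite /X' /replace2 (negPf ka) (negPf kb).
have mX' k : K k -> measurable_fun setT (X' k).
  have [-> _|ka] := eqVneq k a; first by rewrite X'a; exact: measurableT_comp.
  have [-> _|kb Kk] := eqVneq k b; first by rewrite X'b; exact: measurableT_comp.
  by rewrite X'k//; exact: mX.
split=> // s us sK A mA.
(* Padding with the full set lets [a] and [b] be treated as members of the list even when [s] omits
   them. *)
pose A' k := if k \in s then A k else setT.
have mA' k : measurable (A' k) by rewrite /A'; case: ifP.
pose t := [seq k <- s | (k != a) && (k != b)].
have tP k : k \in t -> [/\ k \in s, k != a & k != b].
  by rewrite mem_filter => /andP[/andP[-> ->] ->].
have ut : uniq [:: a, b & t].
  rewrite /= inE negb_or ab !mem_filter !eqxx /= andbF/= filter_uniq//.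
have tK k : k \in [:: a, b & t] -> K k.
  by rewrite !inE => /or3P[/eqP->|/eqP->|/tP[/sK]].
have E1 : [set w | forall k, k \in s -> A k (X' k w)] =
    [set w | [set p | A' a (f p) /\ A' b (g p)] (X a w, X b w) /\
             forall k, k \in t -> A' k (X k w)].
  apply/seteqP; split => w /= h.
    split; first split.
    - rewrite /A'; case: ifP => // /h; by rewrite X'a.
    - rewrite /A'; case: ifP => // /h; by rewrite X'b.
    - by move=> k /tP[ks ka kb]; rewrite /A' ks -X'k//; exact: h.
  case: h => [[ha hb] h] k ks.
  have [ka|ka] := eqVneq k a.
    by move: ha; rewrite /A' -ka ks ka X'a.
  have [kb|kb] := eqVneq k b.
    by move: hb; rewrite /A' -kb ks kb X'b.
  have := h k; rewrite /A' ks X'k// mem_filter ka kb ks; exact.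
have mS : measurable [set p | A' a (f p) /\ A' b (g p)].
  apply: measurableI.
    by rewrite -[X in measurable X]setTI; exact: mf.
  by rewrite -[X in measurable X]setTI; exact: mg.
rewrite E1 (indep_pair indX ut)// fg//.
rewrite iX//; last 2 first.
- by move: ut => /and3P[].
- by move=> k /tP[/sK].
pose F k := P [set w | A' k (X' k w)].
have PT : P setT = 1%E by exact: probability_setT.
have FT k : k \notin s -> F k = 1%E.
  by move=> ks; rewrite /F /A' (negPf ks) -PT; congr (P _); apply/seteqP; split.
have E2 : (\prod_(k <- s) P [set w | A k (X' k w)] = \prod_(k <- s) F k)%E.
  by apply: eq_big_seq => k ks; rewrite /F /A' ks.
have E3 : (\prod_(k <- t) P [set w | A' k (X k w)] = \prod_(k <- t) F k)%E.
  by apply: eq_big_seq => k /tP[ks ka kb]; rewrite /F X'k.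
rewrite E2 E3 /t big_filter.
have split1 (Q : pred I) c : Q c ->
    (\prod_(k <- s | Q k) F k = F c * \prod_(k <- s | Q k && (k != c)) F k)%E.
  move=> Qc; have [cs|cs] := boolP (c \in s).
    rewrite (big_rem c cs)/= Qc rem_filter// big_filter_cond; congr (_ * _)%E.
    by apply: eq_bigl => k /=; rewrite andbC.
  rewrite FT// mul1e big_seq_cond [in RHS]big_seq_cond; apply: eq_bigl => k.
  case: (boolP (k \in s)) => //= ks; case: (Q k) => //=.
  by apply/esym; apply: contraNneq cs => <-.
have Fa : P [set w | A' a (f (X a w, X b w))] = F a by rewrite /F X'a.
have Fb : P [set w | A' b (g (X a w, X b w))] = F b by rewrite /F X'b.
by rewrite Fa Fb (split1 xpredT a)// (split1 (fun k => k != a) b) 1?eq_sym//= muleA.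
Qed.

(** The second output is the constant 0, which is independent of everything; its index is then
    dropped. *)
Lemma indep_merge K X (a b : I) (f : R * R -> R) :
  indep P K X -> a != b -> K a -> K b -> measurable_fun setT f ->
  indep P (K `\ b) (fun k w => if k == a then f (X a w, X b w) else X k w).
Proof.
move=> iX ab Ka Kb mf.
have : indep P K (replace2 X a b f (cst 0)).
  apply: indep_replace2 => // A B mA mB.
  have [B0|nB0] := pselect (B 0).
    rewrite (_ : [set w | B _] = setT); last by apply/seteqP; split.
    rewrite probability_setT mule1; congr (P _).
    by apply/seteqP; split => w //=; case.
  rewrite (_ : [set w | B _] = set0); last by apply/seteqP; split.
  rewrite measure0 mule0 (_ : [set w | _] = set0) ?measure0//.
  by apply/seteqP; split => w //= -[].
move=> /(@indep_sub _ _ _ _ _ _ (K `\ b)) H.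
apply: eq_indep (H _); last by move=> k [].
by move=> k [_ /= /eqP kb]; apply/funext => w; rewrite /replace2 (negPf kb).
Qed.

End IndependenceTransforms.

(** * Exponential variables *)

Section ExponentialVariables.
Context d {T : measurableType d} {R : realType} (P : probability T R).
Implicit Types (X Y : T -> R).

Definition has_exp_law (rate : R) X :=
  forall r, P [set w | r < X w] = (expR (- (rate * Num.max r 0)))%:E.

Definition independent2 X Y := forall A B, measurable A -> measurable B ->
  P [set w | A (X w) /\ B (Y w)] = (P [set w | A (X w)] * P [set w | B (Y w)])%E.

(** Conditioning on [D] without division: in the applications [c] is the probability of [D]. *)
Lemma law_rays_cond (D : set T) (c : R) X X' :
  measurable D -> 0 <= c -> measurable_fun setT X -> measurable_fun setT X' ->
  (forall r, P [set w | D w /\ r < X w] = (c%:E * P [set w | (r < X' w)%R])%E) ->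
  forall A : set R, measurable A ->
    P [set w | D w /\ A (X w)] = (c%:E * P [set w | A (X' w)])%E.
Proof.
move=> mD c0 mX mX' H A mA.
pose m : {measure set T -> \bar R} := mrestr P mD.
pose m' : {measure set T -> \bar R} := mscale (NngNum c0) P.
have mE (B : set T) : m B = P [set w | D w /\ B w].
  by rewrite /m /= /mrestr setIC.
have -> : P [set w | D w /\ A (X w)] = m [set w | A (X w)] by rewrite mE.
change (c%:E * P [set w | A (X' w)])%E with (m' [set w | A (X' w)]).
apply: eq_law_rays => //.
  by rewrite /m /= /mrestr setTI; apply: le_lt_trans (ltry 1); exact: probability_le1.
by move=> r; rewrite mE; exact: H.
Qed.

Lemma joint_law_cond (D : set T) (c : R) X X' Y Y' :
  measurable D -> 0 <= c -> measurable_fun setT X -> measurable_fun setT X' ->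
  measurable_fun setT Y -> measurable_fun setT Y' ->
  (forall A B, measurable A -> measurable B ->
    P [set w | D w /\ (A (X w) /\ B (Y w))] =
    (c%:E * P [set w | A (X' w) /\ B (Y' w)])%E) ->
  forall S : set (R * R), measurable S ->
    P [set w | D w /\ S (X w, Y w)] = (c%:E * P [set w | S (X' w, Y' w)])%E.
Proof.
move=> mD c0 mX mX' mY mY' H S mS.
pose m : {measure set T -> \bar R} := mrestr P mD.
pose m' : {measure set T -> \bar R} := mscale (NngNum c0) P.
have mE (B : set T) : m B = P [set w | D w /\ B w].
  by rewrite /m /= /mrestr setIC.
have -> : P [set w | D w /\ S (X w, Y w)] = m [set w | S (X w, Y w)] by rewrite mE.
change (c%:E * P [set w | S (X' w, Y' w)])%E with (m' [set w | S (X' w, Y' w)]).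
apply: eq_joint_law => //.
  by rewrite /m /= /mrestr setTI; apply: le_lt_trans (ltry 1); exact: probability_le1.
by move=> A B mA mB; rewrite mE; exact: H.
Qed.

Lemma measurable_preim X (A : set R) :
  measurable_fun setT X -> measurable A -> measurable [set w | A (X w)].
Proof. by move=> mX mA; rewrite -[X in measurable X]setTI; exact: mX. Qed.

Lemma measurable_ray X r : measurable_fun setT X -> measurable [set w | r < X w].
Proof.
move=> mX; rewrite (_ : mkset _ = [set w | `]r, +oo[%classic (X w)]).
  exact: measurable_preim.
by apply/seteqP; split => w /=; rewrite in_itv/= andbT.
Qed.

Lemma exp_law_memoryless rate X r (A : set R) :
  measurable_fun setT X -> has_exp_law rate X -> 0 <= r -> measurable A ->
  P [set w | r < X w /\ A (X w - r)] =
  ((expR (- (rate * r)))%:E * P [set w | A (X w)])%E.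
Proof.
move=> mX eX r0 mA.
apply: (law_rays_cond (D := [set w | r < X w]) (X := fun w => X w - r)) => //.
- exact: measurable_ray.
- exact: measurable_funB.
move=> s; rewrite eX -EFinM -expRD -opprD -mulrDr.
rewrite (_ : [set w | _ /\ _] = [set w | r + Num.max s 0 < X w]).
  by rewrite eX; congr (expR (- (_ * _)))%:E; apply/max_idPl; rewrite addr_ge0// le_max lexx orbT.
apply/seteqP; split => w /=; rewrite addr_maxr gt_max addr0 ltrBrDl.
  by case=> -> ->.
by case/andP.
Qed.

Lemma exp_law_setT rate X r : has_exp_law rate X -> r <= 0 ->
  P [set w | r < X w] = 1%E.
Proof. by move=> -> r0; rewrite (max_idPr r0) mulr0 oppr0 expR0. Qed.

Lemma exp_law_min al be X Y : independent2 X Y ->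
  has_exp_law al X -> has_exp_law be Y ->
  has_exp_law (al + be) (fun w => Num.min (X w) (Y w)).
Proof.
move=> iXY eX eY r.
rewrite (_ : [set w | _] = [set w | `]r, +oo[%classic (X w) /\ `]r, +oo[%classic (Y w)]).
  rewrite iXY//.
  rewrite (_ : [set w | _] = [set w | r < X w]); last first.
    by apply/seteqP; split => w /=; rewrite in_itv/= andbT.
  rewrite (_ : [set w | `]r, +oo[%classic (Y w)] = [set w | r < Y w]); last first.
    by apply/seteqP; split => w /=; rewrite in_itv/= andbT.
  by rewrite eX eY -EFinM -expRD -opprD mulrDl.
by apply/seteqP; split => w /=; rewrite !in_itv/= !andbT lt_min => /andP.
Qed.

(** Given that both variables exceed [r], the pair lowered by [r] has its original law, and the
    shift leaves the difference unchanged. So the size of the minimum carries no information on the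
    difference. *)
Lemma exp_law_min_diff al be X Y :
  measurable_fun setT X -> measurable_fun setT Y -> independent2 X Y ->
  has_exp_law al X -> has_exp_law be Y ->
  independent2 (fun w => Num.min (X w) (Y w)) (fun w => X w - Y w).
Proof.
move=> mX mY iXY eX eY.
have eM := exp_law_min iXY eX eY.
have mM : measurable_fun setT (fun w => Num.min (X w) (Y w)) by exact: measurable_minr.
have mD : measurable_fun setT (fun w => X w - Y w) by exact: measurable_funB.
move=> A B mA mB.
have mE : measurable [set w | B (X w - Y w)] by exact: measurable_preim.
have PE : (fine (P [set w | B (X w - Y w)]))%:E = P [set w | B (X w - Y w)].
  by rewrite fineK ?fin_num_measure.
rewrite (_ : [set w | _ /\ _] =
    [set w | [set w | B (X w - Y w)] w /\ A (Num.min (X w) (Y w))]); last first.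
  by apply/seteqP; split => w /= [].
rewrite (law_rays_cond (c := fine (P [set w | B (X w - Y w)]))
  (X' := fun w => Num.min (X w) (Y w))) ?fine_ge0//; first by rewrite PE muleC.
have main r : 0 <= r ->
    P [set w | B (X w - Y w) /\ r < Num.min (X w) (Y w)] =
    ((expR (- ((al + be) * r)))%:E * P [set w | B (X w - Y w)%R])%E.
  move=> r0.
  pose D := [set w | r < X w /\ r < Y w].
  have mDD : measurable D by apply: measurableI; exact: measurable_ray.
  have mS : measurable [set p : R * R | B (p.1 - p.2)].
    rewrite (_ : mkset _ = (fun p : R * R => p.1 - p.2) @^-1` B)//.
    by rewrite -[X in measurable X]setTI; apply: measurable_funB.
  rewrite (_ : [set w | _ /\ _] =
      [set w | D w /\ [set p | B (p.1 - p.2)] (X w - r, Y w - r)]); last first.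
    apply/seteqP; split => w /=; rewrite lt_min opprD opprK addrACA addNr addr0.
      by case=> ? /andP.
    by case=> -[-> ->].
  rewrite (joint_law_cond (c := expR (- ((al + be) * r))) (X' := X) (Y' := Y))
    ?expR_ge0//; do ?exact: measurable_funB.
  move=> A' B' mA' mB'.
  rewrite (_ : [set w | _ /\ _] =
    [set w | [set x | r < x /\ A' (x - r)] (X w) /\
             [set x | r < x /\ B' (x - r)] (Y w)]); last first.
    by apply/seteqP; split => w /= [[? ?] [? ?]].
  have mshift (C : set R) : measurable C -> measurable [set x | r < x /\ C (x - r)].
    move=> mC; rewrite (_ : mkset _ = `]r, +oo[%classic `&` ((fun x => x - r) @^-1` C)).
      apply: measurableI => //; rewrite -[X in measurable X]setTI.
      by apply: measurable_funB.
    by apply/seteqP; split => x /=; rewrite in_itv/= andbT.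
  rewrite iXY ?mshift//; try exact: mshift.
  rewrite (exp_law_memoryless mX eX)// (exp_law_memoryless mY eY)// iXY//.
  by rewrite mulrDl opprD expRD EFinM muleACA.
move=> r; rewrite PE; have [r0|r0] := leP 0 r.
  by rewrite main// eM (max_idPl r0) muleC.
rewrite (exp_law_setT eM) ?mule1 ?ltW//.
(* For [r < 0] the event lies between its version for [r = 0] and the event on the difference alone,
   which have the same probability. *)
apply/eqP; rewrite eq_le; apply/andP; split.
  apply: le_measure; rewrite ?inE//; last by move=> w [].
  by apply: measurableI => //; exact: measurable_ray.
have := main 0 (lexx _); rewrite mulr0 oppr0 expR0 mul1e => <-.
apply: le_measure; rewrite ?inE//; last first.
- by move=> w /= [? h]; split => //; exact: lt_trans h.
- by apply: measurableI => //; exact: measurable_ray.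
- by apply: measurableI => //; exact: measurable_ray.
Qed.

End ExponentialVariables.

Section ExponentialDensity.
Context {R : realType}.
Local Notation leb := (@lebesgue_measure R).
Variable rate : R.
Hypothesis rate0 : 0 < rate.

Let nu : probability (measurableTypeR R) R.
Proof. refine [the probability _ _ of @exponential_prob R rate]; exact: rate0. Defined.

Let exponential_prob_dominates : nu `<< leb.
Proof.
apply/null_content_dominatesP => A mA A0; apply: null_set_integral => //=.
by apply: measurable_funTS; apply/measurable_EFinP; exact: measurable_exponential_pdf.
Qed.

Lemma exponential_prob_ray (r : R) :
  exponential_prob rate `]r, +oo[ = (expR (- (rate * Num.max r 0)))%:E.
Proof.
have nuE A : exponential_prob rate A = nu A by [].
have neg : nu `]-oo, 0[%classic = 0%E.
  change (exponential_prob rate `]-oo, (0:R)[ = 0%E).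
  rewrite /exponential_prob; apply: integral0_eq => x /=; rewrite in_itv/= => x0.
  by rewrite lt0_exponential_pdf.
have pos x : 0 < x -> nu `]x, +oo[%classic = (expR (- (rate * x)))%:E.
  move=> x0.
  have : nu (`]-oo, 0[%classic `|` `[0, x]%classic) = (1 - (expR (- rate * x))%:E)%E.
    rewrite measureU//; last first.
      apply/seteqP; split => // y [/=]; rewrite !in_itv/= => y0 /andP[].
      by rewrite leNgt y0.
    move: (exponential_prob_itv0c rate x0) => itv0c.
    by rewrite -itv0c [X in (X + _)%E = _]neg add0e.
  rewrite (_ : _ `|` _ = ~` `]x, +oo[%classic); last first.
    apply/seteqP; split => y /=; rewrite !in_itv/= andbT.
      by case=> [y0|/andP[_ yx]]; apply/negP; rewrite -leNgt// ltW// (lt_trans y0).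
    move/negP; rewrite -leNgt => yx; case: (ltP y 0) => y0; first by left.
    by right; rewrite yx.
  have nA : nu `]x, +oo[%classic \is a fin_num by exact: fin_num_measure.
  rewrite probability_setC// -(fineK nA) -!EFinB mulNr => -[] h.
  by congr EFin; lra.
have zero : nu [set 0] = 0%E.
  move/null_content_dominatesP : exponential_prob_dominates; apply => //.
  exact: lebesgue_measure_set1.
have pos0 : nu `]0, +oo[%classic = 1%E.
  have := @probability_setC _ _ _ nu _ (measurable_itv `]-oo, (0:R)[).
  rewrite setCitvl neg sube0 => <-.
  rewrite (_ : `[0, +oo[%classic = [set 0] `|` `]0, +oo[%classic); last first.
    apply/seteqP; split => y /=; rewrite !in_itv/= !andbT le_eqVlt.
      by case/predU1P => [->|]; [left|right].
    by case=> [->|->]; rewrite ?eqxx ?orbT.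
  rewrite measureU//; first by rewrite [X in (X + _)%E]zero add0e.
  by apply/seteqP; split => // y [-> /=]; rewrite in_itv/= ltxx.
change (nu `]r, +oo[%classic = (expR (- (rate * Num.max r 0)))%:E).
have [r0|r0] := ltP 0 r; first exact: pos.
rewrite mulr0 oppr0 expR0; apply/eqP; rewrite eq_le probability_le1//=.
rewrite -pos0; apply: le_measure; rewrite ?inE//.
by move=> y /=; rewrite !in_itv/= !andbT; exact: le_lt_trans.
Qed.

(** The Radon-Nikodym derivative of [nu] agrees almost everywhere with the density, since both
    integrate to [nu] over every measurable set. *)
Lemma ge0_integral_exponential_prob (f : R -> \bar R) : (forall x, 0 <= f x)%E ->
  measurable_fun setT f ->
  (\int[nu]_x f x = \int[leb]_x (f x * (exponential_pdf rate x)%:E))%E.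
Proof.
move=> f0 mf.
have dom := exponential_prob_dominates.
rewrite -(Radon_Nikodym_SigmaFinite.change_of_variables dom)//.
apply: ae_eq_integral => //.
- apply: emeasurable_funM => //; apply: measurable_int.
  exact: Radon_Nikodym_SigmaFinite.f_integrable.
- apply: emeasurable_funM => //; apply/measurable_EFinP.
  exact: measurable_exponential_pdf.
- apply: ae_eqe_mul2l; apply: integral_ae_eq => //.
  + exact: Radon_Nikodym_SigmaFinite.f_integrable.
  + by apply/measurable_EFinP; exact: measurable_exponential_pdf.
  + by move=> A _ mA; rewrite -Radon_Nikodym_SigmaFinite.f_integral.
Qed.

(** Exponential tilting: [expR (t * x)] times the density of rate [rate] is [rate / (rate - t)]
    times the density of rate [rate - t]. *)
Lemma exponential_prob_mgf (t : R) : t < rate ->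
  (\int[exponential_prob rate]_x (expR (t * x))%:E = (rate / (rate - t))%:E)%E.
Proof.
move=> trate; change (\int[nu]_x (expR (t * x))%:E = (rate / (rate - t))%:E)%E.
have c0 : 0 < rate - t by rewrite subr_gt0.
rewrite ge0_integral_exponential_prob//; last first.
  apply/measurable_EFinP => /=.
  have h1 := @measurable_expR R.
  have h2 := @mulrl_measurable R setT t.
  exact: (measurableT_comp h1 h2).
transitivity (\int[leb]_x ((rate / (rate - t))%:E *
    (exponential_pdf (rate - t) x)%:E))%E.
  apply: eq_integral; move=> x _; rewrite -!EFinM; congr EFin.
  rewrite /exponential_pdf !patchE; case: ifP => _; last by rewrite !mulr0.
  rewrite [RHS]mulrA divfK ?gt_eqF// mulrCA -expRD; congr (_ * expR _).
  by ring.
rewrite ge0_integralZl//.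
- by rewrite integral_exponential_pdf// mule1.
- by apply/measurable_EFinP; exact: measurable_exponential_pdf.
- by move=> x _; rewrite lee_fin exponential_pdf_ge0// ltW.
- by rewrite lee_fin divr_ge0// ltW.
Qed.

End ExponentialDensity.

(** * Products, sums and atoms of independent variables *)

Section SumsOfIndependentVariables.
Context d {T : measurableType d} {R : realType} (P : probability T R).
Implicit Types (X Y : T -> R).

Lemma exp_lawP rate X : 0 < rate -> measurable_fun setT X -> has_exp_law P rate X ->
  forall A : set R, measurable A -> P [set w | A (X w)] = exponential_prob rate A.
Proof.
move=> rate0 mX eX A mA.
have [nu nuE] : exists nu : probability (measurableTypeR R) R,
    (nu : set _ -> \bar R) = exponential_prob rate.
  by unshelve eexists [the probability _ _ of @exponential_prob R rate].
have nuE' B : nu B = exponential_prob rate B by rewrite -nuE.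
rewrite -nuE'; change (nu A) with (nu [set x | A x]).
apply: (@eq_law_rays _ _ _ _ (measurableTypeR R) P nu X id) => //.
  by apply: le_lt_trans (ltry 1); exact: probability_le1.
move=> r; apply: (etrans (eX r)); rewrite -exponential_prob_ray//.
apply/esym/(etrans (nuE' _)); congr (exponential_prob _ _).
by apply/seteqP; split => w /=; rewrite in_itv/= andbT.
Qed.

Lemma exp_law_scale rate X : 0 < rate -> has_exp_law P 1 X ->
  has_exp_law P rate (fun w => X w / rate).
Proof.
move=> rate0 eX r.
rewrite (_ : [set w | _] = [set w | r * rate < X w]); last first.
  by apply/seteqP; split => w /=; rewrite ltr_pdivlMr.
by rewrite eX mul1r maxr_pMr ?ltW// mulr0 mulrC.
Qed.

Lemma exp_law_mgf rate X t : 0 < rate -> t < rate ->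
  measurable_fun setT X -> has_exp_law P rate X ->
  (\int[P]_w (expR (t * X w))%:E = (rate / (rate - t))%:E)%E.
Proof.
move=> rate0 trate mX eX; rewrite -(exponential_prob_mgf rate0 trate).
have mf : measurable_fun setT (fun x : R => (expR (t * x))%:E).
  apply/measurable_EFinP => /=.
  have h1 := @measurable_expR R.
  have h2 := @mulrl_measurable R setT t.
  exact: (measurableT_comp h1 h2).
have mX' : @measurable_fun _ _ T (measurableTypeR R) setT X by [].
transitivity (\int[pushforward P (X : T -> measurableTypeR R)]_x (expR (t * x))%:E)%E.
  by rewrite (ge0_integral_pushforward mX')// => x _; rewrite lee_fin expR_ge0.
pose m : {measure set (measurableTypeR R) -> \bar R} :=
  [the measure _ _ of pushforward P (X : T -> measurableTypeR R)].
have [nu nuE] : exists nu : {measure set (measurableTypeR R) -> \bar R},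
    (nu : set _ -> \bar R) = exponential_prob rate.
  by unshelve eexists [the measure _ _ of @exponential_prob R rate].
rewrite -nuE; apply: (@eq_measure_integral _ _ _ setT nu (m mX')) => A mA _.
rewrite nuE.
by rewrite /= /pushforward; exact: (exp_lawP rate0 mX eX).
Qed.

Lemma independent2_joint (X Y : {RV P >-> R}) : independent2 P X Y ->
  forall S : set (R * R), measurable S ->
  P [set w | S (X w, Y w)] = (distribution P X \x distribution P Y)%E S.
Proof.
move=> iXY S mS.
have mXY : measurable_fun setT (fun w => (X w, Y w)) by exact/measurable_fun_pair.
pose p : {measure set (R * R) -> \bar R} :=
  [the measure _ _ of pushforward P (fun w => (X w, Y w))].
apply: (etrans _ (esym (product_measure_unique (m1 := distribution P X)
  (m2 := distribution P Y) (m' := p mXY) _ mS))) => //.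
Qed.

Lemma RV_of X : measurable_fun setT X -> exists X' : {RV P >-> R}, (X' : T -> R) = X.
Proof. by move=> mX; exists (mfun_Sub (mem_set mX)). Qed.

Lemma independent2_expectation X Y (f g : R -> R) (M : R) :
  measurable_fun setT X -> measurable_fun setT Y -> independent2 P X Y ->
  measurable_fun setT f -> measurable_fun setT g ->
  (forall x, 0 <= f x) -> (forall x, 0 <= g x) ->
  (\int[P]_w (g (Y w))%:E = M%:E)%E ->
  (\int[P]_w (f (X w) * g (Y w))%:E = \int[P]_w (f (X w))%:E * M%:E)%E.
Proof.
move=> /RV_of[X' <-] /RV_of[Y' <-] iXY mf g_m f0 g0 gM.
have mXY : measurable_fun setT (fun w => (X' w, Y' w)) by exact/measurable_fun_pair.
pose F (p : R * R) := (f p.1 * g p.2)%:E.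
have mF : measurable_fun setT F.
  by apply/measurable_EFinP; apply: measurable_funM; exact: measurableT_comp.
have F0 p : (0 <= F p)%E by rewrite lee_fin mulr_ge0.
have M0 : 0 <= M by rewrite -lee_fin -gM integral_ge0// => w _; rewrite lee_fin.
transitivity (\int[pushforward P (fun w => (X' w, Y' w))]_p F p)%E.
  by rewrite (ge0_integral_pushforward mXY).
pose p : {measure set (R * R) -> \bar R} :=
  [the measure _ _ of pushforward P (fun w => (X' w, Y' w))].
rewrite (eq_measure_integral (distribution P X' \x distribution P Y')%E (m1 := p mXY)); last first.
  by move=> A mA _; exact: (independent2_joint iXY mA).
rewrite fubini_tonelli1//.
have mEg : measurable_fun setT (fun y => (g y)%:E) by exact/measurable_EFinP.
have mEf : measurable_fun setT (fun y => (f y)%:E) by exact/measurable_EFinP.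
have inner x : (\int[distribution P Y']_y F (x, y) = (f x)%:E * M%:E)%E.
  rewrite /F /=; under eq_integral do rewrite EFinM.
  rewrite ge0_integralZl//; do ?by [move=> y _; rewrite lee_fin|rewrite lee_fin].
  by rewrite ge0_integral_distribution// gM.
transitivity (\int[distribution P X']_x ((f x)%:E * M%:E))%E.
  by apply: eq_integral => x _; exact: inner.
rewrite ge0_integralZr//; do ?by [move=> y _; rewrite lee_fin|rewrite lee_fin].
by rewrite ge0_integral_distribution.
Qed.

(** For each fixed value [y] of [Y] the event says that [X] equals [r - c * y]; Fubini does the
    rest. [Y] is the first component of the pair, so that a section is a condition on [X]. *)
Lemma independent2_atomless X Y (c : R) :
  measurable_fun setT X -> measurable_fun setT Y -> independent2 P Y X ->
  (forall r, P [set w | X w = r] = 0%E) ->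
  forall r, P [set w | X w + c * Y w = r] = 0%E.
Proof.
move=> /RV_of[X' <-] /RV_of[Y' <-] iYX X0 r.
pose S := [set p : R * R | p.2 + c * p.1 = r].
have mS : measurable S.
  rewrite (_ : S = (fun p : R * R => p.2 + c * p.1) @^-1` [set r])//.
  rewrite -[X in measurable X]setTI; apply: measurable_funD => //.
  exact: measurable_funM.
change (P [set w | S (Y' w, X' w)] = 0%E).
rewrite independent2_joint// /product_measure1 /=.
rewrite (eq_integral (cst 0%E)) ?integral0// => y _ /=.
rewrite (_ : xsection S y = [set r - c * y]) //; first exact: X0.
apply/seteqP; split => x; rewrite /xsection /S /= ?inE /=.
  by move=> <-; rewrite addrK.
by move=> ->; rewrite subrK.
Qed.

End SumsOfIndependentVariables.

Section FamiliesOfIndependentVariables.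
Context d {T : measurableType d} {R : realType} (P : probability T R).
Context {I : eqType}.
Implicit Types (K : set I) (X : I -> T -> R).

Lemma indep_independent2 K X a b : indep P K X -> a != b -> K a -> K b ->
  independent2 P (X a) (X b).
Proof.
move=> [mX iX] ab Ka Kb A B mA mB.
pose A' k := if k == a then A else B.
have mA' k : measurable (A' k) by rewrite /A'; case: ifP.
have A'a : A' a = A by rewrite /A' eqxx.
have A'b : A' b = B by rewrite /A' eq_sym (negPf ab).
have := iX [:: a; b] _ _ A' mA'.
rewrite !big_cons big_nil mule1 A'a A'b => <-.
- congr (P _); apply/seteqP; split => w /=.
    by move=> [hA hB] k; rewrite !inE => /orP[]/eqP->; rewrite ?A'a ?A'b.
  by move=> h; split; [rewrite -A'a|rewrite -A'b]; apply: h; rewrite !inE eqxx ?orbT.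
- by rewrite /= inE ab.
- by move=> k; rewrite !inE => /orP[]/eqP->.
Qed.

(* The coordinates of [X a, X b] are recovered from their minimum M and their
   difference D; since X c has the law of M, the pair (X c, D) has the law of
   (M, D), and so the new pair has the law of (X a, X b). *)
Lemma indep_flip K X a b c al be : indep P K X ->
  a != b -> c != a -> c != b -> K a -> K b -> K c ->
  has_exp_law P al (X a) -> has_exp_law P be (X b) -> has_exp_law P (al + be) (X c) ->
  let U := fun w => X c w + Num.max (X a w - X b w) 0 in
  let V := fun w => X c w + Num.max (X b w - X a w) 0 in
  [/\ indep P (K `\ a) (fun k => if k == c then U else if k == b then V else X k),
      has_exp_law P al U & has_exp_law P be V].
Proof.
move=> iX ab ca cb Ka Kb Kc ea eb ec U V.
have [mX _] := iX.
have iab := indep_independent2 iX ab Ka Kb.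
pose M w := Num.min (X a w) (X b w).
pose D w := X a w - X b w.
have mM : measurable_fun setT M by apply: measurable_minr; exact: mX.
have mD : measurable_fun setT D by apply: measurable_funB; exact: mX.
have iMD : independent2 P M D.
  by apply: exp_law_min_diff ea eb => //; exact: mX.
pose f1 (p : R * R) := Num.min p.1 p.2.
pose g1 (p : R * R) := p.1 - p.2.
have mf1 : measurable_fun setT f1 by exact: measurable_minr.
have mg1 : measurable_fun setT g1 by exact: measurable_funB.
have i1 : indep P K (replace2 X a b f1 g1) by exact: indep_replace2.
have ba : (b == a) = false by rewrite eq_sym (negPf ab).
have X1b : replace2 X a b f1 g1 b = D.
  by apply/funext => w; rewrite /replace2 ba eqxx.
have X1c : replace2 X a b f1 g1 c = X c.
  by apply/funext => w; rewrite /replace2 (negPf ca) (negPf cb).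
have icD : independent2 P (X c) D.
  by rewrite -X1b -X1c; exact: indep_independent2 i1 cb Kc Kb.
have lawcM (A : set R) : measurable A -> P [set w | A (X c w)] = P [set w | A (M w)].
  apply: eq_law_rays => //.
  - by apply: le_lt_trans (ltry 1); exact: probability_le1.
  - exact: mX.
  - by move=> r; exact: (etrans (ec r) (esym (exp_law_min iab ea eb r))).
have joint (S : set (R * R)) : measurable S ->
    P [set w | S (X c w, D w)] = P [set w | S (M w, D w)].
  apply: eq_joint_law => //.
  - by apply: le_lt_trans (ltry 1); exact: probability_le1.
  - exact: mX.
  - move=> A B mA mB; apply: (etrans (icD A B mA mB)); apply/esym.
    by apply: (etrans (iMD A B mA mB)); rewrite lawcM.
pose f2 (p : R * R) := p.1 + Num.max p.2 0.
pose g2 (p : R * R) := p.1 + Num.max (- p.2) 0.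
have mf2 : measurable_fun setT f2.
  by apply: measurable_funD => //; exact: measurable_maxr.
have mg2 : measurable_fun setT g2.
  apply: measurable_funD => //; apply: measurable_maxr => //.
  exact: measurable_funN.
have f2E w : f2 (M w, D w) = X a w.
  rewrite /f2 /M /D /=; case: (leP (X a w) (X b w)) => h.
    by rewrite (max_idPr _) ?subr_le0// addr0.
  by rewrite (max_idPl _) ?subr_ge0 ?ltW// subrKC.
have g2E w : g2 (M w, D w) = X b w.
  rewrite /g2 /M /D /= opprB; case: (leP (X a w) (X b w)) => h.
    by rewrite (max_idPl _) ?subr_ge0// subrKC.
  by rewrite (max_idPr _) ?subr_le0 ?ltW// addr0.
have f2U w : f2 (X c w, D w) = U w by [].
have g2V w : g2 (X c w, D w) = V w by rewrite /g2 /V /D /= opprB.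
have law2 (A B : set R) : measurable A -> measurable B ->
    P [set w | A (U w) /\ B (V w)] = P [set w | A (X a w) /\ B (X b w)].
  move=> mA mB.
  have mS : measurable [set p | A (f2 p) /\ B (g2 p)].
    apply: measurableI.
      by rewrite -[X in measurable X]setTI; exact: mf2.
    by rewrite -[X in measurable X]setTI; exact: mg2.
  have := joint _ mS => /=.
  under eq_set do rewrite f2U g2V.
  by move=> ->; under eq_set do rewrite f2E g2E.
have lawU (A : set R) : measurable A -> P [set w | A (U w)] = P [set w | A (X a w)].
  move=> mA; have := law2 A setT mA measurableT.
  rewrite (_ : [set w | _] = [set w | A (U w)]).
    by move=> ->; congr (P _); apply/seteqP; split => w //= [].
  by apply/seteqP; split => w //= [].
have lawV (A : set R) : measurable A -> P [set w | A (V w)] = P [set w | A (X b w)].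
  move=> mA; have := law2 setT A measurableT mA.
  rewrite (_ : [set w | _] = [set w | A (V w)]).
    by move=> ->; congr (P _); apply/seteqP; split => w //= [].
  by apply/seteqP; split => w //= [].
have rayE (Z : T -> R) r : [set w | r < Z w] = [set w | `]r, +oo[%classic (Z w)].
  by apply/seteqP; split => w /=; rewrite in_itv/= andbT.
split; last 2 first.
- by move=> r; rewrite rayE lawU// -rayE ea.
- by move=> r; rewrite rayE lawV// -rayE eb.
(* The first replacement has put the minimum at [a] and the difference at [b]. The second recombines
   [X c] with that difference, and [a], which holds the old minimum, is given up. *)
have i2 : indep P K (replace2 (replace2 X a b f1 g1) c b f2 g2).
  apply: indep_replace2 => // A B mA mB; rewrite X1b X1c.
  have eU : [set w | A (f2 (X c w, D w))] = [set w | A (U w)] by [].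
  have eV : [set w | B (g2 (X c w, D w))] = [set w | B (V w)].
    by apply/seteqP; split => w /=; rewrite g2V.
  rewrite eU eV lawU// lawV// -iab// -law2//.
  by congr (P _); apply/seteqP; split => w /=; rewrite g2V.
have := @indep_sub _ _ _ P _ K (K `\ a) _ (@subDsetl _ _ _) i2.
apply: eq_indep => k [Kk /= /eqP ka]; apply/funext => w.
rewrite [LHS]/replace2 X1b X1c f2U g2V; case: eqP => // kc; case: eqP => // kb.
by rewrite /replace2 (negPf ka); case: eqP.
Qed.

End FamiliesOfIndependentVariables.

Section SumsOfFamilies.
Context d {T : measurableType d} {R : realType} (P : probability T R).
Context {I : eqType}.
Implicit Types (K : set I) (X : I -> T -> R).

Lemma measurable_sum_family X (s : seq I) :
  (forall k, k \in s -> measurable_fun setT (X k)) ->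
  measurable_fun setT (fun w => \sum_(k <- s) X k w).
Proof.
elim: s => [_|a s IH mX].
  by rewrite (_ : (fun _ => _) = cst 0)//; apply/funext => w; rewrite big_nil.
rewrite (_ : (fun _ => _) = fun w => X a w + \sum_(k <- s) X k w); last first.
  by apply/funext => w; rewrite big_cons.
apply: measurable_funD; first by apply: mX; rewrite mem_head.
by apply: IH => k ks; apply: mX; rewrite inE ks orbT.
Qed.

(** Induction on the list: [indep_merge] replaces the first two variables by their sum, whose moment
    generating function is a product by independence. *)
Lemma indep_mgf_sum K X (M : I -> R) (t : R) (s : seq I) :
  indep P K X -> uniq s -> (forall k, k \in s -> K k) ->
  (forall k, k \in s -> \int[P]_w (expR (t * X k w))%:E = (M k)%:E)%E ->
  (\int[P]_w (expR (t * \sum_(k <- s) X k w))%:E = (\prod_(k <- s) M k)%:E)%E.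
Proof.
case: s => [|a s].
  move=> _ _ _ _; rewrite big_nil.
  under eq_integral do rewrite big_nil mulr0 expR0.
  by rewrite integral_cst// mul1e; exact: probability_setT.
elim: s K X M => [|b s IH] K X M iX us sK hM.
  rewrite big_seq1; under eq_integral do rewrite big_seq1.
  by apply: hM; rewrite mem_head.
have ab : a != b by move: us; rewrite /= inE negb_or => /andP[/andP[]].
have Ka : K a by apply: sK; rewrite mem_head.
have Kb : K b by apply: sK; rewrite !inE eqxx orbT.
have mf : measurable_fun setT (fun p : R * R => p.1 + p.2) by exact: measurable_funD.
have iX' := indep_merge iX ab Ka Kb mf.
have iab := indep_independent2 iX ab Ka Kb.
have [mX _] := iX.
have mexp : measurable_fun setT (fun x : R => expR (t * x)).
  have h1 := @measurable_expR R.
  have h2 := @mulrl_measurable R setT t.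
  exact: (measurableT_comp h1 h2).
have sP k : k \in s -> [/\ k != a, k != b & K k].
  move=> ks; split; last by apply: sK; rewrite !inE ks !orbT.
  - by apply: contraTneq us => <-; rewrite /= inE ks orbT.
  - by apply: contraTneq us => <-; rewrite /= ks andbF.
set X' := (fun k w => _) in iX'.
have X'a w : X' a w = X a w + X b w by rewrite /X' eqxx.
have X'k k w : k \in s -> X' k w = X k w by move=> /sP[/negPf ka _ _]; rewrite /X' ka.
have Mab : (\int[P]_w (expR (t * X' a w))%:E = (M a * M b)%:E)%E.
  transitivity (\int[P]_w (expR (t * X a w) * expR (t * X b w))%:E)%E.
    by apply: eq_integral => w _; rewrite X'a mulrDr expRD.
  rewrite (independent2_expectation (X := X a) (Y := X b)
    (f := fun x => expR (t * x)) (g := fun x => expR (t * x)) (M := M b))//.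
  - by rewrite [X in (X * _)%E](hM a (mem_head _ _)) EFinM.
  - exact: mX.
  - exact: mX.
  - by rewrite hM// !inE eqxx orbT.
have IH' := IH (K `\ b) X' (fun k => if k == a then M a * M b else M k) iX' _ _ _.
transitivity (\int[P]_w (expR (t * \sum_(k <- a :: s) X' k w))%:E)%E.
  apply: eq_integral => w _; rewrite !big_cons X'a addrA.
  congr (expR (t * (_ + _)))%:E; apply: eq_big_seq => k ks; rewrite X'k//.
rewrite IH'.
- rewrite !big_cons eqxx mulrA; congr (_ * _)%:E; apply: eq_big_seq => k /sP[/negPf-> _ _] //.
- by move: us => /= /andP[+ /andP[_ ->]]; rewrite inE negb_or andbT => /andP[].
- move=> k; rewrite inE => /predU1P[->|/sP[? kb ?]]; split=> //=; apply/eqP => //.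
- move=> k; rewrite inE; case: eqVneq => [->|ka /= ks]; first by rewrite Mab.
  under eq_integral do rewrite X'k//.
  by apply: hM; rewrite !inE ks !orbT.
Qed.

(** The head absorbs one summand at a time, and by [independent2_atomless] it remains free of
    atoms. *)
Lemma indep_atomless_sum K X (c : I -> R) a (s : seq I) :
  indep P K X -> uniq (a :: s) -> (forall k, k \in a :: s -> K k) ->
  (forall r, P [set w | X a w = r] = 0%E) ->
  forall r, P [set w | X a w + \sum_(k <- s) c k * X k w = r] = 0%E.
Proof.
elim: s K X => [|b s IH] K X iX us sK Xa0 r.
  by under eq_set do rewrite big_nil addr0; exact: Xa0.
have ab : a != b by move: us; rewrite /= inE negb_or => /andP[/andP[]].
have Ka : K a by apply: sK; rewrite mem_head.
have Kb : K b by apply: sK; rewrite !inE eqxx orbT.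
have mf : measurable_fun setT (fun p : R * R => p.1 + c b * p.2).
  by apply: measurable_funD => //; exact: measurable_funM.
have iX' := indep_merge iX ab Ka Kb mf.
have iba : independent2 P (X b) (X a).
  by apply: indep_independent2 iX _ Kb Ka; rewrite eq_sym.
have [mX _] := iX.
have sP k : k \in s -> [/\ k != a, k != b & K k].
  move=> ks; split; last by apply: sK; rewrite !inE ks !orbT.
  - by apply: contraTneq us => <-; rewrite /= inE ks orbT.
  - by apply: contraTneq us => <-; rewrite /= ks andbF.
set X' := (fun k w => _) in iX'.
have X'a w : X' a w = X a w + c b * X b w by rewrite /X' eqxx.
have X'k k w : k \in s -> X' k w = X k w by move=> /sP[/negPf ka _ _]; rewrite /X' ka.
have -> : [set w | X a w + \sum_(k <- b :: s) c k * X k w = r] =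
    [set w | X' a w + \sum_(k <- s) c k * X' k w = r].
  have E w : X a w + \sum_(k <- b :: s) c k * X k w =
      X' a w + \sum_(k <- s) c k * X' k w.
    rewrite big_cons addrA X'a; congr (_ + _).
    by apply: eq_big_seq => k ks; rewrite X'k.
  by apply/seteqP; split => w /=; rewrite E.
apply: IH iX' _ _ _ r.
- by move: us => /= /andP[+ /andP[_ ->]]; rewrite inE negb_or andbT => /andP[].
- move=> k; rewrite inE => /predU1P[->|/sP[? kb ?]]; split=> //=; apply/eqP => //.
- move=> r; under eq_set do rewrite X'a.
  by apply: independent2_atomless => //; exact: mX.
Qed.

End SumsOfFamilies.

(** * Chernoff bounds for sums of exponential variables *)

Section Deviations.
Context d {T : measurableType d} {R : realType} (P : probability T R).
Context {I : eqType}.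
Implicit Types (K : set I) (X : I -> T -> R).

(* [1 / (1 - s) = 1 + s / (1 - s) <= exp (s / (1 - s))], and
   [s / (1 - s) = s + s ^ 2 / (1 - s)]. *)
Lemma inv_onem_le_exp (s : R) : s <= 2^-1 -> (1 - s)^-1 <= expR (s + 2 * s ^+ 2).
Proof.
move=> s2; have h : 2^-1 <= 1 - s by lra.
have h0 : 0 < 1 - s by lra.
have E : (1 - s)^-1 = 1 + s / (1 - s) by field; rewrite gt_eqF.
rewrite E; apply: le_trans (expR_ge1Dx _) _; rewrite ler_expR.
have -> : s / (1 - s) = s + s ^+ 2 * (1 - s)^-1 by field; rewrite gt_eqF.
rewrite lerD2l mulrC ler_wpM2r ?sqr_ge0//.
by rewrite -(invrK 2) lef_pV2 ?posrE ?invr_gt0.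
Qed.

Lemma markov_exp (Z : T -> R) (M u : R) : measurable_fun setT Z ->
  (\int[P]_w (expR (Z w))%:E = M%:E)%E ->
  (P [set w | (u <= Z w)%R] <= (M * expR (- u))%:E)%E.
Proof.
move=> /(RV_of P)[Z' <-] hM; have := @chernoff _ _ _ P Z' 1 u ltr01.
rewrite /mmt_gen_fun unlock mul1r EFinM => h; apply: (le_trans h).
rewrite lee_wpmul2r ?lee_fin ?expR_ge0// -hM.
by under eq_integral do rewrite /= mulr1.
Qed.

(** With the exponent [a * rate] each variable contributes [(1 - a)^-1], whatever its rate. Positive
    [a] serves the upper tail and negative [a] the lower one. *)
Lemma exp_sum_chernoff K X (s : seq I) (rate a u : R) : 0 < rate -> a <= 2^-1 ->
  indep P K X -> uniq s -> (forall k, k \in s -> K k) ->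
  (forall k, k \in s -> has_exp_law P rate (X k)) ->
  (P [set w | (u <= a * rate * \sum_(k <- s) X k w)%R] <=
   (expR ((a + 2 * a ^+ 2) * (size s)%:R - u))%:E)%E.
Proof.
move=> rate0 a2 iX us sK eX; have [mX _] := iX.
have trate : a * rate < rate.
  by rewrite gtr_pMl//; apply: le_lt_trans a2 _; lra.
have a1 : 0 < 1 - a by lra.
have hM := indep_mgf_sum (M := fun=> (1 - a)^-1) (t := a * rate) iX us sK.
have mS : measurable_fun setT (fun w => a * rate * \sum_(k <- s) X k w).
  apply: measurable_funM => //; apply: measurable_sum_family => k ks.
  by apply: mX; exact: sK.
apply: le_trans (markov_exp _ mS (hM _)) _.
  move=> k ks; rewrite (exp_law_mgf rate0 trate)//; first last.
  - exact: eX.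
  - by apply: mX; exact: sK.
  - congr EFin; field; rewrite gt_eqF//= ?subr_gt0// gt_eqF//.
    by rewrite subr_gt0.
rewrite lee_fin expRD ler_wpM2r ?expR_ge0// big_const_seq count_predT iter_mulr_1.
rewrite mulrC expRM_natl lerXn2r ?nnegrE ?expR_ge0 ?invr_ge0 ?(ltW a1)//.
exact: inv_onem_le_exp.
Qed.

(** The deviation is measured by an upper bound [m] on the number of summands: later [m] is the
    distance of two lattice points, while the sum runs along one side of their rectangle only. As
    [c] is fixed before the family, it serves all corners at once. *)
Lemma exp_sum_deviation (rate del : R) : 0 < rate -> 0 < del ->
  exists2 c : R, 0 < c & forall K X (s : seq I) (m : nat),
    indep P K X -> uniq s -> (forall k, k \in s -> K k) ->
    (forall k, k \in s -> has_exp_law P rate (X k)) -> (size s <= m)%N ->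
    (P [set w | (del * m%:R <= `|\sum_(k <- s) X k w - (size s)%:R / rate|)%R] <=
     (2 * expR (- (c * m%:R)))%:E)%E.
Proof.
(* Since [a <= rate * del / 4], the quadratic error [2 * a ^+ 2 * m] consumes at most half of the
   gain [a * rate * del * m]; the other half is [c * m]. *)
move=> rate0 del0; pose a := Num.min 2^-1 (rate * del / 4).
have a0 : 0 < a by rewrite lt_min invr_gt0 ltr0n /= divr_gt0// mulr_gt0.
have a2 : a <= 2^-1 by rewrite ge_min lexx.
have ad : a <= rate * del / 4 by rewrite ge_min lexx orbT.
exists (a * (rate * del) / 2); first by rewrite divr_gt0// !mulr_gt0.
move=> K X s m iX us sK eX sm; have [mX _] := iX.
pose S w := \sum_(k <- s) X k w.
have mS : measurable_fun setT S.
  by apply: measurable_sum_family => k ks; apply: mX; exact: sK.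
pose n : R := (size s)%:R.
have n0 : 0 <= n by exact: ler0n.
have nm : n <= m%:R by rewrite ler_nat.
pose A b := [set w | b * n + a * rate * del * m%:R <= b * rate * S w].
have mA b : measurable (A b).
  have -> : A b = [set w | (fun x => b * rate * x) (S w) \in
     `[b * n + a * rate * del * m%:R, +oo[].
    by apply/seteqP; split => w /=; rewrite in_itv/= andbT.
  have mb : measurable_fun setT (fun w => b * rate * S w) by exact: measurable_funM.
  exact: (measurable_preim mb (measurable_itv _)).
have PA b : `|b| = a -> b <= 2^-1 ->
    (P (A b) <= (expR (- (a * (rate * del) / 2 * m%:R)))%:E)%E.
  move=> ba b2; apply: le_trans (exp_sum_chernoff _ rate0 b2 iX us sK eX) _.
  rewrite lee_fin ler_expR -/n.
  have -> : b ^+ 2 = a ^+ 2 by rewrite -ba real_normK ?num_real.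
  have h1 : a ^+ 2 * n <= a ^+ 2 * m%:R by rewrite ler_wpM2l// sqr_ge0.
  have h2 : a * a * m%:R <= a * (rate * del / 4) * m%:R.
    by rewrite ler_wpM2r// ler_wpM2l// ltW.
  rewrite expr2 in h1 *; lra.
have E2 (x : R) : (2 * x)%:E = (x%:E + x%:E)%E by rewrite -EFinD; congr EFin; ring.
rewrite E2.
apply: (@le_trans _ _ (P (A a `|` A (- a)))); last first.
  apply: le_trans (measureU2 _ _ _) _ => //; apply: leeD; apply: PA => //.
  - by rewrite gtr0_norm.
  - by rewrite normrN gtr0_norm.
  - by apply: le_trans a2; rewrite ge0_cp// ltW.
apply: le_measure; rewrite ?inE//.
- have mZ : measurable_fun setT (fun w => `|S w - n / rate|).
    by apply: measurableT_comp => //; exact: measurable_funB.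
  rewrite (_ : [set w | _] = [set w | `[del * m%:R, +oo[%classic `|S w - n / rate|]).
    exact: (measurable_preim mZ (measurable_itv _)).
  by apply/seteqP; split => w /=; rewrite in_itv/= andbT.
- exact: measurableU.
move=> w /=; rewrite -/(S w) -/n => h.
have ar0 : 0 < a * rate by exact: mulr_gt0.
have E : a * rate * (n / rate) = a * n by field; rewrite gt_eqF.
case: (leP 0 (S w - n / rate)) h => [h0|h0].
  rewrite ger0_norm// => h; left; rewrite /A /=.
  have := ler_wpM2l (ltW ar0) h; rewrite mulrBr E; lra.
rewrite ltr0_norm// => h; right; rewrite /A /=.
have := ler_wpM2l (ltW ar0) h; rewrite mulrN mulrBr E; lra.
Qed.

End Deviations.

(** * Burke's property *)

Section StationaryLastPassage.
Context {R : realType}.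
Variables (rho : R) (eta : nat -> nat -> R).

(* Last-passage times from the origin of the quadrant, with boundary weights
   of rate [1 - rho] on the horizontal axis and [rho] on the vertical one. *)
Fixpoint stat_lpp_row (b : nat) : nat -> R :=
  match b with
  | 0 => fix row a := match a with
      | 0 => 0
      | a'.+1 => row a' + eta a'.+1 0%N / (1 - rho)
      end
  | b'.+1 => fix row a := match a with
      | 0 => stat_lpp_row b' 0%N + eta 0%N b'.+1 / rho
      | a'.+1 => eta a'.+1 b'.+1 + Num.max (row a') (stat_lpp_row b' a'.+1)
      end
  end.

Definition stat_lpp a b := stat_lpp_row b a.

Lemma stat_lpp00 : stat_lpp 0 0 = 0. Proof. by []. Qed.

Lemma stat_lppS0 a : stat_lpp a.+1 0 = stat_lpp a 0 + eta a.+1 0%N / (1 - rho).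
Proof. by []. Qed.

Lemma stat_lpp0S b : stat_lpp 0 b.+1 = stat_lpp 0 b + eta 0%N b.+1 / rho.
Proof. by []. Qed.

Lemma stat_lppSS a b :
  stat_lpp a.+1 b.+1 = eta a.+1 b.+1 + Num.max (stat_lpp a b.+1) (stat_lpp a.+1 b).
Proof. by []. Qed.

Definition hor_inc a b := stat_lpp a.+1 b - stat_lpp a b.
Definition ver_inc a b := stat_lpp a b.+1 - stat_lpp a b.

(** Together with [ver_incS] this is the map of [indep_flip] across a unit square: the bottom and
    left increments and the weight of the upper right site yield the top and right increments. *)
Lemma hor_incS a b :
  hor_inc a b.+1 = eta a.+1 b.+1 + Num.max (hor_inc a b - ver_inc a b) 0.
Proof.
rewrite /hor_inc /ver_inc stat_lppSS -addrA; congr (_ + _).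
rewrite addr_maxl subrr maxC; congr Num.max; lra.
Qed.

Lemma ver_incS a b :
  ver_inc a.+1 b = eta a.+1 b.+1 + Num.max (ver_inc a b - hor_inc a b) 0.
Proof.
rewrite /hor_inc /ver_inc stat_lppSS -addrA; congr (_ + _).
rewrite addr_maxl subrr; congr Num.max; lra.
Qed.

End StationaryLastPassage.

Arguments stat_lpp : simpl never.
#[global] Opaque stat_lpp.

(** Reflection in the diagonal exchanges the two boundary rates, so results on rows become results
    on columns. *)
Lemma stat_lpp_transpose {R : realType} (rho : R) (eta : nat -> nat -> R) a b :
  stat_lpp (1 - rho) (fun i j => eta j i) b a = stat_lpp rho eta a b.
Proof.
have rr : 1 - (1 - rho) = rho by lra.
elim: b a => [|b IHb]; elim=> [|a IHa]; first by rewrite !stat_lpp00.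
- by rewrite stat_lpp0S stat_lppS0 IHa.
- by rewrite stat_lpp0S stat_lppS0 IHb rr.
- by rewrite !stat_lppSS IHa IHb maxC.
Qed.

Section Burke.
Context d {T : measurableType d} {R : realType} (P : probability T R).

Lemma indep_reindex (I I' : eqType) (phi : I' -> I) (K : set I) (K' : set I')
    (X : I -> T -> R) : injective phi -> (forall k, K' k -> K (phi k)) ->
  indep P K X -> indep P K' (fun k => X (phi k)).
Proof.
move=> phiI KK [mX iX]; split=> [k /KK/mX//|s us sK A mA].
case: s us sK => [|k0 s0] us sK.
  rewrite big_nil -[RHS](probability_setT P); congr (P _).
  by apply/seteqP; split.
set s := k0 :: s0 in us sK *.
pose A' i := if i \in map phi s then A (nth k0 s (index i (map phi s))) else setT.
have A'E k : k \in s -> A' (phi k) = A k.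
  by move=> ks; rewrite /A' map_f// index_map// nth_index.
have mA' i : measurable (A' i) by rewrite /A'; case: ifP.
have := iX (map phi s) _ _ A' mA'.
rewrite big_map (eq_big_seq (fun k => P [set w | A k (X (phi k) w)])); last first.
  by move=> k ks; rewrite A'E.
move=> <-.
- congr (P _); apply/seteqP; split => w h.
    by move=> i /mapP[k ks ->]; rewrite A'E//; exact: h.
  by move=> k ks; rewrite -A'E//; apply: h; exact: map_f.
- by rewrite map_inj_uniq.
- by move=> i /mapP[k ks ->]; exact/KK/sK.
Qed.

Lemma indep_scale (I : eqType) (K : set I) (X : I -> T -> R) (r : I -> R) :
  indep P K X -> indep P K (fun k w => X k w / r k).
Proof.
move=> [mX iX].
have mdiv k : measurable_fun setT (fun x : R => x / r k) by exact: mulrr_measurable.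
split=> [k Kk|s us sK A mA].
  by apply: measurable_funM => //; exact: mX.
apply: (iX s us sK (fun k => (fun x => x / r k) @^-1` A k)) => k.
by rewrite -[X in measurable X]setTI; exact: mdiv.
Qed.

Variables (rho : R) (X : nat * nat -> T -> R).
Hypotheses (rho0 : 0 < rho) (rho1 : rho < 1).
Hypothesis iX : indep P setT X.
Hypothesis eX : forall k, has_exp_law P 1 (X k).

Local Notation eta w := (fun a b => X (a, b) w).
Local Notation Hor a b w := (hor_inc rho (eta w) a b).
Local Notation Ver a b w := (ver_inc rho (eta w) a b).

(* The variables alive after the rows up to [j], and the first [i] sites of row
   [j.+1], have been processed: [Hor a j] sits at [(a.+1, j)], and
   the current vertical increment of row [j.+1] at [(0, j.+1)]. *)
Let alive j i : set (nat * nat) := [set k | (k.2 == j) && (i < k.1)%N || (j < k.2)%N].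

Let state j i (k : nat * nat) (w : T) : R :=
  if k.2 == j then Hor k.1.-1 j w
  else if k.2 == j.+1 then
    if k.1 == 0%N then Ver i j w
    else if (k.1 <= i)%N then Hor k.1.-1 j.+1 w else X k w
  else if k.1 == 0%N then X k w / rho else X k w.

Let rate j i (k : nat * nat) : R :=
  if k.2 == j then 1 - rho
  else if k.2 == j.+1 then
    if k.1 == 0%N then rho else if (k.1 <= i)%N then 1 - rho else 1
  else if k.1 == 0%N then rho else 1.

Let inv j i := indep P (alive j i) (state j i) /\
  (forall k, alive j i k -> has_exp_law P (rate j i k) (state j i k)).

Let rho1' : 0 < 1 - rho. Proof. by rewrite subr_gt0. Qed.

Let inv0 : inv 0 0.
Proof.
pose r (k : nat * nat) := if k.2 == 0%N then 1 - rho else if k.1 == 0%N then rho else 1.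
have E k : alive 0 0 k -> (fun w => X k w / r k) = state 0 0 k.
  case: k => a b; rewrite /alive /= => h; apply/funext => w; rewrite /state /r /=.
  case: b h => [|b] /=.
    by rewrite orbF; case: a => // a _; rewrite /hor_inc stat_lppS0 /= addrAC subrr add0r.
  move=> _; rewrite eqSS; case: b => [|b] /=.
    case: a => [|a] /=; first by rewrite /ver_inc stat_lpp0S addrAC subrr add0r.
    by rewrite divr1.
  by case: a => //= a; rewrite divr1.
have r0 k : 0 < r k by rewrite /r; case: ifP => // _; case: ifP.
split.
  apply: eq_indep E _; apply: indep_sub (indep_scale r iX).
  exact: subsetT.
move=> k ak; rewrite -E//.
have -> : rate 0 0 k = r k.
  case: k ak => a b; rewrite /rate /r /=; case: b => //= b _.
  by rewrite eqSS leqn0; case: b => //=; case: a.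
exact: exp_law_scale.
Qed.

Let invS j i : inv j i -> inv j i.+1.
Proof.
move=> [iZ eZ].
(* The inputs of [indep_flip] are the horizontal increment below (rate [1 - rho]), the vertical
   increment on the left (rate [rho]) and the fresh weight (rate 1). The outputs overwrite the
   weight and the vertical increment. *)
have ha : alive j i (i.+1, j) by rewrite /alive /= eqxx ltnSn.
have hb : alive j i (0%N, j.+1) by rewrite /alive /= (ltnSn j) orbT.
have hc : alive j i (i.+1, j.+1) by rewrite /alive /= (ltnSn j) orbT.
have jS : (j.+1 == j) = false by rewrite eqn_leq ltnn.
have Sa w : state j i (i.+1, j) w = Hor i j w by rewrite /state /= eqxx.
have Sb w : state j i (0%N, j.+1) w = Ver i j w by rewrite /state /= jS eqxx.
have Sc w : state j i (i.+1, j.+1) w = X (i.+1, j.+1) w.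
  by rewrite /state /= jS eqxx ltnn.
have ra : rate j i (i.+1, j) = 1 - rho by rewrite /rate /= eqxx.
have rb : rate j i (0%N, j.+1) = rho by rewrite /rate /= jS eqxx.
have rc : rate j i (i.+1, j.+1) = 1 by rewrite /rate /= jS eqxx ltnn.
have ea := eZ _ ha; have eb := eZ _ hb; have ec := eZ _ hc.
rewrite ra in ea; rewrite rb in eb; rewrite rc -(subrK rho 1) in ec.
have ab : (i.+1, j) != (0%N, j.+1) by [].
have ca : (i.+1, j.+1) != (i.+1, j) by rewrite xpair_eqE eqxx jS.
have cb : (i.+1, j.+1) != (0%N, j.+1) by [].
have [iZ' eU eV] := indep_flip iZ ab ca cb ha hb hc ea eb ec.
have KE k : alive j i.+1 k <-> (alive j i `\ (i.+1, j)) k.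
  case: k => a b; rewrite /alive /=; split.
    move=> /orP[/andP[/eqP-> ia]|jb]; split.
    - by rewrite eqxx (ltnW ia).
    - by move=> [] E; rewrite E ltnn in ia.
    - by rewrite jb orbT.
    - by move=> [_] E; rewrite E ltnn in jb.
  move=> [/orP[/andP[/eqP-> ia]|->]]; last by rewrite orbT.
  move=> ne; apply/orP; left; rewrite eqxx /= ltn_neqAle ia andbT.
  by apply/eqP => E; apply: ne; rewrite E.
have ZE k : alive j i.+1 k -> (if k == (i.+1, j.+1) then
    fun w => state j i (i.+1, j.+1) w +
      Num.max (state j i (i.+1, j) w - state j i (0%N, j.+1) w) 0
    else if k == (0%N, j.+1) then
      fun w => state j i (i.+1, j.+1) w +
        Num.max (state j i (0%N, j.+1) w - state j i (i.+1, j) w) 0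
    else state j i k) = state j i.+1 k.
  move=> /KE[_ ne]; apply/funext => w.
  case: eqP => [->|kc].
    by rewrite Sa Sb Sc /state /= jS eqxx leqnn hor_incS.
  case: eqP => [->|kb].
    by rewrite Sa Sb Sc /state /= jS eqxx ver_incS.
  case: k ne kc kb => a b ne kc kb; rewrite /state /=.
  case: eqP => // bj; case: eqP => // bj1; case: eqP => a0.
    by exfalso; apply: kb; rewrite a0 bj1.
  rewrite [(a <= i.+1)%N]leq_eqVlt ltnS; case: eqP => // ai; exfalso; apply: kc.
  by rewrite ai bj1.
split.
  apply: eq_indep ZE _; apply: indep_sub iZ' => k; exact: (KE k).1.
move=> k ak; rewrite -ZE//; move: (ak) => /KE[ak' ne].
case: eqP => [->|kc]; first by rewrite /rate /= jS eqxx leqnn.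
case: eqP => [->|kb]; first by rewrite /rate /= jS eqxx.
have -> : rate j i.+1 k = rate j i k; last exact: eZ.
case: k ak ak' ne kc kb => a b _ _ ne kc kb; rewrite /rate /=.
case: eqP => // bj; case: eqP => // bj1; case: eqP => // a0.
rewrite [(a <= i.+1)%N]leq_eqVlt ltnS; case: eqP => // ai; exfalso; apply: kc.
by rewrite ai bj1.
Qed.

(** A row is infinite, but independence concerns finitely many indices at a time. For these the
    state is final once [i] has reached the largest of their columns, and there [inv j i]
    applies. *)
Let inv_row j : inv j 0 -> inv j.+1 0.
Proof.
move=> ij0; have ij i : inv j i by elim: i => // i; exact: invS.
have jS : (j.+1 == j) = false by rewrite eqn_leq ltnn.
have KE i k : alive j.+1 0 k -> alive j i k.
  by case: k => a b; rewrite /alive /= => /orP[/andP[/eqP-> _]|/ltnW->];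
    rewrite ?ltnSn orbT.
have ZE i k : alive j.+1 0 k -> (k.1 <= i)%N ->
    state j i k = state j.+1 0 k /\ rate j i k = rate j.+1 0 k.
  case: k => a b; rewrite /alive /= => h ai; split.
    apply/funext => w; rewrite /state /=.
    case: (eqVneq b j.+1) h => [->|bj].
      by rewrite jS ltnn orbF /= => a0; rewrite (gtn_eqF a0) ai.
    rewrite /= => jb; rewrite gtn_eqF ?(ltnW jb)//.
    have [->|a0] := eqVneq a 0%N; last by rewrite leqn0 ?(negPf a0); case: ifP.
    by case: eqP => [->|//]; rewrite /ver_inc stat_lpp0S addrAC subrr add0r.
  rewrite /rate /=.
  case: (eqVneq b j.+1) h => [->|bj].
    by rewrite jS ltnn orbF /= => a0; rewrite (gtn_eqF a0) ai.
  rewrite /= => jb; rewrite gtn_eqF ?(ltnW jb)//.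
  have [_|a0] := eqVneq a 0%N; first by case: ifP.
  by rewrite leqn0 ?(negPf a0); case: ifP.
split; last first.
  move=> k ak; have [<- <-] := ZE k.1 k ak (leqnn _).
  by have [_ h] := ij k.1; apply: h; exact: KE.
split.
  move=> k ak; have [<- _] := ZE k.1 k ak (leqnn _).
  by have [[h _] _] := ij k.1; apply: h; exact: KE.
move=> s us sK A mA; pose i := (\max_(k <- s) k.1)%N.
have si k : k \in s -> (k.1 <= i)%N by move=> ks; apply: leq_bigmax_seq.
have [[_ h] _] := ij i.
have := h s us (fun k ks => KE i k (sK k ks)) A mA.
rewrite (eq_big_seq (fun k => P [set w | A k (state j.+1 0 k w)])); last first.
  by move=> k ks; have [-> _] := ZE i k (sK k ks) (si k ks).
move=> <-; congr (P _); apply/seteqP; split => w /= hw k ks; have := hw k ks;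
  by have [-> _] := ZE i k (sK k ks) (si k ks).
Qed.

Lemma burke_row j :
  let K := [set k : nat * nat | k.2 = j /\ (0 < k.1)%N] in
  let Z := fun (k : nat * nat) w => Hor k.1.-1 k.2 w in
  indep P K Z /\ (forall k, K k -> has_exp_law P (1 - rho) (Z k)).
Proof.
have [iZ eZ] : inv j 0 by elim: j => [|j]; [exact: inv0|exact: inv_row].
have E k : [set k : nat * nat | k.2 = j /\ (0 < k.1)%N] k ->
    alive j 0 k /\ state j 0 k = (fun w => Hor k.1.-1 k.2 w).
  move=> [/= kj k0]; split; first by rewrite /alive /= kj eqxx k0.
  by apply/funext => w; rewrite /state kj eqxx.
split=> [|k Kk].
  apply: (eq_indep (X := state j 0)); first by move=> k /E[].
  by apply: indep_sub iZ => k /E[].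
have [ak <-] := E _ Kk; have := eZ _ ak; rewrite /rate.
by case: Kk => /= -> _; rewrite eqxx.
Qed.

End Burke.

(** * Deviations of stationary last-passage times *)

Section StationaryDeviations.
Context d {T : measurableType d} {R : realType} (P : probability T R).
Implicit Types X : nat * nat -> T -> R.

Definition iid_exp X := indep P setT X /\ (forall k, has_exp_law P 1 (X k)).

Lemma measurable_stat_lpp rho X a b : (forall k, measurable_fun setT (X k)) ->
  measurable_fun setT (fun w => stat_lpp rho (fun i j => X (i, j) w) a b).
Proof.
move=> mX; elim: b a => [|b IHb]; elim=> [|a IHa].
- under eq_fun do rewrite stat_lpp00.
  exact: measurable_cst.
- under eq_fun do rewrite stat_lppS0.
  by apply: measurable_funD => //; exact: measurable_funM.
- under eq_fun do rewrite stat_lpp0S.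
  by apply: measurable_funD => //; exact: measurable_funM.
- under eq_fun do rewrite stat_lppSS.
  by apply: measurable_funD => //; exact: measurable_maxr.
Qed.

Lemma measurable_le_norm (Z : T -> R) r : measurable_fun setT Z ->
  measurable [set w | r <= `|Z w|].
Proof.
move=> mZ; have mZ' : measurable_fun setT (fun w => `|Z w|) by exact: measurableT_comp.
rewrite (_ : [set w | _] = [set w | `[r, +oo[%classic `|Z w|]).
  exact: (measurable_preim mZ' (measurable_itv _)).
by apply/seteqP; split => w /=; rewrite in_itv/= andbT.
Qed.

Lemma row_deviation rho del : 0 < rho -> rho < 1 -> 0 < del ->
  exists2 c : R, 0 < c & forall X N a j m, iid_exp X -> (a <= N)%N -> (a <= m)%N ->
    (P [set w | (del * m%:R <=
       `|stat_lpp rho (fun i k => X (i, k) w) N j -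
         stat_lpp rho (fun i k => X (i, k) w) (N - a) j - a%:R / (1 - rho)|)%R] <=
     (2 * expR (- (c * m%:R)))%:E)%E.
Proof.
move=> rho0 rho1 del0; have rho1' : 0 < 1 - rho by rewrite subr_gt0.
have [c c0 hc] := exp_sum_deviation P (I := (nat * nat)%type) rho1' del0.
exists c => // X N a j m [iX eX] aN am.
have [iZ eZ] := burke_row rho0 rho1 iX eX j.
set K := [set _ | _] in iZ eZ; set Z := (fun _ _ => _) in iZ eZ.
(* The increments of row [j] that end in the columns [N], [N - 1], ..., [N - a + 1]; their sum
   telescopes. *)
pose s := [seq ((N - i)%N, j) | i <- iota 0 a].
have us : uniq s.
  rewrite map_inj_in_uniq ?iota_uniq// => x y; rewrite !mem_iota !add0n => xa ya [] xy.
  lia.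
have sK k : k \in s -> K k.
  by move=> /mapP[i]; rewrite mem_iota add0n => ia ->; split => //=; lia.
have ss : size s = a by rewrite size_map size_iota.
have := hc K Z s m iZ us sK (fun k ks => eZ k (sK k ks)); rewrite ss => /(_ am).
rewrite (_ : [set w | _] = [set w | del * m%:R <=
  `|stat_lpp rho (fun i k => X (i, k) w) N j -
    stat_lpp rho (fun i k => X (i, k) w) (N - a) j - a%:R / (1 - rho)|])//.
have E w : \sum_(k <- s) Z k w = stat_lpp rho (fun i k => X (i, k) w) N j -
    stat_lpp rho (fun i k => X (i, k) w) (N - a) j.
  rewrite big_map; elim: a aN {am us sK ss hc s} => [|a IH] aN.
    by rewrite big_nil subn0 subrr.
  rewrite -addn1 iotaD big_cat/= IH ?(ltnW aN)// big_seq1 add0n.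
  have e1 : (N - a).-1.+1 = (N - a)%N by lia.
  have e2 : (N - a).-1 = (N - (a + 1))%N by lia.
  have -> : Z ((N - a)%N, j) w = stat_lpp rho (fun i k => X (i, k) w) (N - a).-1.+1 j -
    stat_lpp rho (fun i k => X (i, k) w) (N - a).-1 j by [].
  by rewrite e1 e2 addrA subrK.
by apply/seteqP; split => w /=; rewrite E.
Qed.

Lemma iid_exp_transpose X : iid_exp X -> iid_exp (fun k => X (k.2, k.1)).
Proof.
move=> [iX eX]; split; last by move=> k; exact: eX.
by apply: (indep_reindex (phi := fun k => (k.2, k.1)) _ _ iX) => // -[a b] [a' b'] [-> ->].
Qed.

(** The point (N - a, N - b) is reached from (N, N) through (N - a, N). The horizontal leg lies in
    row [N], the vertical one in column [N - a], a row of the transposed model. Each leg may deviate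
    by half of the total, and a union bound turns 2 into 4. *)
Lemma stat_lpp_deviation rho del : 0 < rho -> rho < 1 -> 0 < del ->
  exists2 c : R, 0 < c & forall X N a b, iid_exp X -> (a <= N)%N -> (b <= N)%N ->
    (P [set w | (del * (a + b)%:R <=
       `|stat_lpp rho (fun i k => X (i, k) w) N N -
         stat_lpp rho (fun i k => X (i, k) w) (N - a) (N - b) -
         (a%:R / (1 - rho) + b%:R / rho)|)%R] <=
     (4 * expR (- (c * (a + b)%:R)))%:E)%E.
Proof.
move=> rho0 rho1 del0; have rho1' : 0 < 1 - rho by rewrite subr_gt0.
have del2 : 0 < del / 2 by exact: divr_gt0.
have rho1'' : 1 - rho < 1 by lra.
have [c1 c10 hc1] := row_deviation rho0 rho1 del2.
have [c2 c20 hc2] := row_deviation rho1' rho1'' del2.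
pose c := Num.min c1 c2.
exists c; first by rewrite lt_min c10 c20.
move=> X N a b hX aN bN; set m := (a + b)%N.
have mX k : measurable_fun setT (X k) by have [[h _] _] := hX; exact: h.
have h1 := hc1 X N a N m hX aN (leq_addr _ _).
have h2 := hc2 _ N b (N - a)%N m (iid_exp_transpose hX) bN (leq_addl _ _).
have cle c' : c <= c' -> 2 * expR (- (c' * m%:R)) <= 2 * expR (- (c * m%:R)).
  by move=> cc; rewrite ler_pM2l// ler_expR lerN2 ler_wpM2r.
set A1 := [set w | _] in h1; set A2 := [set w | _] in h2.
have mH i j := measurable_stat_lpp rho i j mX.
have mH' i j : measurable_fun setT (fun w => stat_lpp (1 - rho) (fun i k => X (k, i) w) i j).
  exact: (measurable_stat_lpp (1 - rho) (X := fun k => X (k.2, k.1)) i j).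
have mA1 : measurable A1.
  by apply: measurable_le_norm; do 2 apply: measurable_funB => //.
have mA2 : measurable A2.
  by apply: measurable_le_norm; do 2 apply: measurable_funB => //.
apply: (@le_trans _ _ (P (A1 `|` A2))); last first.
  apply: le_trans (measureU2 _ _ _) _ => //.
  have -> : 4 * expR (- (c * m%:R)) = 2 * expR (- (c * m%:R)) + 2 * expR (- (c * m%:R)).
    by ring.
  rewrite EFinD; apply: leeD.
    by apply: le_trans h1 _; rewrite lee_fin cle// ge_min lexx.
  by apply: le_trans h2 _; rewrite lee_fin cle// ge_min lexx orbT.
apply: le_measure; rewrite ?inE//.
- by apply: measurable_le_norm; do 2 apply: measurable_funB => //.
- exact: measurableU.
move=> w /= h.
have E i j : stat_lpp (1 - rho) (fun i k => X (k, i) w) i j =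
    stat_lpp rho (fun i k => X (i, k) w) j i.
  by rewrite -(stat_lpp_transpose rho).
rewrite /A1 /A2 /=.
case: (leP (del / 2 * m%:R) (`|stat_lpp rho (fun i k => X (i, k) w) N N -
  stat_lpp rho (fun i k => X (i, k) w) (N - a) N - a%:R / (1 - rho)|)) => h3.
  by left.
right; rewrite !E subKr.
set x := stat_lpp _ _ N N in h h3; set y := stat_lpp _ _ _ N in h3 *.
set z := stat_lpp _ _ _ _ in h *.
have h4 : `|x - z - (a%:R / (1 - rho) + b%:R / rho)| <=
    `|x - y - a%:R / (1 - rho)| + `|y - z - b%:R / rho|.
  by apply: le_trans (ler_normD _ _); rewrite le_eqVlt; apply/orP; left; apply/eqP; congr `| _ |; ring.
lra.
Qed.

End StationaryDeviations.

(** * Lattice paths and geodesics *)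

Lemma up_right_stepP (u v : Z2) : reflect
  ((v.1 = u.1 + 1 /\ v.2 = u.2) \/ (v.1 = u.1 /\ v.2 = u.2 + 1)) (up_right_step u v).
Proof.
case: u v => u1 u2 [v1 v2]; rewrite /up_right_step /unit_vec /= !xpair_eqE !subr_eq.
apply: (iffP orP) => /=.
  by case=> /andP[/eqP-> /eqP->]; [left|right]; split; lia.
by case=> -[-> ->]; [left|right]; apply/andP; split; apply/eqP; lia.
Qed.

Definition up_right (x : nat -> Z2) := forall k, up_right_step (x k) (x k.+1).

Lemma up_right_coords x k l : up_right x -> (k <= l)%N ->
  [/\ (x k).1 <= (x l).1, (x k).2 <= (x l).2 &
      (x l).1 + (x l).2 = (x k).1 + (x k).2 + (l - k)%N%:Z].
Proof.
move=> ux /subnKC <-; elim: (l - k)%N => [|m [h1 h2 h3]].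
  by rewrite addn0 subnn addr0 !lexx.
have /up_right_stepP := ux (k + m)%N; rewrite addnS => h.
have -> : ((k + m).+1 - k)%N = m.+1 by lia.
have h' : ((k + m) - k)%N = m by lia.
rewrite h' in h3; case: h => -[-> ->]; split; lia.
Qed.

(** Finite paths are prolonged, by horizontal steps beyond the last point, so that [up_right_coords]
    applies to them too. *)
Lemma up_right_path_seq (p : seq Z2) : sorted up_right_step p ->
  exists2 x, up_right x & forall i, (i < size p)%N -> p`_i = x i.
Proof.
case: p => [_|z p sp].
  by exists (fun i => (i%:Z, 0)) => // k; apply/up_right_stepP; left; split => /=; lia.
pose x i : Z2 := if (i < size (z :: p))%N then (z :: p)`_i
  else last z p + unit_vec 1 *+ (i - size p).
exists x; last by move=> i ip; rewrite /x ip.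
move=> k; rewrite /x.
have [h1|h1] := ltnP k.+1 (size (z :: p)).
  by rewrite (ltnW h1); move/(sortedP 0) : sp; apply.
have [h2|h2] := ltnP k (size (z :: p)).
  have -> : k = size p by apply/eqP; rewrite eqn_leq -ltnS h2 /= -ltnS.
  have -> : (z :: p)`_(size p) = last z p by rewrite nth_last.
  by rewrite subSnn mulr1n /up_right_step addrAC subrr add0r eqxx.
rewrite /= in h2 *; rewrite (subSn (ltnW h2)) mulrSr /up_right_step.
by rewrite opprD addrACA subrr add0r addrAC subrr add0r eqxx.
Qed.

Lemma l1norm_up_right x k l : up_right x -> (k <= l)%N -> l1norm (x l - x k) = (l - k)%N.
Proof.
move=> ux kl; have [h1 h2 h3] := up_right_coords ux kl; rewrite /l1norm /=.
lia.
Qed.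

Section Geodesics.
Context {R : realType} (W : Z2 -> R).

Lemma segment_up_right_path x k l : up_right x -> (k <= l)%N ->
  up_right_paths (x k) (x l) [seq x i | i <- iota k (l - k).+1].
Proof.
move=> ux kl; split.
- by rewrite size_map size_iota l1norm_up_right.
- apply/(sortedP 0) => i; rewrite size_map size_iota => il.
  rewrite !(nth_map 0%N) ?size_iota ?(ltnW il)// !nth_iota ?(ltnW il)// addnS.
  exact: ux.
- by rewrite (nth_map 0%N) ?size_iota// nth_iota// addn0.
- rewrite l1norm_up_right// (nth_map 0%N) ?size_iota// nth_iota//.
  by rewrite subnKC.
Qed.

Lemma sum_segment x k l : up_right x -> (k <= l)%N ->
  \sum_(0 <= i < (l1norm (x l - x k)).+1) W [seq x i | i <- iota k (l - k).+1]`_i =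
  \sum_(k <= i < l.+1) W (x i).
Proof.
move=> ux kl; rewrite l1norm_up_right//.
have -> : \sum_(k <= i < l.+1) W (x i) = \sum_(0 <= i < (l - k).+1) W (x (i + k)%N).
  by rewrite -{1}(add0n k) big_addn subSn.
apply: eq_big_nat => i /andP[_ il].
by rewrite (nth_map 0%N) ?size_iota// nth_iota// addnC.
Qed.

Lemma last_passage_max x k l : up_right x -> (k <= l)%N ->
  (forall p, up_right_paths (x k) (x l) p ->
     \sum_(0 <= i < (l - k).+1) W p`_i <= \sum_(k <= i < l.+1) W (x i)) ->
  last_passage W (x k) (x l) = \sum_(k <= i < l.+1) W (x i).
Proof.
move=> ux kl hp; rewrite /last_passage.
set A := [set _ | _ in _].
have Ax : A (\sum_(k <= i < l.+1) W (x i)).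
  exists [seq x i | i <- iota k (l - k).+1]; first exact: segment_up_right_path.
  exact: sum_segment.
have ubA : ubound A (\sum_(k <= i < l.+1) W (x i)).
  by move=> _ [p px <-]; rewrite l1norm_up_right//; exact: hp.
apply/eqP; rewrite eq_le; apply/andP; split.
  by apply: ge_sup => //; exists (\sum_(k <= i < l.+1) W (x i)).
by apply: ub_le_sup => //; exists (\sum_(k <= i < l.+1) W (x i)).
Qed.

(** Pairs with different end points are included: the almost sure proof uses only the common start
    and the common size. *)
Definition distinct_path_weights := forall p q : seq Z2,
  sorted up_right_step p -> sorted up_right_step q -> size p = size q ->
  p`_0 = q`_0 -> p != q -> \sum_(z <- p) W z != \sum_(z <- q) W z.

(** Both initial segments have as weight the last-passage time between the same two points, hence
    they coincide. *)
Lemma geodesic_agree x y n : distinct_path_weights ->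
  semi_infinite_geodesic W x -> semi_infinite_geodesic W y ->
  x 0%N = y 0%N -> x n = y n -> forall i, (i <= n)%N -> x i = y i.
Proof.
move=> U [ux gx] [uy gy] xy0; case: n => [|n] xyn i ni.
  by move: ni; rewrite leqn0 => /eqP->.
pose px := [seq x i | i <- iota 0 n.+2]; pose py := [seq y i | i <- iota 0 n.+2].
have nthE (z : nat -> Z2) j : (j < n.+2)%N -> [seq z i | i <- iota 0 n.+2]`_j = z j.
  by move=> jn; rewrite (nth_map 0%N) ?size_iota// nth_iota.
have srt (z : nat -> Z2) : up_right z -> sorted up_right_step [seq z i | i <- iota 0 n.+2].
  move=> uz; apply/(sortedP 0) => j; rewrite size_map size_iota => jn.
  by rewrite !nthE// ?(ltnW jn).
have sumE (z : nat -> Z2) : \sum_(v <- [seq z i | i <- iota 0 n.+2]) W v =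
    \sum_(0 <= i < n.+2) W (z i).
  by rewrite big_map /index_iota subn0.
have [pxy|pxy] := eqVneq px py.
  by rewrite -(nthE x) ?ltnS// -/px pxy nthE ?ltnS.
have := U px py (srt x ux) (srt y uy) _ _ pxy.
rewrite !size_map !nthE// !sumE -gx// -gy// xy0 xyn eqxx => h.
by have := h erefl erefl.
Qed.

(** In one step the horizontal coordinates change by at most one, so paths from a common point
    cannot change sides without meeting at a common level; by [geodesic_agree] a meeting would erase
    every earlier separation. *)
Lemma geodesic_stays_left x y n : distinct_path_weights ->
  semi_infinite_geodesic W x -> semi_infinite_geodesic W y ->
  x 0%N = y 0%N -> (x n).1 < (y n).1 -> forall m, (x m).1 <= (y m).1.
Proof.
move=> U gx gy xy0 xyn m; rewrite leNgt; apply/negP => yxm.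
have [ux _] := gx; have [uy _] := gy.
have level i : (x i).1 = (y i).1 -> x i = y i.
  move=> e; have [_ _ h1] := up_right_coords ux (leq0n i).
  have [_ _ h2] := up_right_coords uy (leq0n i).
  rewrite (surjective_pairing (x i)) (surjective_pairing (y i)) e; congr pair.
  rewrite xy0 in h1; lia.
have step i : (x i).1 < (y i).1 -> (x i.+1).1 <= (y i.+1).1.
  by move=> h; case/up_right_stepP: (ux i) => -[-> _];
    case/up_right_stepP: (uy i) => -[-> _]; lia.
have step' i : (y i).1 < (x i).1 -> (y i.+1).1 <= (x i.+1).1.
  by move=> h; case/up_right_stepP: (ux i) => -[-> _];
    case/up_right_stepP: (uy i) => -[-> _]; lia.
have stay i j : (x i).1 < (y i).1 -> (x (i + j)%N).1 < (y (i + j)%N).1.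
  move=> h; elim: j => [|j IH]; first by rewrite addn0.
  have := step _ IH; rewrite -addnS le_eqVlt => /predU1P[e|//].
  have := geodesic_agree U gx gy xy0 (level _ e) (leq_addr j.+1 i) => e'.
  by rewrite e' ltxx in h.
have stay' i j : (y i).1 < (x i).1 -> (y (i + j)%N).1 < (x (i + j)%N).1.
  move=> h; elim: j => [|j IH]; first by rewrite addn0.
  have := step' _ IH; rewrite -addnS le_eqVlt => /predU1P[/esym e|//].
  have := geodesic_agree U gx gy xy0 (level _ e) (leq_addr j.+1 i) => e'.
  by rewrite e' ltxx in h.
(* Both strict orders would persist to level [n + m]. *)
have := stay _ m xyn; have := stay' _ n yxm; rewrite addnC => h1 h2.
by have := lt_trans h1 h2; rewrite ltxx.
Qed.

Lemma geodesic_shift x j : semi_infinite_geodesic W x ->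
  semi_infinite_geodesic W (fun n => x (j + n)%N).
Proof.
move=> [ux gx]; split=> [k|k l kl]; first by rewrite addnS; exact: ux.
rewrite gx ?ltn_add2l// -addnS (addnC j k) big_addn addKn.
by apply: eq_bigr => i _; rewrite addnC.
Qed.

End Geodesics.

(** Koenig's lemma: a word is good if it is a prefix of [b N] for arbitrarily large [N] in [Q], and
    every good word has a good extension by one letter. *)
Lemma binary_konig (Q : nat -> Prop) (b : nat -> nat -> bool) :
  (forall K, exists2 N, (K <= N)%N & Q N) ->
  exists s : nat -> bool, forall n K, exists N,
    [/\ (K <= N)%N, Q N & forall i, (i < n)%N -> b N i = s i].
Proof.
move=> Qoo.
pose good (w : seq bool) := forall K, exists N,
  [/\ (K <= N)%N, Q N & forall i, (i < size w)%N -> b N i = nth false w i].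
have good_nil : good [::] by move=> K; have [N KN QN] := Qoo K; exists N.
have good_ext w : good w -> good (rcons w true) \/ good (rcons w false).
  move=> gw; have [gt|/existsNP[K hK]] := pselect (good (rcons w true)); first by left.
  right=> L; have [N [LN QN hN]] := gw (maxn K L).
  exists N; split=> //; first by apply: leq_trans LN; exact: leq_maxr.
  move=> i; rewrite size_rcons ltnS leq_eqVlt => /predU1P[->|iw]; last first.
    by rewrite nth_rcons iw; exact: hN.
  rewrite nth_rcons ltnn eqxx; apply/negP => bN; apply: hK; exists N; split=> //.
    by apply: leq_trans LN; exact: leq_maxl.
  move=> j; rewrite size_rcons ltnS leq_eqVlt => /predU1P[->|jw].
    by rewrite nth_rcons ltnn eqxx.
  by rewrite nth_rcons jw; exact: hN.
pose fix w n := if n is n'.+1 then rcons (w n') `[< good (rcons (w n') true) >] else [::].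
have gw n : good (w n).
  elim: n => [//|n IH] /=; case: asboolP => // ng.
  by case: (good_ext _ IH).
have sw n : size (w n) = n by elim: n => //= n IH; rewrite size_rcons IH.
exists (fun i => nth false (w i.+1) i) => n K.
have [N [KN QN hN]] := gw n K; exists N; split=> // i ni.
rewrite hN ?sw//; elim: n ni {hN} => // n IH; rewrite ltnS leq_eqVlt => /predU1P[->//|ni].
by rewrite [in LHS]/= nth_rcons sw ni; exact: IH.
Qed.

(** Coding paths by Booleans, [true] for a horizontal step, reduces the compactness of the space of
    paths to [binary_konig]. *)
Definition walk (x : Z2) (s : nat -> bool) (n : nat) : Z2 :=
  x + (\sum_(i < n) (s i)%:Z, \sum_(i < n) (~~ s i)%:Z).

Lemma walk0 x s : walk x s 0 = x.
Proof. by rewrite /walk !big_ord0 addr0. Qed.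

Lemma walkS x s n : walk x s n.+1 = walk x s n + (if s n then (1, 0) else (0, 1)).
Proof.
rewrite /walk !big_ord_recr /= -addrA; congr (_ + _).
by case: (s n); apply: injective_projections => /=; rewrite ?addr0.
Qed.

Lemma up_right_walk x s : up_right (walk x s).
Proof.
move=> k; rewrite walkS /up_right_step addrAC subrr add0r.
by case: (s k).
Qed.

Lemma walk_eq x s s' n : (forall i, (i < n)%N -> s i = s' i) ->
  forall i, (i <= n)%N -> walk x s i = walk x s' i.
Proof.
move=> h i ni; rewrite /walk; congr (_ + (_, _)); apply: eq_bigr => -[j ji] _ /=;
  by rewrite h//; exact: leq_trans ji ni.
Qed.

Lemma up_right_walkE x : up_right x ->
  x = walk (x 0%N) (fun i => x i.+1 - x i == unit_vec 1).
Proof.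
move=> ux; apply/funext; elim=> [|n IH]; first by rewrite walk0.
rewrite walkS -IH; have := ux n; rewrite /up_right_step.
case: eqP => [/= e _|_ /= /eqP e]; rewrite -[LHS](subrK (x n)) addrC.
  by rewrite e.
by rewrite e.
Qed.

(** * Slopes of semi-infinite geodesics *)

Section Directions.
Context {R : realType}.

(** Given the start, this number determines the position of an up-right path at level [n]. So a
    direction is encoded by a scalar slope [t], standing for (t, 1 - t), and geodesics from one
    point are ordered by it. *)
Definition hor_disp (x : nat -> Z2) (n : nat) : R := ((x n).1 - (x 0%N).1)%:~R.

Lemma hor_disp_bounds x n : up_right x -> 0 <= hor_disp x n <= n%:R.
Proof.
move=> ux; have [h1 h2 h3] := up_right_coords ux (leq0n n).
rewrite /hor_disp ler0z subr_ge0 h1 /= -[n%:R]/(n%:Z%:~R) ler_int.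
rewrite subn0 in h3; lia.
Qed.

Lemma ver_disp x n : up_right x ->
  ((x n).2 - (x 0%N).2)%:~R = n%:R - hor_disp x n.
Proof.
move=> ux; have [_ _ h3] := up_right_coords ux (leq0n n).
rewrite /hor_disp -[n%:R]/(n%:Z%:~R) -intrB; congr (_%:~R).
rewrite subn0 in h3; lia.
Qed.

Definition asymptotic_slope (x : nat -> Z2) (t : R) := forall e, 0 < e ->
  exists M, forall n, (M <= n)%N -> `|hor_disp x n - t * n%:R| <= e * n%:R.

Definition eventually_in_cone (x : nat -> Z2) (a b : R) :=
  exists M, forall n, (M <= n)%N -> a * n%:R <= hor_disp x n <= b * n%:R.

Variable W : Z2 -> R.

Definition cone_geodesic (z : Z2) (a b : R) := exists x : nat -> Z2,
  [/\ semi_infinite_geodesic W x, x 0%N = z & eventually_in_cone x a b].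

Lemma eventually_pos (P : nat -> Prop) M : (forall n, (M <= n)%N -> P n) ->
  exists n, [/\ (M <= n)%N, (0 < n)%N & P n].
Proof.
move=> h; exists (maxn M 1); rewrite leq_maxl leq_max orbT; split=> //.
by apply: h; rewrite leq_maxl.
Qed.

Hypothesis W_distinct : distinct_path_weights W.
Hypothesis W_cones : forall z (a b : rat), 0 < a -> a < b -> b < 1 ->
  cone_geodesic z (ratr a) (ratr b).

Lemma cone_geodesic_between z (u v : R) : 0 <= u -> u < v -> v <= 1 ->
  exists a b : R, [/\ u < a, a < b, b < v & cone_geodesic z a b].
Proof.
move=> u0 uv v1.
have [a /andP[]] := rat_in_itvoo uv; rewrite !bnd_simp => ua av.
have [b /andP[]] := rat_in_itvoo av; rewrite !bnd_simp => ab bv.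
exists (ratr a), (ratr b); split=> //; apply: W_cones.
- by rewrite -(ltr0q R); exact: le_lt_trans ua.
- by rewrite -(ltr_rat R).
- by rewrite -(ltr_rat R) rmorph1; exact: lt_le_trans bv _.
Qed.

Lemma hor_disp_lt x y n : x 0%N = y 0%N ->
  (hor_disp x n < hor_disp y n) = ((x n).1 < (y n).1).
Proof. by move=> e; rewrite /hor_disp e ltr_int ltrBlDr subrK. Qed.

Lemma hor_disp_le x y n : x 0%N = y 0%N ->
  (hor_disp x n <= hor_disp y n) = ((x n).1 <= (y n).1).
Proof. by move=> e; rewrite /hor_disp e ler_int lerBlDr subrK. Qed.

(* If the slope of a geodesic oscillated, it would be infinitely often on both
   sides of a geodesic confined to a cone strictly between its limit points. *)
Lemma geodesic_slope x : semi_infinite_geodesic W x ->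
  exists2 t : R, 0 <= t <= 1 & asymptotic_slope x t.
Proof.
move=> gx; have [ux _] := gx.
(* The supremum of [E] is the lower limit of the slope of [x]; the work is to bound the upper limit
   by the same number. *)
pose E := [set a : R | exists M, forall n, (M <= n)%N -> a * n%:R <= hor_disp x n].
have E0 : E 0.
  by exists 0%N => n _; rewrite mul0r; have /andP[] := hor_disp_bounds n ux.
have ubE : ubound E 1.
  move=> a [M /eventually_pos[n [_ n0 h]]].
  have /andP[_ h'] := hor_disp_bounds n ux.
  by rewrite -(ler_pM2r (x := n%:R)) ?ltr0n// mul1r (le_trans h).
have t0 : 0 <= sup E by apply: ub_le_sup => //; exists 1.
have t1 : sup E <= 1 by apply: ge_sup => //; exists 0.
exists (sup E); first by rewrite t0 t1.
move=> e e0.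
have [a Ea ta] : exists2 a, E a & sup E - e < a.
  by apply: sup_adherent => //; split; [exists 0|exists 1].
have [M hM] := Ea.
have [N hN] : exists N, forall n, (N <= n)%N -> hor_disp x n <= (sup E + e) * n%:R.
  apply: contrapT => /forallNP hN.
  have oo K : exists2 n, (K <= n)%N & (sup E + e) * n%:R < hor_disp x n.
    have /existsNP[n /not_implyP[Kn /negP]] := hN K; rewrite -ltNge => h.
    by exists n.
  have te1 : sup E + e <= 1.
    have [n n0 h] := oo 1%N; have /andP[_ h'] := hor_disp_bounds n ux.
    by rewrite -(ler_pM2r (x := n%:R)) ?ltr0n// mul1r ltW// (lt_le_trans h).
  have tte : sup E < sup E + e by rewrite ltrDl.
  have [a' [b' [ta' ab' bt [y [gy y0 [L hL]]]]]] := cone_geodesic_between (x 0%N) t0 tte te1.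
  have [n Ln hn] := oo L.
  have /andP[_ yb] := hL n Ln.
  have yx : (y n).1 < (x n).1.
    rewrite -(hor_disp_lt _ y0); apply: le_lt_trans hn; apply: le_trans yb _.
    by rewrite ler_wpM2r// ltW.
  (* A single level at which [x] is strictly to the right of [y] keeps it weakly to the right
     forever; then [a'], which exceeds [sup E], belongs to [E]. *)
  have lyx := geodesic_stays_left W_distinct gy gx y0 yx.
  have Ea' : E a'.
    exists L => m Lm; have /andP[h _] := hL m Lm; apply: le_trans h _.
    by rewrite (hor_disp_le _ y0).
  have : a' <= sup E by apply: ub_le_sup => //; exists 1.
  by rewrite leNgt ta'.
exists (maxn M N) => n; rewrite geq_max => /andP[/hM h1 /hN h2].
rewrite ler_norml; apply/andP; split; last by lra.
have : (sup E - e) * n%:R <= a * n%:R by rewrite ler_wpM2r// ltW.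
lra.
Qed.

(** A segment of the limit is a segment of [xs N] for some large [N] in [Q]. So it is enough that
    each segment of [xs N] is optimal from some [N] on: the approximants may be geodesic only up to
    a growing horizon. *)
Lemma semi_infinite_geodesic_limit z (xs : nat -> nat -> Z2) (Q : nat -> Prop) :
  (forall K, exists2 N, (K <= N)%N & Q N) ->
  (forall N, up_right (xs N)) -> (forall N, xs N 0%N = z) ->
  (forall k l, (k < l)%N -> exists L, forall N, (L <= N)%N -> Q N ->
     last_passage W (xs N k) (xs N l) = \sum_(k <= i < l.+1) W (xs N i)) ->
  exists x, [/\ semi_infinite_geodesic W x, x 0%N = z &
    forall n K, exists N, [/\ (K <= N)%N, Q N & forall i, (i <= n)%N -> xs N i = x i]].
Proof.
move=> Qoo uxs xs0 gxs.
have [s hs] := binary_konig (fun N i => xs N i.+1 - xs N i == unit_vec 1) Qoo.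
have h n K : exists N, [/\ (K <= N)%N, Q N & forall i, (i <= n)%N -> xs N i = walk z s i].
  have [N [KN QN hN]] := hs n K; exists N; split=> // i ni.
  by rewrite (up_right_walkE (uxs N)) xs0; exact: (walk_eq _ hN).
exists (walk z s); rewrite walk0; split=> //; split; first exact: up_right_walk.
move=> k l kl; have [L hL] := gxs k l kl.
have [N [LN QN hN]] := h l L.
rewrite -!hN ?(ltnW kl)// hL//.
by apply: eq_big_nat => i /andP[_ il]; rewrite hN.
Qed.

(** The level from which the k-th approximant stays in its cone may grow with k, so the limit need
    not inherit the cones. It is confined by geodesics from [z] with slopes close to [t] instead:
    late approximants are on one side of such a geodesic at a large level, hence at all levels, and
    so is the limit. *)
Lemma slope_geodesic z (t : R) : 0 <= t <= 1 ->
  exists x, [/\ semi_infinite_geodesic W x, x 0%N = z & asymptotic_slope x t].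
Proof.
move=> /andP[t0 t1].
have hk (k : nat) : exists x, [/\ semi_infinite_geodesic W x, x 0%N = z &
    eventually_in_cone x (t - k.+1%:R^-1) (t + k.+1%:R^-1)].
  have : 0 < k.+1%:R^-1 :> R by rewrite invr_gt0.
  move: (k.+1%:R^-1 : R) => q q0.
  pose u := Num.max 0 (t - q); pose v := Num.min 1 (t + q).
  have uv : u < v.
    rewrite lt_min !gt_max; apply/andP; split; apply/andP; split; lra.
  have u0 : 0 <= u by rewrite le_max lexx.
  have v1 : v <= 1 by rewrite ge_min lexx.
  have [a [b [ua ab bv [x [gx x0 [M hM]]]]]] := cone_geodesic_between z u0 uv v1.
  exists x; split=> //; exists M => n /hM /andP[h1 h2]; apply/andP; split.
    apply: le_trans h1; rewrite ler_wpM2r//; apply: le_trans (ltW ua).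
    by rewrite le_max lexx orbT.
  apply: le_trans h2 _; rewrite ler_wpM2r//; apply: le_trans (ltW bv) _.
  by rewrite ge_min lexx orbT.
have [xs hxs] := choice hk.
have [x [gx x0 hx]] : exists x, [/\ semi_infinite_geodesic W x, x 0%N = z &
    forall n K, exists N, [/\ (K <= N)%N, True & forall i, (i <= n)%N -> xs N i = x i]].
  apply: semi_infinite_geodesic_limit.
  - by move=> K; exists K.
  - by move=> N; have [[]] := hxs N.
  - by move=> N; have [] := hxs N.
  - by move=> k l kl; exists 0%N => N _ _; have [[_ h] _ _] := hxs N; exact: h.
exists x; split=> // e e0; have [ux _] := gx.
have small : exists K, forall N, (K <= N)%N -> N.+1%:R^-1 < e / 3 :> R.
  exists (Num.trunc (3 / e)) => N KN.
  have e3 : 0 < 3 / e by rewrite divr_gt0.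
  have : 3 / e < N.+1%:R.
    by apply: lt_le_trans (truncnS_gt _) _; rewrite ler_nat ltnS.
  by rewrite -(ltf_pV2 _ _) ?posrE// invf_div.
have [K hK] := small.
have [M1 hM1] : exists M, forall n, (M <= n)%N -> hor_disp x n <= (t + e) * n%:R.
  (* If [t + e >= 1], every path obeys the bound. Otherwise there is a geodesic [y] with slopes
     between [t + e / 3] and [t + 2 * e / 3], to the right of all approximants with cones narrower
     than [e / 3]. *)
  have [te|te] := leP 1 (t + e).
    exists 0%N => n _; have /andP[_ h] := hor_disp_bounds n ux; apply: le_trans h _.
    by rewrite ler_peMl.
  have [] := @cone_geodesic_between z (t + e / 3) (t + 2 * e / 3); [lra|lra|lra|].
  move=> a [b [ta ab bt [y [gy y0 [M hM]]]]].
  exists M => n Mn; have /andP[_ h] := hM n Mn.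
  have [N [KN _ hN]] := hx n K.
  have [gN N0 [L hL]] := hxs N.
  pose m := maxn (maxn L M) 1.
  have /hL /andP[_ h1] : (L <= m)%N by rewrite /m; lia.
  have /hM /andP[h2 _] : (M <= m)%N by rewrite /m; lia.
  have m0 : 0 < m%:R :> R by rewrite ltr0n /m; lia.
  have xy0 : xs N 0%N = y 0%N by rewrite N0 y0.
  have xy : (xs N m).1 < (y m).1.
    rewrite -(hor_disp_lt _ xy0); apply: le_lt_trans h1 _; apply: lt_le_trans h2.
    by rewrite ltr_pM2r//; have := hK _ KN; move: (_^-1 : R) => q; lra.
  have := geodesic_stays_left W_distinct gN gy xy0 xy n.
  rewrite -(hor_disp_le _ xy0) => h3.
  have -> : hor_disp x n = hor_disp (xs N) n by rewrite /hor_disp !hN.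
  by apply: le_trans h3 _; apply: le_trans h _; rewrite ler_wpM2r//; lra.
have [M2 hM2] : exists M, forall n, (M <= n)%N -> (t - e) * n%:R <= hor_disp x n.
  have [te|te] := leP (t - e) 0.
    exists 0%N => n _; have /andP[h _] := hor_disp_bounds n ux; apply: le_trans h.
    by rewrite mulr_le0_ge0.
  have [] := @cone_geodesic_between z (t - 2 * e / 3) (t - e / 3); [lra|lra|lra|].
  move=> a [b [ta ab bt [y [gy y0 [M hM]]]]].
  exists M => n Mn; have /andP[h _] := hM n Mn.
  have [N [KN _ hN]] := hx n K.
  have [gN N0 [L hL]] := hxs N.
  pose m := maxn (maxn L M) 1.
  have /hL /andP[h1 _] : (L <= m)%N by rewrite /m; lia.
  have /hM /andP[_ h2] : (M <= m)%N by rewrite /m; lia.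
  have m0 : 0 < m%:R :> R by rewrite ltr0n /m; lia.
  have yx0 : y 0%N = xs N 0%N by rewrite N0 y0.
  have yx : (y m).1 < (xs N m).1.
    rewrite -(hor_disp_lt _ yx0); apply: le_lt_trans h2 _; apply: lt_le_trans h1.
    by rewrite ltr_pM2r//; have := hK _ KN; move: (_^-1 : R) => q; lra.
  have := geodesic_stays_left W_distinct gy gN yx0 yx n.
  rewrite -(hor_disp_le _ yx0) => h3.
  have -> : hor_disp x n = hor_disp (xs N) n by rewrite /hor_disp !hN.
  by apply: le_trans h3; apply: le_trans h; rewrite ler_wpM2r//; lra.
exists (maxn M1 M2) => n; rewrite geq_max => /andP[/hM1 h1 /hM2 h2].
by rewrite ler_norml; apply/andP; split; lra.
Qed.

End Directions.

(** * Directions, and uniqueness along the axes *)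

Section GeodesicDirections.
Context {R : realType}.

Lemma slope_cvg (c t : R) (f : nat -> R) :
  (forall e, 0 < e -> exists M, forall n, (M <= n)%N -> `|f n - t * n%:R| <= e * n%:R) ->
  (fun n => (c + f n) / n%:R) @ \oo --> t.
Proof.
move=> h; apply/cvgrPdist_le => e e0.
have e2 : 0 < e / 2 by rewrite divr_gt0.
have [M hM] := h _ e2.
exists (maxn (maxn M 1) (Num.trunc (2 * `|c| / e)).+1) => // n /=.
rewrite !geq_max => /andP[/andP[/hM h1 n0] h2].
have n0' : 0 < n%:R :> R by rewrite ltr0n.
have h3 : `|c| <= e / 2 * n%:R.
  have : 2 * `|c| / e < n%:R.
    by apply: lt_le_trans (truncnS_gt _) _; rewrite ler_nat.
  by rewrite ltr_pdivrMr// => h3; lra.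
have -> : t - (c + f n) / n%:R = - ((c + (f n - t * n%:R)) / n%:R).
  by field; rewrite gt_eqF.
rewrite normrN normrM normfV (gtr0_norm n0') ler_pdivrMr//.
apply: le_trans (ler_normD _ _) _; lra.
Qed.

Lemma asymptotic_slope_hor x (t : R) : asymptotic_slope x t ->
  (fun n => (x n).1%:~R / n%:R : R) @ \oo --> t.
Proof.
move=> /(slope_cvg (x 0%N).1%:~R); under eq_fun do rewrite /hor_disp -intrD subrKC.
by [].
Qed.

Lemma asymptotic_slope_ver x (t : R) : up_right x -> asymptotic_slope x t ->
  (fun n => (x n).2%:~R / n%:R : R) @ \oo --> 1 - t.
Proof.
move=> ux sx.
have : (fun n => ((x 0%N).2%:~R + (n%:R - hor_disp x n)) / n%:R : R) @ \oo --> 1 - t.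
  apply: slope_cvg => e /sx[M hM]; exists M => n /hM.
  by rewrite -normrN; congr (`|_| <= _); ring.
by under eq_fun do rewrite -ver_disp// -intrD subrKC.
Qed.

Lemma asymptotic_slope_directed x (t : R) : up_right x -> asymptotic_slope x t ->
  directed (t, 1 - t) x.
Proof.
move=> ux sx; exact: (cvg_pair (asymptotic_slope_hor sx) (asymptotic_slope_ver ux sx)).
Qed.

Variable W : Z2 -> R.

Lemma axis_coords (z : Z2) (r n : nat) : z + unit_vec r *+ n =
  if r == 1%N then (z.1 + n%:Z, z.2) else (z.1, z.2 + n%:Z).
Proof.
elim: n => [|n IH].
  by rewrite mulr0n !addr0; case: z => ? ?; case: ifP.
rewrite mulrSr addrA IH /unit_vec; case: ifP => _; apply: injective_projections => /=; lia.
Qed.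

(** Between two points of a horizontal or vertical line there is only one up-right path. *)
Lemma axis_geodesic (z : Z2) (r : nat) : r \in [:: 1; 2]%N ->
  semi_infinite_geodesic W (fun k => z + unit_vec r *+ k).
Proof.
move=> r12; pose x k : Z2 := z + unit_vec r *+ k.
have ux : up_right x.
  move=> k; rewrite /x /up_right_step mulrSr addrA [_ + unit_vec r - _]addrC addKr.
  by move: r12; rewrite !inE => /orP[]/eqP->; rewrite eqxx ?orbT.
split=> // k l kl; apply: (last_passage_max ux (ltnW kl)) => p [sz sp p0 pl].
rewrite (l1norm_up_right ux (ltnW kl)) in sz pl.
have [y uy py] := up_right_path_seq sp.
have E i : (i <= l - k)%N -> p`_i = x (k + i)%N.
  move=> il; rewrite py ?sz ?ltnS//.
  have y0 : y 0%N = x k by rewrite -py ?sz.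
  have yl : y (l - k)%N = x l by rewrite -py ?sz.
  have [a1 a2 a3] := up_right_coords uy (leq0n i).
  have [b1 b2 b3] := up_right_coords uy il.
  have [_ _ c3] := up_right_coords ux (leq_addr i k).
  rewrite y0 in a1 a2 a3; rewrite yl in b1 b2 b3.
  have coord j : (r = 1%N -> (x j).2 = z.2) /\ (r = 2%N -> (x j).1 = z.1).
    by split=> rE; rewrite /x axis_coords rE.
  have [k1 k2] := coord k; have [l1 l2] := coord l; have [j1 j2] := coord (k + i)%N.
  rewrite subn0 in a3; rewrite addKn in c3.
  rewrite (surjective_pairing (y i)) (surjective_pairing (x (k + i)%N)).
  move: r12; rewrite !inE => /orP[]/eqP r_eq.
    by have := k1 r_eq; have := l1 r_eq; have := j1 r_eq => e1 e2 e3; congr pair; lia.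
  by have := k2 r_eq; have := l2 r_eq; have := j2 r_eq => e1 e2 e3; congr pair; lia.
have -> : \sum_(k <= i < l.+1) W (x i) = \sum_(0 <= i < (l - k).+1) W (x (i + k)%N).
  by rewrite -{1}(add0n k) big_addn subSn// ltnW.
rewrite le_eqVlt; apply/orP; left; apply/eqP; apply: eq_big_nat => i /andP[_ il].
by rewrite E// addnC.
Qed.

Lemma axis1_slope (z : Z2) : asymptotic_slope (fun k => z + unit_vec 1 *+ k) (1 : R).
Proof.
move=> e e0; exists 0%N => n _.
rewrite /hor_disp !axis_coords /= addr0 addrAC subrr add0r mul1r subrr normr0.
by rewrite mulr_ge0// ltW.
Qed.

Lemma axis2_slope (z : Z2) : asymptotic_slope (fun k => z + unit_vec 2 *+ k) (0 : R).
Proof.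
move=> e e0; exists 0%N => n _.
rewrite /hor_disp !axis_coords /= subrr mul0r subr0 normr0.
by rewrite mulr_ge0// ltW.
Qed.

Definition first_step_geodesic (z : Z2) (r : nat) (a b : R) := exists x : nat -> Z2,
  [/\ semi_infinite_geodesic W x, x 0%N = z, x 1%N = z + unit_vec r &
      eventually_in_cone x a b].

Hypothesis W_distinct : distinct_path_weights W.
Hypothesis W_first1 : forall z, exists a b, b < 1 /\ first_step_geodesic z 1 a b.
Hypothesis W_first2 : forall z, exists a b, 0 < a /\ first_step_geodesic z 2 a b.

Lemma slope_shift x j (t : R) : up_right x -> asymptotic_slope x t ->
  asymptotic_slope (fun n => x (j + n)%N) t.
Proof.
move=> ux sx e e0; have e2 : 0 < e / 2 by rewrite divr_gt0.
have [M hM] := sx _ e2.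
pose c := `|hor_disp x j| + `|t| * j%:R + e / 2 * j%:R.
exists (maxn M (Num.trunc (2 * c / e)).+1) => n; rewrite geq_max => /andP[Mn cn].
have h1 : c <= e / 2 * n%:R.
  have : 2 * c / e < n%:R.
    by apply: lt_le_trans (truncnS_gt _) _; rewrite ler_nat.
  by rewrite ltr_pdivrMr// => h3; lra.
have h2 := hM (j + n)%N (leq_trans Mn (leq_addl _ _)).
have -> : hor_disp (fun n => x (j + n)%N) n - t * n%:R =
  (hor_disp x (j + n) - t * (j + n)%:R) + (- hor_disp x j + t * j%:R) :> R.
  rewrite /hor_disp addn0 natrD !intrB; ring.
have h3 : `|- hor_disp x j + t * j%:R| <= `|hor_disp x j| + `|t| * j%:R :> R.
  by apply: le_trans (ler_normD _ _) _; rewrite normrN normrM normr_nat.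
apply: le_trans (ler_normD _ _) _; rewrite [X in _ <= _ * X]natrD mulrDr in h2.
rewrite /c in h1; lra.
Qed.

Lemma not_axis x (r : nat) : up_right x -> r \in [:: 1; 2]%N ->
  ~ (forall k, x k = x 0%N + unit_vec r *+ k) ->
  exists j, x j.+1 = x j + unit_vec (3 - r).
Proof.
move=> ux r12 nx; apply: contrapT => /forallNP nj; apply: nx.
elim=> [|k IH]; first by rewrite mulr0n addr0.
rewrite mulrSr addrA -IH; have := ux k; rewrite /up_right_step.
have -> : (x k.+1 - x k == unit_vec 1) || (x k.+1 - x k == unit_vec 2) =
    (x k.+1 - x k == unit_vec r) || (x k.+1 - x k == unit_vec (3 - r)).
  by move: r12; rewrite !inE => /orP[]/eqP->; rewrite //= orbC.
move=> /orP[/eqP <-|/eqP h]; first by rewrite subrKC.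
by case: (nj k); rewrite -h subrKC.
Qed.

(** A vertical step may occur late, so the blocking geodesic is started at the point [x j] where it
    occurs. The tail of [x] from there is to its left at level 1, hence always, which limits its
    slope to [b < 1]. *)
Lemma slope1_axis x : semi_infinite_geodesic W x -> asymptotic_slope x (1 : R) ->
  forall k, x k = x 0%N + unit_vec 1 *+ k.
Proof.
move=> gx sx; have [ux _] := gx; apply: contrapT => /(not_axis ux)[]// j xj.
have [a [b [b1 [y [gy y0 y1 [L hL]]]]]] := W_first1 (x j).
pose x' n := x (j + n)%N.
have gx' : semi_infinite_geodesic W x' by exact: geodesic_shift.
have x'y : x' 0%N = y 0%N by rewrite /x' addn0.
have lt1 : (x' 1%N).1 < (y 1%N).1 by rewrite /x' addn1 xj y1 /=; lia.
have h := geodesic_stays_left W_distinct gx' gy x'y lt1.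
have e0 : 0 < (1 - b) / 2 by rewrite divr_gt0// subr_gt0.
have [M hM] := slope_shift j ux sx e0.
have [n [Mn n0 h1]] : exists n, [/\ (maxn L M <= n)%N, (0 < n)%N & True].
  by exists (maxn (maxn L M) 1); rewrite leq_maxl leq_max orbT.
move: Mn; rewrite geq_max => /andP[/hL /andP[_ h2] /hM].
rewrite -/x' ler_norml => /andP[h3 _].
have := h n; rewrite -(hor_disp_le (R := R) _ x'y) => h4.
have n0' : 0 < n%:R :> R by rewrite ltr0n.
have : 0 < (1 - b) / 2 * n%:R by rewrite mulr_gt0.
lra.
Qed.

Lemma slope0_axis x : semi_infinite_geodesic W x -> asymptotic_slope x (0 : R) ->
  forall k, x k = x 0%N + unit_vec 2 *+ k.
Proof.
move=> gx sx; have [ux _] := gx; apply: contrapT => /(not_axis ux)[]// j xj.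
have [a [b [a0 [y [gy y0 y1 [L hL]]]]]] := W_first2 (x j).
pose x' n := x (j + n)%N.
have gx' : semi_infinite_geodesic W x' by exact: geodesic_shift.
have x'y : y 0%N = x' 0%N by rewrite /x' addn0.
have lt1 : (y 1%N).1 < (x' 1%N).1 by rewrite /x' addn1 xj y1 /=; lia.
have h := geodesic_stays_left W_distinct gy gx' x'y lt1.
have e0 : 0 < a / 2 by rewrite divr_gt0.
have [M hM] := slope_shift j ux sx e0.
have [n [Mn n0 h1]] : exists n, [/\ (maxn L M <= n)%N, (0 < n)%N & True].
  by exists (maxn (maxn L M) 1); rewrite leq_maxl leq_max orbT.
move: Mn; rewrite geq_max => /andP[/hL /andP[h2 _] /hM].
rewrite -/x' ler_norml => /andP[_ h3].
have := h n; rewrite -(hor_disp_le (R := R) _ x'y) => h4.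
have n0' : 0 < n%:R :> R by rewrite ltr0n.
have : 0 < a / 2 * n%:R by rewrite mulr_gt0.
lra.
Qed.

Hypothesis W_cones : forall z (a b : rat), 0 < a -> a < b -> b < 1 ->
  cone_geodesic W z (ratr a) (ratr b).

Lemma axis_unique (z : Z2) (r : nat) : r \in [:: 1; 2]%N -> forall x : nat -> Z2,
  [/\ semi_infinite_geodesic W x, x 0%N = z
    & limn_einf (fun k : nat =>
        ((dot (x k) (unit_vec (3 - r)))%:~R / k%:R : R)%:E) = 0%E]
  <-> forall k : nat, x k = z + unit_vec r *+ k.
Proof.
move=> r12 x.
have dotE k : dot (x k) (unit_vec (3 - r)) = if r == 1%N then (x k).2 else (x k).1.
  by move: r12; rewrite !inE => /orP[]/eqP->; rewrite /dot /= ?mulr0 ?mulr1 ?addr0 ?add0r.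
have einf t : up_right x -> asymptotic_slope x t ->
    limn_einf (fun k : nat => ((dot (x k) (unit_vec (3 - r)))%:~R / k%:R : R)%:E) =
    (if r == 1%N then 1 - t else t)%:E.
  move=> ux sx.
  have cv : (fun k : nat => ((dot (x k) (unit_vec (3 - r)))%:~R / k%:R : R)) @ \oo -->
      (if r == 1%N then 1 - t else t).
    under eq_fun do rewrite dotE.
    by case: ifP => _; [exact: asymptotic_slope_ver|exact: asymptotic_slope_hor].
  have : (fun k : nat => ((dot (x k) (unit_vec (3 - r)))%:~R / k%:R : R)%:E) @ \oo -->
      (if r == 1%N then 1 - t else t)%:E by apply: cvg_EFin => //; exact: nearW.
  by move=> /cvg_limn_einf_sup[].
split=> [[gx x0 lim0]|xE].
  have [ux _] := gx.
  (* Since every geodesic has a slope, the lower limit is a limit and determines that slope. *)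
  have [t t01 sx] := geodesic_slope W_distinct W_cones gx.
  have := einf t ux sx; rewrite lim0 => -[].
  move: r12; rewrite !inE -x0 => /orP[]/eqP-> /=.
    by move=> /esym/eqP; rewrite subr_eq0 => /eqP t1; apply: slope1_axis; rewrite // t1.
  by move=> t0; apply: slope0_axis; rewrite // t0.
have xE' : x = fun k => z + unit_vec r *+ k by apply/funext.
have gx : semi_infinite_geodesic W x by rewrite xE'; exact: axis_geodesic.
split=> //; first by rewrite xE mulr0n addr0.
have [ux _] := gx.
have sx : asymptotic_slope x (if r == 1%N then 1 else 0 : R).
  rewrite xE'; move: r12; rewrite !inE => /orP[]/eqP-> /=; first exact: axis1_slope.
  exact: axis2_slope.
by rewrite (einf _ ux sx); case: (r == 1%N); rewrite ?subrr.
Qed.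

Lemma geodesic_directions_of_cones :
  [/\ (forall x : nat -> Z2, semi_infinite_geodesic W x ->
         exists2 u : R * R, directions u & directed u x),
      (forall (r : nat) (z : Z2), r \in [:: 1; 2]%N -> forall x : nat -> Z2,
         [/\ semi_infinite_geodesic W x, x 0%N = z
           & limn_einf (fun k : nat =>
               ((dot (x k) (unit_vec (3 - r)))%:~R / k%:R : R)%:E) = 0%E]
         <-> forall k : nat, x k = z + unit_vec r *+ k)
    & (forall (u : R * R) (z : Z2), directions u ->
         exists x : nat -> Z2,
           [/\ semi_infinite_geodesic W x, x 0%N = z & directed u x])].
Proof.
split.
- move=> x gx; have [t t01 sx] := geodesic_slope W_distinct W_cones gx.
  have [ux _] := gx; exists (t, 1 - t); last exact: asymptotic_slope_directed.
  by exists t => //=; rewrite in_itv.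
- by move=> r z r12 x; exact: axis_unique.
- move=> u z [t /=]; rewrite in_itv/= => t01 <-.
  have [x [gx x0 sx]] := slope_geodesic W_distinct W_cones z t01.
  by exists x; split => //; have [ux _] := gx; exact: asymptotic_slope_directed.
Qed.

End GeodesicDirections.

(** * Greedy paths towards a corner *)

Section GreedyPaths.
Context {R : realType} (W : Z2 -> R) (x : Z2) (N : nat).

(** The field seen from the corner [x + (N, N)] with both axes reversed, so that passage to the
    corner becomes passage from the origin. *)
Definition corner_weights (a b : nat) : R := W (x.1 + N%:Z - a%:Z, x.2 + N%:Z - b%:Z).

(** The quantity H_rho of the overview, meaningful for [z] not beyond the corner in either
    coordinate. *)
Definition potential rho (z : Z2) : R :=
  stat_lpp rho corner_weights (absz (x.1 + N%:Z - z.1)%R) (absz (x.2 + N%:Z - z.2)%R).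

Lemma potentialE rho (z : Z2) : z.1 < x.1 + N%:Z -> z.2 < x.2 + N%:Z ->
  potential rho z =
  W z + Num.max (potential rho (z + unit_vec 1)) (potential rho (z + unit_vec 2)).
Proof.
case: z => z1 z2 /= h1 h2; rewrite /potential /=.
have [a ea] : exists a : nat, x.1 + N%:Z - z1 = a.+1%:Z.
  by exists ((absz (x.1 + N%:Z - z1)%R).-1); lia.
have [b eb] : exists b : nat, x.2 + N%:Z - z2 = b.+1%:Z.
  by exists ((absz (x.2 + N%:Z - z2)%R).-1); lia.
have -> : (absz (x.1 + N%:Z - z1)%R) = a.+1 by lia.
have -> : (absz (x.2 + N%:Z - z2)%R) = b.+1 by lia.
have -> : (absz (x.1 + N%:Z - (z1 + 1))%R) = a by lia.
have -> : (absz (x.2 + N%:Z - (z2 + 0))%R) = b.+1 by lia.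
have -> : (absz (x.1 + N%:Z - (z1 + 0))%R) = a.+1 by lia.
have -> : (absz (x.2 + N%:Z - (z2 + 1))%R) = b by lia.
rewrite stat_lppSS; congr (_ + _); rewrite /corner_weights; congr W.
by apply: injective_projections => /=; lia.
Qed.

(** In [potentialE] the maximum is at least the value at the step taken; summation gives the bound.
    Room for [l - k] steps in both coordinates keeps the summed points off the boundary. The weight
    of [y l] is left out because [potential rho (y l)] still contains it. *)
Lemma potential_path rho (y : nat -> Z2) k l : up_right y ->
  (y k).1 + (l - k)%N%:Z <= x.1 + N%:Z -> (y k).2 + (l - k)%N%:Z <= x.2 + N%:Z ->
  (k <= l)%N ->
  \sum_(k <= i < l) W (y i) <= potential rho (y k) - potential rho (y l).
Proof.
move=> uy h1 h2 /subnKC e; rewrite -e in h1 h2 *; rewrite addKn in h1 h2.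
elim: (l - k)%N h1 h2 => [|m IH] h1 h2; first by rewrite addn0 big_geq// subrr.
rewrite addnS big_nat_recr ?leq_addr//=.
have [c1 c2 c3] := up_right_coords uy (leq_addr m k); rewrite addKn in c3.
have b1 : (y (k + m)%N).1 < x.1 + N%:Z by lia.
have b2 : (y (k + m)%N).2 < x.2 + N%:Z by lia.
have IH' : \sum_(k <= i < k + m) W (y i) <=
    potential rho (y k) - potential rho (y (k + m)%N) by apply: IH; lia.
apply: le_trans (lerD IH' (lexx _)) _.
rewrite (potentialE rho b1 b2).
have : potential rho (y (k + m).+1) <=
    Num.max (potential rho (y (k + m)%N + unit_vec 1))
            (potential rho (y (k + m)%N + unit_vec 2)).
  have := uy (k + m)%N; rewrite /up_right_step le_max.
  move=> /orP[/eqP <-|/eqP <-]; rewrite subrKC lexx ?orbT//.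
lra.
Qed.

Variable rho : R.

Fixpoint greedy (n : nat) : Z2 := if n is n'.+1 then
  if potential rho (greedy n' + unit_vec 2) <= potential rho (greedy n' + unit_vec 1)
  then greedy n' + unit_vec 1 else greedy n' + unit_vec 2
  else x.

Lemma up_right_greedy : up_right greedy.
Proof.
move=> k; rewrite /up_right_step /=; case: ifP => _;
  by rewrite [greedy k + _]addrC addrK eqxx ?orbT.
Qed.

Lemma greedy_sum k l : (k <= l <= N)%N ->
  \sum_(k <= i < l) W (greedy i) = potential rho (greedy k) - potential rho (greedy l).
Proof.
move=> /andP[/subnKC <-]; elim: (l - k)%N => [|m IH] mN.
  by rewrite addn0 big_geq// subrr.
rewrite addnS big_nat_recr ?leq_addr//= IH; last by lia.
have [c1 c2 c3] := up_right_coords up_right_greedy (leq0n (k + m)); rewrite subn0 in c3.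
have b1 : (greedy (k + m)).1 < x.1 + N%:Z by move: c1 c2 c3 => /=; lia.
have b2 : (greedy (k + m)).2 < x.2 + N%:Z by move: c1 c2 c3 => /=; lia.
rewrite [X in _ - X + _](potentialE rho b1 b2).
by case: leP => h; lra.
Qed.

(** The potential certifies optimality: every path between the two points weighs at most the drop of
    the potential, and the greedy path weighs exactly that. The weight of the common last point is
    split off on both sides. *)
Lemma greedy_geodesic k l : (k < l <= N)%N ->
  last_passage W (greedy k) (greedy l) = \sum_(k <= i < l.+1) W (greedy i).
Proof.
move=> /andP[kl lN]; have ug := up_right_greedy.
apply: (last_passage_max ug (ltnW kl)) => p [sz sp p0 pl].
rewrite (l1norm_up_right ug (ltnW kl)) in sz pl.
have [y uy py] := up_right_path_seq sp.
have y0 : y 0%N = greedy k by rewrite -py ?sz.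
have yl : y (l - k)%N = greedy l by rewrite -py ?sz.
have -> : \sum_(0 <= i < (l - k).+1) W p`_i = \sum_(0 <= i < (l - k).+1) W (y i).
  by apply: eq_big_nat => i /andP[_ il]; rewrite py// sz.
rewrite !big_nat_recr ?leq0n//=; last exact: ltnW.
rewrite yl lerD2r greedy_sum; last by rewrite (ltnW kl).
rewrite -yl -y0.
have [c1 c2 c3] := up_right_coords ug (leq0n k); rewrite subn0 /= in c1 c2 c3.
by apply: potential_path => //; rewrite y0 subn0; lia.
Qed.

Lemma greedy_potential_le sig m : (m <= N)%N ->
  potential rho x - potential rho (greedy m) <=
  potential sig x - potential sig (greedy m).
Proof.
move=> mN; have := greedy_sum (k := 0) (l := m); rewrite leq0n mN /= => <- //.
by apply: (potential_path sig up_right_greedy) => //=; rewrite subn0; lia.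
Qed.

End GreedyPaths.

(** * Means of the stationary model and the characteristic direction *)

Section Gap.
Context {R : realType}.

(** The function f_rho of the overview. *)
Definition stat_mean (rho a b : R) := a / (1 - rho) + b / rho.

Lemma stat_mean_swap rho a b : stat_mean (1 - rho) b a = stat_mean rho a b.
Proof. by rewrite /stat_mean subKr addrC. Qed.

(* [stat_mean rho a b] is minimal in [rho] when [a / b = ((1 - rho) / rho) ^ 2]. *)
Lemma stat_mean_gap (rho al : R) : 0 < rho -> rho < 1 -> 0 < al -> al < 1 ->
  al * rho ^+ 2 < (1 - al) * (1 - rho) ^+ 2 ->
  exists sig del, [/\ 0 < sig, sig < 1, 0 < del & forall a b : R,
    a <= al * (a + b) -> 0 <= a + b ->
    2 * del * (a + b) <= stat_mean rho a b - stat_mean sig a b].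
Proof.
move=> rho0 rho1 al0 al1 h.
have r1 : 0 < 1 - rho by rewrite subr_gt0.
have a1 : 0 < 1 - al by rewrite subr_gt0.
pose K := (1 - al) * (1 - rho) + al * rho.
have K0 : 0 < K by rewrite addr_gt0// mulr_gt0.
(* By [E] below, the difference of the means is [c] times an expression that equals [B * (a + b)]
   when [a = al * (a + b)]. [B] decreases in [sig] and vanishes at [sig0]; the hypothesis on [al]
   says [rho < sig0], so a [sig] strictly between them gives a positive gap. *)
pose sig0 := (1 - al) * (1 - rho) / K.
have s0 : rho < sig0.
  rewrite /sig0 ltr_pdivlMr// /K; rewrite !expr2 in h; nra.
have s1 : sig0 <= 1.
  by rewrite /sig0 ler_pdivrMr// mul1r /K lerDl mulr_ge0// ltW.
pose sig := (rho + sig0) / 2.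
have sr : rho < sig by rewrite /sig; lra.
have ss0 : sig < sig0 by rewrite /sig; lra.
have sig_gt0 : 0 < sig by lra.
have sig1 : sig < 1 by lra.
have s1' : 0 < 1 - sig by rewrite subr_gt0.
pose c := (sig - rho) / (rho * sig * (1 - rho) * (1 - sig)).
have c0 : 0 < c.
  apply: divr_gt0; first by rewrite subr_gt0.
  by do 3 (apply: mulr_gt0 => //).
pose B := (1 - al) * (1 - rho) - sig * K.
have B0 : 0 < B by rewrite subr_gt0 -ltr_pdivlMr.
exists sig, (c * B / 2); split => //; first by rewrite divr_gt0// mulr_gt0.
move=> a b hab ab0.
have E : stat_mean rho a b - stat_mean sig a b =
    c * (b * ((1 - rho) * (1 - sig)) - a * (rho * sig)).
  rewrite /stat_mean /c; field.
  by rewrite !gt_eqF.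
rewrite E mulrCA divff ?mulr1 ?gt_eqF//.
rewrite -mulrA ler_pM2l//.
have hb : (1 - al) * (a + b) <= b by lra.
have p1 : 0 < (1 - rho) * (1 - sig) by exact: mulr_gt0.
have p2 : 0 < rho * sig by exact: mulr_gt0.
have h1 := ler_wpM2r (ltW p1) hb.
have h2 := ler_wpM2r (ltW p2) hab.
rewrite /B /K; lra.
Qed.

Lemma stat_mean_gap2 (rho be : R) : 0 < rho -> rho < 1 -> 0 < be -> be < 1 ->
  (1 - be) * (1 - rho) ^+ 2 < be * rho ^+ 2 ->
  exists sig del, [/\ 0 < sig, sig < 1, 0 < del & forall a b : R,
    be * (a + b) <= a -> 0 <= a + b ->
    2 * del * (a + b) <= stat_mean rho a b - stat_mean sig a b].
Proof.
move=> rho0 rho1 be0 be1 h.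
have := @stat_mean_gap (1 - rho) (1 - be); rewrite !subKr => /(_ _ _ _ _ h)[].
- lra.
- lra.
- lra.
- lra.
move=> sig [del [s0 s1 d0 hs]]; exists (1 - sig), del; split=> //; [lra|lra|].
move=> a b hab ab0; rewrite -(stat_mean_swap rho) -(stat_mean_swap (1 - sig)) subKr addrC.
by apply: hs; lra.
Qed.

(* The characteristic direction of [rho] can be placed in any cone. *)
Lemma characteristic_between (al be : R) : 0 < al -> al < be -> be < 1 ->
  exists rho, [/\ 0 < rho, rho < 1, al * rho ^+ 2 < (1 - al) * (1 - rho) ^+ 2 &
    (1 - be) * (1 - rho) ^+ 2 < be * rho ^+ 2].
Proof.
(* For [rho = (1 + r)^-1] the ratio [(1 - rho) / rho] is [r], so the characteristic direction has
   slope [t], the middle of the cone. *)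
move=> al0 ab be1; pose t := (al + be) / 2; pose r := Num.sqrt (t / (1 - t)).
have t0 : 0 < t by rewrite /t; lra.
have t1 : 0 < 1 - t by rewrite /t; lra.
have r2 : r ^+ 2 = t / (1 - t) by rewrite sqr_sqrtr// divr_ge0// ltW.
have r0 : 0 < r by rewrite sqrtr_gt0 divr_gt0.
have r10 : 0 < 1 + r by rewrite addr_gt0.
exists (1 + r)^-1.
have E : 1 - (1 + r)^-1 = r / (1 + r) by field; rewrite gt_eqF.
have p0 : 0 < (1 + r) ^- 2 by rewrite invr_gt0 exprn_gt0.
split.
- by rewrite invr_gt0.
- by rewrite invf_lt1// ltrDl.
- rewrite E exprMn exprVn mulrA ltr_pM2r// r2 mulrA ltr_pdivlMr// /t.
  have := mulr_gt0 al0 al0; nra.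
- rewrite E exprMn exprVn mulrA ltr_pM2r// r2 mulrA ltr_pdivrMr// /t.
  nra.
Qed.

End Gap.

(** * Probability estimates *)

Section ProbabilityBounds.
Context d {T : measurableType d} {R : realType} (P : probability T R).

Lemma union_lt_bound (B : nat -> set T) (p : nat -> R) N :
  (forall i, measurable (B i)) -> (forall i, (i < N)%N -> (P (B i) <= (p i)%:E)%E) ->
  measurable [set w | exists2 i, (i < N)%N & B i w] /\
  (P [set w | exists2 i, (i < N)%N & B i w] <= (\sum_(i < N) p i)%:E)%E.
Proof.
move=> mB; elim: N => [|N IH] hB.
  rewrite (_ : [set w | _] = set0) ?measure0 ?big_ord0//.
  by apply/seteqP; split => w //= [].
have [mU hU] := IH (fun i iN => hB i (ltnW iN)).
rewrite (_ : [set w | _] = [set w | exists2 i, (i < N)%N & B i w] `|` B N); last first.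
  apply/seteqP; split => w /=.
    move=> [i]; rewrite ltnS leq_eqVlt => /predU1P[->|iN] Biw; first by right.
    by left; exists i.
  by move=> [[i iN Biw]|BN]; [exists i => //; exact: ltnW|exists N].
split; first exact: measurableU.
by apply: le_trans (measureU2 _ mU (mB N)) _; rewrite big_ord_recr EFinD leeD// hB.
Qed.

Lemma geometric_sum_le (q : R) N : 0 <= q -> q < 1 -> \sum_(i < N) q ^+ i <= (1 - q)^-1.
Proof.
move=> q0 q1; have q1' : 0 < 1 - q by rewrite subr_gt0.
rewrite -(ler_pM2l q1') divff ?gt_eqF// -opprB mulNr -subrX1 opprB.
by rewrite gerBl exprn_ge0.
Qed.

(** The event is the increasing union over [K] of the intersections of [B N] for [N >= K], each
    contained in [B K]. *)
Lemma liminf_bound (B : nat -> set T) (p : R) : (forall N, measurable (B N)) ->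
  (forall N, (P (B N) <= p%:E)%E) ->
  measurable [set w | exists K, forall N, (K <= N)%N -> B N w] /\
  (P [set w | exists K, forall N, (K <= N)%N -> B N w] <= p%:E)%E.
Proof.
move=> mB hB.
pose F K := \bigcap_(N in [set N | (K <= N)%N]) B N.
have mF K : measurable (F K) by apply: bigcap_measurable => //; exists K => /=.
have -> : [set w | exists K, forall N, (K <= N)%N -> B N w] = \bigcup_K F K.
  by apply/seteqP; split => w /= [K]; [exists K|move=> _; exists K].
have mU : measurable (\bigcup_K F K) by exact: bigcup_measurable.
split=> //.
have Fnd : {homo F : n m / (n <= m)%N >-> (n <= m)%O}.
  by move=> n m nm; apply/subsetPset => w Fw k /= mk; apply: Fw => /=; exact: leq_trans mk.
have cv := nondecreasing_cvg_mu (mu := P) mF mU Fnd.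
rewrite -(cvg_lim _ cv)//; apply: lime_le; first by apply/cvg_ex; eexists; exact: cv.
apply: nearW => K /=; apply: le_trans (hB K); apply: le_measure; rewrite ?inE//.
by move=> w; apply => /=.
Qed.

Lemma negligible_small (A : set T) :
  (forall e : R, 0 < e -> exists2 L, measurable L & A `<=` L /\ (P L <= e%:E)%E) ->
  P.-negligible A.
Proof.
move=> hA.
have hn (n : nat) : exists L, [/\ measurable L, A `<=` L & (P L <= (n.+1%:R^-1)%:E)%E].
  have [|L mL [AL PL]] := hA n.+1%:R^-1; first by rewrite invr_gt0.
  by exists L.
have [L hL] := choice hn.
have mL : measurable (\bigcap_n L n).
  by apply: bigcapT_measurable => n; have [] := hL n.
exists (\bigcap_n L n); split=> //; last by move=> w Aw n _; have [_ h _] := hL n; exact: h.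
apply/eqP; rewrite -measure_le0; apply/lee_addgt0Pr => e e0; rewrite add0e.
pose n := Num.trunc e^-1; have [mLn _ hn'] := hL n.
apply: (@le_trans _ _ (P (L n))).
  by apply: le_measure; rewrite ?inE//; exact: bigcap_inf.
apply: le_trans hn' _; rewrite lee_fin -[leRHS]invrK lef_pV2 ?posrE ?invr_gt0//.
exact/ltW/truncnS_gt.
Qed.

Variable Y : Z2 -> T -> R.
Hypotheses (iY : indep P setT Y) (eY : forall z, has_exp_law P 1 (Y z)).

Let mY z : measurable_fun setT (Y z). Proof. by have [h _] := iY; exact: h. Qed.

Local Notation W w := (fun z => Y z w).

Lemma corner_iid (x : Z2) N :
  iid_exp P (fun k : nat * nat => Y (x.1 + N%:Z - k.1%:Z, x.2 + N%:Z - k.2%:Z)).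
Proof.
split; last by move=> k; exact: eY.
apply: (indep_reindex (phi := fun k : nat * nat =>
  (x.1 + N%:Z - k.1%:Z, x.2 + N%:Z - k.2%:Z)) _ _ iY) => //.
by move=> [a b] [a' b'] /= [h1 h2]; congr pair; lia.
Qed.

Lemma potential_offset w (x : Z2) N rho (a b : nat) : (a <= N)%N -> (b <= N)%N ->
  potential (W w) x N rho (x + (a%:Z, b%:Z)) =
  stat_lpp rho (fun i j => Y (x.1 + N%:Z - i%:Z, x.2 + N%:Z - j%:Z) w) (N - a) (N - b).
Proof.
by move=> aN bN; rewrite /potential /corner_weights /=; congr stat_lpp; lia.
Qed.

Lemma potential_corner w (x : Z2) N rho : potential (W w) x N rho x =
  stat_lpp rho (fun i j => Y (x.1 + N%:Z - i%:Z, x.2 + N%:Z - j%:Z) w) N N.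
Proof.
by rewrite /potential /corner_weights /=; congr stat_lpp; lia.
Qed.

Lemma measurable_potential (x : Z2) N rho z :
  measurable_fun setT (fun w => potential (W w) x N rho z).
Proof.
rewrite /potential /corner_weights.
by apply: (measurable_stat_lpp rho (X := fun k => Y (x.1 + N%:Z - k.1%:Z, x.2 + N%:Z - k.2%:Z))).
Qed.

Definition large_deviation rho del (x : Z2) M N (w : T) :=
  exists2 a : nat, (a < N)%N & exists2 b : nat, (b < N)%N & (M <= a + b)%N /\
    del * (a + b)%:R <= `|potential (W w) x N rho x -
      potential (W w) x N rho (x + (a%:Z, b%:Z)) - stat_mean rho a%:R b%:R|.

Lemma large_deviation_bound rho del : 0 < rho -> rho < 1 -> 0 < del ->
  exists C q, [/\ 0 < q, q < 1 & forall x M N,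
    measurable (large_deviation rho del x M N) /\
    (P (large_deviation rho del x M N) <= (C * q ^+ M)%:E)%E].
Proof.
move=> rho0 rho1 del0.
have [c c0 hc] := stat_lpp_deviation P rho0 rho1 del0.
(* Half of the decay becomes [q ^+ M], as the distance is at least [M]; the other half makes the sum
   over [a] and [b] at most [(1 - q)^-1 ^+ 2] for every [N]. *)
pose q := expR (- (c / 2)).
have q0 : 0 < q by exact: expR_gt0.
have q1 : q < 1 by rewrite /q -[ltRHS]expR0 ltr_expR oppr_lt0 divr_gt0.
exists (4 * (1 - q)^-1 ^+ 2), q; split=> // x M N.
pose A a b := [set w | (M <= a + b)%N /\
    del * (a + b)%:R <= `|potential (W w) x N rho x -
      potential (W w) x N rho (x + (a%:Z, b%:Z)) - stat_mean rho a%:R b%:R|].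
have mA a b : measurable (A a b).
  have [Mab|Mab] := boolP (M <= a + b)%N; last first.
    rewrite (_ : A a b = set0) //; apply/seteqP; split => w //= [h].
    by rewrite h in Mab.
  rewrite (_ : A a b = [set w | del * (a + b)%:R <= `|potential (W w) x N rho x -
      potential (W w) x N rho (x + (a%:Z, b%:Z)) - stat_mean rho a%:R b%:R|]).
    apply: measurable_le_norm; apply: measurable_funB => //.
    by apply: measurable_funB; exact: measurable_potential.
  by apply/seteqP; split => w //= [].
have PA a b : (a < N)%N -> (b < N)%N -> (P (A a b) <= (4 * q ^+ M * q ^+ a * q ^+ b)%:E)%E.
  move=> aN bN; have [Mab|Mab] := boolP (M <= a + b)%N; last first.
    rewrite (_ : A a b = set0).
      by rewrite measure0 lee_fin !mulr_ge0// exprn_ge0// ltW.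
    apply/seteqP; split => w //= [h].
    by rewrite h in Mab.
  have := hc _ N a b (corner_iid x N) (ltnW aN) (ltnW bN).
  rewrite (_ : [set w | _] = A a b); last first.
    have e1 w := potential_corner w x N rho.
    have e2 w := potential_offset w x rho (ltnW aN) (ltnW bN).
    have AE w : A a b w = ((M <= a + b)%N /\ del * (a + b)%:R <= `|potential (W w) x N rho x -
      potential (W w) x N rho (x + (a%:Z, b%:Z)) - stat_mean rho a%:R b%:R|) by [].
    apply/funext => w; rewrite AE e2 e1 /mkset.
    by apply/propext; split => [h|[]].
  move=> h; apply: le_trans h _; rewrite lee_fin -!mulrA ler_pM2l//.
  have -> : expR (- (c * (a + b)%:R)) = q ^+ (a + b) * (q ^+ a * q ^+ b).
    by rewrite -exprD -exprMn /q -expRD -expRM_natl; congr expR; field.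
  by rewrite ler_wpM2r ?mulr_ge0 ?exprn_ge0 ?(ltW q0)// ler_wiXn2l// ltW.
have row a : (a < N)%N ->
    measurable [set w | exists2 b, (b < N)%N & A a b w] /\
    (P [set w | exists2 b, (b < N)%N & A a b w] <=
      (4 * q ^+ M * q ^+ a * (1 - q)^-1)%:E)%E.
  move=> aN; have [mU hU] := union_lt_bound (fun b => mA a b) (fun b bN => PA a b aN bN).
  split=> //; apply: le_trans hU _; rewrite lee_fin -mulr_sumr.
  rewrite ler_wpM2l ?mulr_ge0 ?exprn_ge0 ?(ltW q0)//.
  by apply: geometric_sum_le => //; exact: ltW.
have mrow a : measurable [set w | exists2 b, (b < N)%N & A a b w].
  have := @union_lt_bound (fun b => A a b) (fun=> 1) N (fun b => mA a b).
  by case=> // b _; exact: probability_le1.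
have [mU hU] := union_lt_bound mrow (fun a aN => (row a aN).2).
split; first exact: mU.
apply: le_trans hU _; rewrite lee_fin -mulr_suml -mulr_sumr.
have h := geometric_sum_le N (ltW q0) q1.
have r0 : 0 <= (1 - q)^-1 by rewrite invr_ge0 subr_ge0 ltW.
have -> : 4 * (1 - q)^-1 ^+ 2 * q ^+ M = 4 * q ^+ M * (1 - q)^-1 * (1 - q)^-1 by ring.
by rewrite ler_wpM2r// ler_wpM2l// mulr_ge0// exprn_ge0// ltW.
Qed.

End ProbabilityBounds.

(** * Greedy paths in cones and their limits *)

Section GreedyLimits.
Context {R : realType} (W : Z2 -> R) (x : Z2).

(** Along the greedy path the drop of the potential is smallest for [rho]. Outside the cone the mean
    for [rho] exceeds that for [sig1] or [sig2] by [2 * del] times the distance, and two errors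
    below [del] times the distance cannot reverse this order. *)
Lemma greedy_in_cone (rho sig1 sig2 del al be : R) M N :
  (forall a b : R, a <= al * (a + b) -> 0 <= a + b ->
    2 * del * (a + b) <= stat_mean rho a b - stat_mean sig1 a b) ->
  (forall a b : R, be * (a + b) <= a -> 0 <= a + b ->
    2 * del * (a + b) <= stat_mean rho a b - stat_mean sig2 a b) ->
  (forall tau, tau \in [:: rho; sig1; sig2] -> forall a b, (a < N)%N -> (b < N)%N ->
    (M <= a + b)%N -> `|potential W x N tau x -
      potential W x N tau (x + (a%:Z, b%:Z)) - stat_mean tau a%:R b%:R| < del * (a + b)%:R) ->
  forall m, (M <= m < N)%N ->
    al * m%:R <= hor_disp (R := R) (greedy W x N rho) m <= be * m%:R.
Proof.
move=> gap1 gap2 dev m /andP[Mm mN].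
set g := greedy W x N rho.
have ug : up_right g := up_right_greedy W x N rho.
have [c1 c2 c3] := up_right_coords ug (leq0n m); rewrite subn0 /= in c1 c2 c3.
pose a := absz ((g m).1 - x.1)%R; pose b := absz ((g m).2 - x.2)%R.
have abm : (a + b)%N = m by rewrite /a /b; lia.
have gE : g m = x + (a%:Z, b%:Z).
  by rewrite /a /b; apply: injective_projections => /=; lia.
have hE : hor_disp (R := R) g m = a%:R.
  rewrite /hor_disp -[a%:R]/(a%:Z%:~R); congr (_%:~R); rewrite /a /=; lia.
have aN : (a < N)%N by lia.
have bN : (b < N)%N by lia.
have abM : (M <= a + b)%N by rewrite abm.
have le_pot tau := greedy_potential_le W x rho tau (ltnW mN).
rewrite -/g gE in le_pot.
have r1 : rho \in [:: rho; sig1; sig2] by rewrite mem_head.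
have s1 : sig1 \in [:: rho; sig1; sig2] by rewrite !inE eqxx orbT.
have s2 : sig2 \in [:: rho; sig1; sig2] by rewrite !inE eqxx !orbT.
have := dev _ r1 a b aN bN abM; rewrite ltr_norml => /andP[d1 _].
have := dev _ s1 a b aN bN abM; rewrite ltr_norml => /andP[_ d2].
have := dev _ s2 a b aN bN abM; rewrite ltr_norml => /andP[_ d3].
have l1 := le_pot sig1; have l2 := le_pot sig2.
have n0 : 0 <= a%:R + b%:R :> R by rewrite -natrD.
have contra (c D D' f f' : R) : - c < D - f -> D' - f' < c -> D <= D' ->
    2 * c <= f - f' -> False by lra.
rewrite hE -abm; rewrite natrD in d1 d2 d3 *; apply/andP; split.
- rewrite leNgt; apply/negP => /ltW/gap1/(_ n0); rewrite -mulrA => h.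
  exact: contra d1 d2 l1 h.
- rewrite leNgt; apply/negP => /ltW/gap2/(_ n0); rewrite -mulrA => h.
  exact: contra d1 d3 l2 h.
Qed.

(** The last clause of the conclusion lets control of the first step of greedy paths pass to the
    limit. *)
Lemma greedy_limit (rho al be : R) M (Q : nat -> Prop) :
  (forall K, exists2 N, (K <= N)%N & Q N) ->
  (forall N, Q N -> forall m, (M <= m < N)%N ->
    al * m%:R <= hor_disp (R := R) (greedy W x N rho) m <= be * m%:R) ->
  exists y : nat -> Z2, [/\ semi_infinite_geodesic W y, y 0%N = x,
    eventually_in_cone y al be & exists2 N, Q N & y 1%N = greedy W x N rho 1].
Proof.
move=> Qoo Qcone.
have [y [gy y0 hy]] : exists y, [/\ semi_infinite_geodesic W y, y 0%N = x &
    forall n K, exists N, [/\ (K <= N)%N, Q N &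
      forall i, (i <= n)%N -> greedy W x N rho i = y i]].
  apply: semi_infinite_geodesic_limit => //.
  - by move=> N; exact: up_right_greedy.
  - by move=> k l kl; exists l => N lN _; apply: greedy_geodesic; rewrite kl lN.
exists y; split=> //; last by have [N [_ QN h]] := hy 1%N 0%N; exists N => //; rewrite h.
exists M => n Mn; have [N [nN QN h]] := hy n n.+1.
have := Qcone N QN n; rewrite Mn nN => /(_ isT).
by rewrite /hor_disp !h.
Qed.

(** After a vertical choice [x + unit_vec 2] would realize the maximum in [potentialE], and the
    vertical increment would be exactly [W x]. *)
Lemma greedy_step1 rho N : (0 < N)%N ->
  W x < potential W x N rho x - potential W x N rho (x + unit_vec 2) ->
  greedy W x N rho 1 = x + unit_vec 1.
Proof.
move=> N0; rewrite {1}potentialE; [|lia|lia] => h.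
rewrite /=; case: ifP => // /negbT; rewrite -ltNge => h'.
by move: h; rewrite (max_idPr (ltW h')) addrK ltxx.
Qed.

Lemma greedy_step2 rho N : (0 < N)%N ->
  W x < potential W x N rho x - potential W x N rho (x + unit_vec 1) ->
  greedy W x N rho 1 = x + unit_vec 2.
Proof.
move=> N0; rewrite {1}potentialE; [|lia|lia] => h.
rewrite /=; case: ifP => // h'.
by move: h; rewrite (max_idPl h') addrK ltxx.
Qed.

End GreedyLimits.

(** * Geodesics in cones with high probability *)

Section AlmostSure.
Context d {T : measurableType d} {R : realType} (P : probability T R).
Variable Y : Z2 -> T -> R.
Hypotheses (iY : indep P setT Y) (eY : forall z, has_exp_law P 1 (Y z)).

Local Notation W w := (fun z => Y z w).

Lemma geometric_small (C q e : R) : 0 < q -> q < 1 -> 0 < e ->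
  exists M0, forall M, (M0 <= M)%N -> C * q ^+ M <= e.
Proof.
move=> q0 q1 e0; have C0 : 0 < `|C| + 1 by rewrite ltr_wpDl.
have nq1 : `|q| < 1 by rewrite gtr0_norm.
have eC : 0 < e / (`|C| + 1) by exact: divr_gt0.
have /cvgrPdist_le/(_ _ eC)[] := cvg_expr nq1.
move=> M0 _ hM0; exists M0 => M /hM0 /=; rewrite sub0r normrN gtr0_norm ?exprn_gt0//.
rewrite ler_pdivlMr// => h; apply: le_trans h.
rewrite mulrC ler_wpM2l ?exprn_ge0 ?(ltW q0)//.
by rewrite (le_trans (ler_norm _))// lerDl.
Qed.

(** The events [E N] are further failures to be avoided: empty for plain existence in a cone, and
    the failure of the criterion for the first step for the blocking geodesics. *)
Lemma cone_geodesic_high_probability (rho al be : R) (x : Z2) (e : R) (E : nat -> set T) :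
  0 < rho -> rho < 1 -> 0 < al -> al < 1 -> 0 < be -> be < 1 ->
  al * rho ^+ 2 < (1 - al) * (1 - rho) ^+ 2 ->
  (1 - be) * (1 - rho) ^+ 2 < be * rho ^+ 2 -> 0 < e ->
  (forall N, measurable (E N)) -> (forall N, (0 < N)%N -> (P (E N) <= (e / 2)%:E)%E) ->
  exists2 L, measurable L & (P L <= e%:E)%E /\ forall w, ~ L w ->
    exists y : nat -> Z2, [/\ semi_infinite_geodesic (W w) y, y 0%N = x,
      eventually_in_cone y al be &
      exists2 N, (0 < N)%N /\ ~ E N w & y 1%N = greedy (W w) x N rho 1].
Proof.
move=> rho0 rho1 al0 al1 be0 be1 hal hbe e0 mE PE.
have [sig1 [del1 [s10 s11 d10 gap1]]] := stat_mean_gap rho0 rho1 al0 al1 hal.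
have [sig2 [del2 [s20 s21 d20 gap2]]] := stat_mean_gap2 rho0 rho1 be0 be1 hbe.
pose del := Num.min del1 del2.
have del0 : 0 < del by rewrite lt_min d10 d20.
have gap1' (a b : R) : a <= al * (a + b) -> 0 <= a + b ->
    2 * del * (a + b) <= stat_mean rho a b - stat_mean sig1 a b.
  move=> h1 h2; apply: le_trans (gap1 a b h1 h2); rewrite ler_wpM2r// ler_pM2l//.
  by rewrite ge_min lexx.
have gap2' (a b : R) : be * (a + b) <= a -> 0 <= a + b ->
    2 * del * (a + b) <= stat_mean rho a b - stat_mean sig2 a b.
  move=> h1 h2; apply: le_trans (gap2 a b h1 h2); rewrite ler_wpM2r// ler_pM2l//.
  by rewrite ge_min lexx orbT.
have [C1 [q1 [q10 q11 b1]]] := large_deviation_bound iY eY rho0 rho1 del0.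
have [C2 [q2 [q20 q21 b2]]] := large_deviation_bound iY eY s10 s11 del0.
have [C3 [q3 [q30 q31 b3]]] := large_deviation_bound iY eY s20 s21 del0.
have e6 : 0 < e / 6 by rewrite divr_gt0.
have [M1 hM1] := geometric_small C1 q10 q11 e6.
have [M2 hM2] := geometric_small C2 q20 q21 e6.
have [M3 hM3] := geometric_small C3 q30 q31 e6.
pose M := maxn M1 (maxn M2 M3).
pose LD tau N : set T := large_deviation Y tau del x M N.
(* The three deviation events get [e / 6] each and [E N] gets [e / 2]. For [E 0] no bound is
   assumed, so only positive [N] are selected below. *)
pose B N := if N is 0 then set0 else ((LD rho N `|` LD sig1 N) `|` LD sig2 N) `|` E N.
have mLD N : [/\ measurable (LD rho N), measurable (LD sig1 N) & measurable (LD sig2 N)].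
  by split; [exact: (b1 x M N).1|exact: (b2 x M N).1|exact: (b3 x M N).1].
have mB N : measurable (B N).
  case: N => [|N]; first exact: measurable0.
  have [l1 l2 l3] := mLD N.+1; rewrite /B.
  apply: measurableU => //; apply: measurableU => //; exact: measurableU.
have PB N : (P (B N) <= e%:E)%E.
  case: N => [|N]; first by rewrite /B measure0 lee_fin ltW.
  have [l1 l2 l3] := mLD N.+1.
  have h1 : (P (LD rho N.+1) <= (e / 6)%:E)%E.
    by apply: le_trans (b1 x M N.+1).2 _; rewrite lee_fin; apply: hM1; rewrite leq_maxl.
  have h2 : (P (LD sig1 N.+1) <= (e / 6)%:E)%E.
    apply: le_trans (b2 x M N.+1).2 _; rewrite lee_fin; apply: hM2.
    by rewrite !leq_max leqnn orbT.
  have h3 : (P (LD sig2 N.+1) <= (e / 6)%:E)%E.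
    apply: le_trans (b3 x M N.+1).2 _; rewrite lee_fin; apply: hM3.
    by rewrite !leq_max leqnn !orbT.
  have -> : e%:E = ((e / 6)%:E + (e / 6)%:E + (e / 6)%:E + (e / 2)%:E)%E.
    by rewrite -!EFinD; congr EFin; field.
  have mU1 := measurableU _ _ l1 l2; have mU2 := measurableU _ _ mU1 l3.
  apply: le_trans (measureU2 _ mU2 (mE _)) _; apply: leeD; last exact: PE.
  apply: le_trans (measureU2 _ mU1 l3) _; apply: leeD => //.
  by apply: le_trans (measureU2 _ l1 l2) _; exact: leeD.
have [mL PL] := liminf_bound mB PB.
eexists; first exact: mL.
split=> // w /= /forallNP hw.
have h1 K : exists2 N, (K <= N)%N & (0 < N)%N /\ ~ B N w.
  have /existsNP[N /not_implyP[KN nB]] := hw (maxn K 1).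
  by move: KN; rewrite geq_max => /andP[KN N0]; exists N.
have h2 N : (0 < N)%N /\ ~ B N w -> forall m, (M <= m < N)%N ->
    al * m%:R <= hor_disp (R := R) (greedy (W w) x N rho) m <= be * m%:R.
  move=> [N0 nB] m Mm; apply: (greedy_in_cone gap1' gap2') Mm => tau tauP a b aN bN Mab.
  rewrite ltNge; apply/negP => h; apply: nB.
  have : LD tau N w by exists a => //; exists b.
  case: N N0 {aN bN h} => // N _; move: tauP; rewrite !inE /B => /or3P[]/eqP-> ?.
  + by left; left; left.
  + by left; left; right.
  + by left; right.
have [y [gy y0 ycone [N [N0 nB] y1]]] := greedy_limit h1 h2; exists y; split=> //; exists N => //.
by split=> // EN; apply: nB; case: N N0 EN y1 => // N _ EN _; right.
Qed.

End AlmostSure.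

(** * Almost sure properties *)

Section AlmostSureGeodesics.
Context d {T : measurableType d} {R : realType} (P : probability T R).
Variable Y : Z2 -> T -> R.
Hypotheses (iY : indep P setT Y) (eY : forall z, has_exp_law P 1 (Y z)).

Let mY z : measurable_fun setT (Y z). Proof. by have [h _] := iY; exact: h. Qed.

Local Notation W w := (fun z => Y z w).

Lemma ae_forall_countable (I : countType) (Q : I -> T -> Prop) :
  (forall i, {ae P, forall w, Q i w}) -> {ae P, forall w, forall i, Q i w}.
Proof.
move=> hQ.
have : {ae P, forall w, forall n, if @choice.unpickle I n is Some i then Q i w else True}.
  apply: ae_foralln => n; case: choice.unpickle => [i|]; first exact: hQ.
  exact: aeW.
by apply: filterS => w h i; have := h (choice.pickle i); rewrite choice.pickleK.
Qed.

Lemma ae_cone_geodesic (x : Z2) (al be : R) : 0 < al -> al < be -> be < 1 ->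
  {ae P, forall w, cone_geodesic (W w) x al be}.
Proof.
move=> al0 ab be1; have [rho [rho0 rho1 h1 h2]] := characteristic_between al0 ab be1.
apply: negligible_small => e e0.
have e2 : (0 <= (e / 2)%:E :> \bar R)%E by rewrite lee_fin ltW// divr_gt0.
have [L mL [PL hL]] := cone_geodesic_high_probability iY eY x rho0 rho1 al0 (lt_trans ab be1)
  (lt_trans al0 ab) be1 h1 h2 e0 (fun=> measurable0)
  (fun N _ => le_trans (eq_ind _ (fun u => (u <= 0)%E) (lexx 0%E) _ (esym (measure0 P))) e2).
exists L => //; split=> // w /= nc; apply: contrapT => /hL[y [gy y0 yc _]].
by apply: nc; exists y.
Qed.

(** If [Z <= X], then [Z <= l], of probability at most [rho * l], or [l < X], of probability at most
    [l^-1]. The threshold avoids the joint law: in the applications the increment [Z] depends on the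
    weight [X]. *)
Lemma exp_law_compare rho Z (X : T -> R) (l : R) : 0 < rho -> 0 < l ->
  measurable_fun setT Z -> measurable_fun setT X ->
  has_exp_law P rho Z -> has_exp_law P 1 X ->
  measurable [set w | Z w <= X w] /\
  (P [set w | (Z w <= X w)%R] <= (rho * l + l^-1)%:E)%E.
Proof.
move=> rho0 l0 mZ mX eZ eX.
have mA : measurable [set w | Z w <= X w].
  have mD : measurable_fun setT (fun w => X w - Z w) by exact: measurable_funB.
  rewrite (_ : [set w | _] = [set w | `[0, +oo[%classic (X w - Z w)]).
    exact: (measurable_preim mD (measurable_itv _)).
  by apply/seteqP; split => w /=; rewrite in_itv/= andbT subr_ge0.
split=> //.
have mZl : measurable [set w | l < Z w] by exact: measurable_ray.
have mXl : measurable [set w | l < X w] by exact: measurable_ray.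
apply: (@le_trans _ _ (P (~` [set w | l < Z w] `|` [set w | l < X w]))).
  apply: le_measure; rewrite ?inE//; first by apply: measurableU => //; exact: measurableC.
  move=> w /= ZX; case: (ltP l (X w)) => h; [by right|left].
  by apply/negP; rewrite -leNgt; exact: le_trans h.
apply: le_trans (measureU2 _ _ _) _ => //; first exact: measurableC.
rewrite EFinD; apply: leeD.
  rewrite [X in (X <= _)%E](probability_setC P mZl) eZ (max_idPl (ltW l0)) -EFinB lee_fin.
  have := expR_ge1Dx (- (rho * l)); lra.
rewrite [X in (X <= _)%E](eX l) (max_idPl (ltW l0)) mul1r lee_fin expRN lef_pV2 ?posrE ?expR_gt0//.
by have := expR_ge1Dx l; lra.
Qed.

(** Burke's property for the transposed field, whose row [N] is the column through [x]. *)
Lemma ver_inc_law (x : Z2) N rho : 0 < rho -> rho < 1 -> (0 < N)%N ->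
  has_exp_law P rho (fun w =>
    potential (W w) x N rho x - potential (W w) x N rho (x + unit_vec 2)).
Proof.
move=> rho0 rho1 N0; have r0 : 0 < 1 - rho by rewrite subr_gt0.
have r1 : 1 - rho < 1 by lra.
have [iX eX] := iid_exp_transpose (corner_iid iY eY x N).
have [_ h] := burke_row r0 r1 iX eX N.
have := h (N, N); rewrite /= subKr => /(_ (conj erefl N0)); congr has_exp_law.
apply/funext => w; rewrite potential_corner.
rewrite (potential_offset Y w x rho (leq0n N) N0) subn0 subn1.
rewrite /hor_inc (prednK N0).
by rewrite -!(stat_lpp_transpose rho).
Qed.

Lemma hor_inc_law (x : Z2) N rho : 0 < rho -> rho < 1 -> (0 < N)%N ->
  has_exp_law P (1 - rho) (fun w =>
    potential (W w) x N rho x - potential (W w) x N rho (x + unit_vec 1)).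
Proof.
move=> rho0 rho1 N0.
have [iX eX] := corner_iid iY eY x N.
have [_ h] := burke_row rho0 rho1 iX eX N.
have := h (N, N) (conj erefl N0); rewrite /=; congr has_exp_law.
apply/funext => w; rewrite potential_corner.
rewrite (potential_offset Y w x rho N0 (leq0n N)) subn0 subn1.
by rewrite /hor_inc (prednK N0).
Qed.

(** The last two conditions place [al] below and [be] above the characteristic slope,
    [(1 - rho) ^+ 2] divided by [rho ^+ 2 + (1 - rho) ^+ 2], which lies strictly between 0 and 1. *)
Lemma cone_around (rho : R) : 0 < rho -> rho < 1 -> exists al be,
  [/\ 0 < al, al < 1, 0 < be & be < 1] /\
  [/\ al * rho ^+ 2 < (1 - al) * (1 - rho) ^+ 2 &
      (1 - be) * (1 - rho) ^+ 2 < be * rho ^+ 2].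
Proof.
move=> rho0 rho1; have r0 : 0 < 1 - rho by rewrite subr_gt0.
have p0 : 0 < rho ^+ 2 by exact: exprn_gt0.
have p1 : 0 < (1 - rho) ^+ 2 by exact: exprn_gt0.
move: (rho ^+ 2) ((1 - rho) ^+ 2) p0 p1 => u v u0 v0.
pose s := u + v; have s0 : 0 < s by exact: addr_gt0.
pose t := v / s; have ts : t * s = v by rewrite /t divfK// gt_eqF.
have t0 : 0 < t by exact: divr_gt0.
have t1 : t < 1 by rewrite ltr_pdivrMr// mul1r /s ltrDr.
have us : u = (1 - t) * s by rewrite mulrBl mul1r ts /s addrK.
exists (t / 2), ((1 + t) / 2); split; first by split; lra.
have ts0 : 0 < t * s by rewrite ts.
have us0 : 0 < (1 - t) * s by rewrite -us.
have vs : v = t * s by [].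
by rewrite us vs; split; lra.
Qed.

(* As [rho] tends to 0, the vertical increment of rate [rho] exceeds the weight
   of [x] with probability tending to 1, which forces a horizontal first step. *)
Lemma ae_first_step1 (x : Z2) :
  {ae P, forall w, exists a b, b < 1 /\ first_step_geodesic (W w) x 1 a b}.
Proof.
apply: negligible_small => e e0.
(* Both terms of [exp_law_compare] become at most [e / 4]. As [rho], and with it the cone, depends
   on [e], the bounds [a] and [b] are chosen after [w]. *)
pose l := 4 / e; have l0 : 0 < l by exact: divr_gt0.
pose rho := Num.min 2^-1 (e / 4 / l).
have rho0 : 0 < rho by rewrite lt_min invr_gt0 ltr0n /= !divr_gt0.
have rho1 : rho < 1 by rewrite gt_min; apply/orP; left; lra.
have rhol : rho * l <= e / 4 by rewrite -ler_pdivlMr// ge_min lexx orbT.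
have linv : l^-1 = e / 4 by rewrite /l invf_div.
have [al [be [[al0 al1 be0 be1] [h1 h2]]]] := cone_around rho0 rho1.
pose J N w := potential (W w) x N rho x - potential (W w) x N rho (x + unit_vec 2).
have mJ N : measurable_fun setT (J N).
  by apply: measurable_funB; exact: (measurable_potential iY).
have mE N : measurable [set w | J N w <= Y x w].
  have mD : measurable_fun setT (fun w => Y x w - J N w) by exact: measurable_funB.
  rewrite (_ : [set w | _] = [set w | `[0, +oo[%classic (Y x w - J N w)]).
    exact: (measurable_preim mD (measurable_itv _)).
  by apply/seteqP; split => w /=; rewrite in_itv/= andbT subr_ge0.
have PE N : (0 < N)%N -> (P [set w | (J N w <= Y x w)%R] <= (e / 2)%:E)%E.
  move=> N0; have eJ := ver_inc_law x rho0 rho1 N0.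
  have [_] := exp_law_compare rho0 l0 (mJ N) (mY x) eJ (eY x).
  by move=> h; apply: le_trans h _; rewrite lee_fin linv; lra.
have [L mL [PL hL]] := cone_geodesic_high_probability iY eY x rho0 rho1 al0 al1 be0 be1 h1 h2 e0 mE PE.
exists L => //; split=> // w /= nc; apply: contrapT => /hL[y [gy y0 yc [N [N0 nE] y1]]].
apply: nc; exists al, be; split=> //; exists y; split=> //.
rewrite y1 (greedy_step1 (W := W w) N0)//.
by rewrite ltNge; apply/negP.
Qed.

Lemma ae_first_step2 (x : Z2) :
  {ae P, forall w, exists a b, 0 < a /\ first_step_geodesic (W w) x 2 a b}.
Proof.
apply: negligible_small => e e0.
pose l := 4 / e; have l0 : 0 < l by exact: divr_gt0.
pose sig := Num.min 2^-1 (e / 4 / l).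
have sig0 : 0 < sig by rewrite lt_min invr_gt0 ltr0n /= !divr_gt0.
have sig1 : sig < 1 by rewrite gt_min; apply/orP; left; lra.
have sigl : sig * l <= e / 4 by rewrite -ler_pdivlMr// ge_min lexx orbT.
have linv : l^-1 = e / 4 by rewrite /l invf_div.
(* Now [1 - rho] is small: it is the rate of the horizontal increment, which is then likely to
   exceed the weight of [x] and so to force a vertical first step. *)
pose rho := 1 - sig.
have rho0 : 0 < rho by rewrite subr_gt0.
have rho1 : rho < 1 by rewrite /rho; lra.
have rhoE : 1 - rho = sig by rewrite /rho subKr.
have [al [be [[al0 al1 be0 be1] [h1 h2]]]] := cone_around rho0 rho1.
pose J N w := potential (W w) x N rho x - potential (W w) x N rho (x + unit_vec 1).
have mJ N : measurable_fun setT (J N).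
  by apply: measurable_funB; exact: (measurable_potential iY).
have mE N : measurable [set w | J N w <= Y x w].
  have mD : measurable_fun setT (fun w => Y x w - J N w) by exact: measurable_funB.
  rewrite (_ : [set w | _] = [set w | `[0, +oo[%classic (Y x w - J N w)]).
    exact: (measurable_preim mD (measurable_itv _)).
  by apply/seteqP; split => w /=; rewrite in_itv/= andbT subr_ge0.
have PE N : (0 < N)%N -> (P [set w | (J N w <= Y x w)%R] <= (e / 2)%:E)%E.
  move=> N0; have eJ := hor_inc_law x rho0 rho1 N0; rewrite rhoE in eJ.
  have [_] := exp_law_compare sig0 l0 (mJ N) (mY x) eJ (eY x).
  by move=> h; apply: le_trans h _; rewrite lee_fin linv; lra.
have [L mL [PL hL]] := cone_geodesic_high_probability iY eY x rho0 rho1 al0 al1 be0 be1 h1 h2 e0 mE PE.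
exists L => //; split=> // w /= nc; apply: contrapT => /hL[y [gy y0 yc [N [N0 nE] y1]]].
apply: nc; exists al, be; split=> //; exists y; split=> //.
rewrite y1 (greedy_step2 (W := W w) N0)//.
by rewrite ltNge; apply/negP.
Qed.

Lemma exp_law_atomless rate X r : 0 < rate -> measurable_fun setT X ->
  has_exp_law P rate X -> P [set w | X w = r] = 0%E.
Proof.
move=> rate0 mX eX; have := exp_lawP rate0 mX eX (measurable_set1 r).
rewrite /= => ->; rewrite /exponential_prob; apply: null_set_integral => //=.
- by apply: measurable_funTS; apply/measurable_EFinP; exact: measurable_exponential_pdf.
- exact: lebesgue_measure_set1.
Qed.

(** Different paths differ at some index. The sum of coordinates grows by one per step, so the point
    [a] of [p] at that index is nowhere on [q]. The difference of the weights is then [Y a] plus a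
    combination of other weights, which has no atom at 0, and there are countably many pairs. *)
Lemma ae_distinct_path_weights :
  {ae P, forall w, distinct_path_weights (W w)}.
Proof.
suff : {ae P, forall w, forall pq : seq Z2 * seq Z2,
    sorted up_right_step pq.1 -> sorted up_right_step pq.2 -> size pq.1 = size pq.2 ->
    pq.1`_0 = pq.2`_0 -> pq.1 != pq.2 ->
    \sum_(z <- pq.1) Y z w != \sum_(z <- pq.2) Y z w}.
  by apply: filterS => w h p q; exact: (h (p, q)).
apply: ae_forall_countable => -[p q] /=.
have [[sp sq spq pq0 pq]|nh] := pselect [/\ sorted up_right_step p,
    sorted up_right_step q, size p = size q, p`_0 = q`_0 & p != q]; last first.
  by apply: aeW => w sp sq spq pq0 pq; case: nh.
have [y uy py] := up_right_path_seq sp.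
have [z uz qz] := up_right_path_seq sq.
have level (v : nat -> Z2) i j : up_right v -> v i = v j -> i = j.
  move=> uv; wlog ij : i j / (i <= j)%N.
    by move=> h; case: (leqP i j) => [|/ltnW] ij e; [exact: h|exact/esym/h].
  by move=> e; have [_ _] := up_right_coords uv ij; rewrite e => h; lia.
have uniq_path (s : seq Z2) (v : nat -> Z2) : up_right v ->
    (forall i, (i < size s)%N -> s`_i = v i) -> uniq s.
  move=> uv sv; apply/(uniqP 0) => i j; rewrite !inE => si sj.
  by rewrite !sv//; exact: level.
have up := uniq_path p y uy py; have uq := uniq_path q z uz qz.
have [i ip pqi] : exists2 i, (i < size p)%N & p`_i != q`_i.
  apply: contrapT => nh; move/eqP: pq; apply; apply: (eq_from_nth (x0 := 0)) => // i ip.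
  by apply/eqP/negPn/negP => h; apply: nh; exists i.
set a := p`_i.
have ap : a \in p by rewrite mem_nth.
have aq : a \notin q.
  apply/negP => /(nthP 0)[j jq aj]; move/negP: pqi; apply; apply/eqP.
  rewrite -/a -aj; congr (_`_ _).
  have p0 : y 0%N = z 0%N.
    by rewrite -py ?(leq_ltn_trans _ ip)// -qz -?spq ?(leq_ltn_trans _ ip).
  have [_ _ h1] := up_right_coords uy (leq0n i).
  have [_ _ h2] := up_right_coords uz (leq0n j).
  have : y i = z j by rewrite -py// -qz.
  by move=> e; rewrite e p0 in h1; rewrite !subn0 in h1 h2; lia.
pose s := rem a (undup (p ++ q)).
pose c k : R := (k \in p)%:R - (k \in q)%:R.
have us : uniq (undup (p ++ q)) by exact: undup_uniq.
have as0 : a \in undup (p ++ q) by rewrite mem_undup mem_cat ap.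
have usa : uniq (a :: s) by rewrite /= mem_rem_uniq// inE eqxx rem_uniq.
have Xa0 r : P [set w | Y a w = r] = 0%E.
  exact: (exp_law_atomless r ltr01 (mY a) (eY a)).
have h0 := indep_atomless_sum c iY usa (fun _ _ => Logic.I) Xa0 0.
have sumE (v : seq Z2) w : uniq v -> {subset v <= undup (p ++ q)} ->
    \sum_(k <- v) Y k w = \sum_(k <- undup (p ++ q)) (k \in v)%:R * Y k w.
  move=> uv sv; rewrite [RHS](bigID (mem v))/= [X in _ = _ + X]big1 ?addr0; last first.
    by move=> k /negPf ->; rewrite mul0r.
  rewrite -[RHS]big_filter; apply: etrans (perm_big _ _) _ => /=; last first.
    by apply: eq_big_seq => k; rewrite mem_filter => /andP[->]; rewrite mul1r.
  apply: uniq_perm => //; first exact: filter_uniq.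
  by move=> k; rewrite mem_filter; case: (boolP (k \in v)) => //= /sv ->.
have diffE w : \sum_(k <- p) Y k w - \sum_(k <- q) Y k w =
    Y a w + \sum_(k <- s) c k * Y k w.
  rewrite (sumE p)// ?(sumE q)//; last 2 first.
  - by move=> k kq; rewrite mem_undup mem_cat kq orbT.
  - by move=> k kp; rewrite mem_undup mem_cat kp.
  rewrite -sumrB (big_rem a as0)/= ap (negPf aq) mul1r mul0r subr0; congr (_ + _).
  by apply: eq_bigr => k _; rewrite /c mulrBl.
exists [set w | Y a w + \sum_(k <- s) c k * Y k w = 0]; split=> //.
  have mF : measurable_fun setT (fun w => Y a w + \sum_(k <- s) c k * Y k w).
    apply: measurable_funD => //; apply: (measurable_sum_family (X := fun k w => c k * Y k w)).
    by move=> k _; exact: measurable_funM.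
  exact: (measurable_preim mF (measurable_set1 0)).
move=> w /= nh; apply: contrapT => h; apply: nh => _ _ _ _ _.
by rewrite -subr_eq0 diffE; apply/eqP.
Qed.

End AlmostSureGeodesics.

Theorem theorem2p1 (R : realType) (d : measure_display) (T : measurableType d)
    (P : probability T R) (theta : Z2 -> T -> T) (Y : Z2 -> {RV P >-> R})
    (htheta : measure_preserving_action P theta)
    (hindep : mutually_independent Y)
    (hexp : forall x : Z2, exponentially_distributed 1 (Y x))
    (hstat : forall x : Z2, {ae P, forall w : T, Y x w = Y 0 (theta x w)}) :
  {ae P, forall w : T,
    [/\ (forall x_ : nat -> Z2,
           semi_infinite_geodesic (fun z => Y z w) x_ ->
           exists2 u : R * R, directions u & directed u x_),
        (forall (r : nat) (x : Z2), r \in [:: 1; 2]%N ->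
           forall x_ : nat -> Z2,
             [/\ semi_infinite_geodesic (fun z => Y z w) x_,
                 x_ 0%N = x
               & limn_einf (fun k : nat =>
                   ((dot (x_ k) (unit_vec (3 - r)))%:~R / k%:R : R)%:E) = 0%E]
             <-> forall k : nat, x_ k = x + unit_vec r *+ k)
      & (forall (u : R * R) (x : Z2), directions u ->
           exists x_ : nat -> Z2,
             [/\ semi_infinite_geodesic (fun z => Y z w) x_,
                 x_ 0%N = x & directed u x_])]}.
Proof.
pose Y' (z : Z2) : T -> R := Y z.
have eY z : has_exp_law P 1 (Y' z).
  move=> r; have := hexp z `]r, +oo[%classic (measurable_itv _).
  rewrite exponential_prob_ray// => <-; congr (P _).
  by apply/seteqP; split => w /=; rewrite in_itv/= andbT.
have iY : indep P setT Y'.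
  split=> [z _|s us _ A mA]; first exact: measurable_funP.
  have := hindep [fset z in s]%fset A mA.
  rewrite (_ : \bigcap_(x in _) _ = [set w | forall k, k \in s -> A k (Y' k w)]).
    move=> ->; apply: perm_big; apply: uniq_perm => // k.
    by rewrite !inE.
  apply/seteqP; split => w /= h k ks; first by apply: h; rewrite /= !inE.
  by apply: h; move: ks; rewrite /= !inE.
have hU := ae_distinct_path_weights iY eY.
(* Apex and rational ends form a countable index, so one null set serves all cones; the order
   conditions on the ends move inside the almost sure statement. *)
have hC : {ae P, forall w, forall i : Z2 * (rat * rat),
    0 < i.2.1 -> i.2.1 < i.2.2 -> i.2.2 < 1 ->
    cone_geodesic (fun z => Y' z w) i.1 (ratr i.2.1) (ratr i.2.2)}.
  apply: ae_forall_countable => -[z [a b]] /=.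
  have [[a0 ab b1]|nh] := pselect [/\ 0 < a, a < b & b < 1]; last first.
    by apply: aeW => w a0 ab b1; case: nh.
  have : {ae P, forall w, cone_geodesic (fun z => Y' z w) z (ratr a : R) (ratr b)}.
    apply: (ae_cone_geodesic iY eY).
    - by rewrite ltr0q.
    - by rewrite ltr_rat.
    - by rewrite -(rmorph1 (ratr : rat -> R)) ltr_rat.
  by apply: filterS.
have h1 := ae_forall_countable (ae_first_step1 iY eY).
have h2 := ae_forall_countable (ae_first_step2 iY eY).
apply: filterS2 (filterI hU hC) (filterI h1 h2) => w [U C] [F1 F2].
apply: (geodesic_directions_of_cones U F1 F2) => z a b a0 ab b1.
exact: (C (z, (a, b))).
Qed.
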